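(* Let $d\geqslant2$. The diffraction measure of a primitive binary block substitution of constant size in dimension $d$ is always singular (with respect to Lebesgue measure). That is, let $n_1,\dots,n_d\geqslant2$ be integers, let $\varrho$ be a primitive substitution on the alphabet $\{0,1\}$ that maps each letter to an $n_1\times\cdots\times n_d$ block of letters, let $w\in\{0,1\}^{\mathbb{Z}^d}$ be an element of the hull of $\varrho$, and let $u_0,u_1\in\mathbb{C}$ be weights; then the diffraction measure $\widehat\gamma$ of the weighted Dirac comb $\omega=\sum_{x\in\mathbb{Z}^d}u_{w(x)}\,\delta_x$ has no absolutely continuous component.
   Context: A binary block substitution of constant size in $d$ dimensions has two types of unit cubes, white ($0$) and black ($1$), each of which is substituted into a block of the same shape $n_1\times\cdots\times n_d$ of such unit cubes. The corresponding linear expansion is $Q=\operatorname{diag}(n_1,\dots,n_d)$ with all $n_i\geqslant2$. The control point of a unit cube is its corner with minimal coordinates, so that tilings correspond to elements of $\{0,1\}^{\mathbb{Z}^d}$. The substitution is primitive if its $2\times2$ incidence matrix $M$, where $M_{ij}$ is the number of letters $i$ in $\varrho(j)$, is primitive (some power has only positive entries). The hull of $\varrho$ consists of all $w\in\{0,1\}^{\mathbb{Z}^d}$ all of whose finite patches occur in $\varrho^n(a)$ for some $n\in\mathbb{N}$ and some letter $a$. The autocorrelation of $\omega$ is the vague limit $\gamma=\lim_{r\to\infty}\frac{1}{(2r)^d}\,\omega_r*\widetilde{\omega_r}$, where $\omega_r$ is the restriction of $\omega$ to $[-r,r]^d$ and $\widetilde\mu(g)=\overline{\mu(\widetilde g)}$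 with $\widetilde g(x)=\overline{g(-x)}$. It exists and is the same for all elements of the hull. The diffraction measure is the Fourier transform $\widehat\gamma$. *)

(* Defs.v *)
From HB Require Import structures.
From mathcomp Require Import all_boot all_order all_algebra complex.
From mathcomp Require Import all_classical all_reals all_analysis.
From mathcomp Require Import measurable_realfun.

Set Implicit Arguments.
Unset Strict Implicit.
Unset Printing Implicit Defensive.

Import Order.TTheory GRing.Theory Num.Theory numFieldNormedType.Exports.

Local Open Scope classical_set_scope.
Local Open Scope ring_scope.
Local Open Scope complex_scope.

(* R^d with its Borel sigma-algebra *)
Notation borel_rV R d :=
  (g_sigma_algebraType [set U : set 'rV[R%type]_d | open U]).

Section LebesgueMeasure.
Context {R : realType}.

Let box n (q : 'rV[rat]_n) (k : nat) : set 'rV[R]_n :=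
  [set v | forall i, `|v 0 i - ratr (q 0 i)| < k.+1%:R^-1].

Let open_bigcup_box n (U : set 'rV[R]_n) : open U ->
  U = \bigcup_(p in [set p : 'rV[rat]_n * nat | box p.1 p.2 `<=` U])
        box p.1 p.2.
Proof.
move=> oU; apply/seteqP; split=> [v Uv|v [p /= pU] /pU//].
have /nbhs_ballP[e /= e0 eU] : nbhs v U by exact: open_nbhs_nbhs.
have [k ke] : exists k, k.+1%:R^-1 < e / 2.
  have e20 : 0 < e / 2 by rewrite divr_gt0.
  exists (Num.truncn (e / 2)^-1).
  by rewrite invf_plt ?posrE ?ltr0n// truncnS_gt.
have exq i : exists r : rat, `|v 0 i - ratr r| < k.+1%:R^-1.
  have k0 : 0 < k.+1%:R^-1 :> R by rewrite invr_gt0 ltr0n.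
  have /rat_in_itvoo[r] : v 0 i - k.+1%:R^-1 < v 0 i + k.+1%:R^-1.
    by rewrite ltrD2l gtrN.
  rewrite in_itv /= => /andP[h1 h2]; exists r.
  by rewrite ltr_distlC h1 h2.
pose q : 'rV[rat]_n := \row_i projT1 (cid (exq i)).
have bq : box q k v.
  by move=> i; rewrite mxE; exact: (projT2 (cid (exq i))).
exists (q, k) => //= v' bv'; apply: eU; split => // i j; rewrite ord1 /ball /=.
rewrite -(subrK (ratr (q 0 j)) (v 0 j)) -addrA (splitr e).
rewrite (le_lt_trans (ler_normD _ _))// ltrD//.
  exact: lt_trans (bq j) ke.
by rewrite distrC; exact: lt_trans (bv' j) ke.
Qed.

Lemma measurable_fun_rV d (T : measurableType d) n (f : T -> borel_rV R n) :
  (forall i, measurable_fun setT (fun t => f t 0 i : R)) ->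
  measurable_fun setT f.
Proof.
move=> mf; apply: (@measurability _ _ _ _ setT f [set U : set 'rV[R]_n | open U]) => //.
move=> _ [U oU <-]; rewrite setTI (open_bigcup_box oU) preimage_bigcup.
rewrite bigcup_mkcond; apply: countable_bigcupT_measurable => // -[q k].
case: ifP => _ //=.
rewrite (_ : _ @^-1` _ = \bigcap_(i in [set: 'I_n])
    ((fun t => f t 0 i) @^-1` ball (ratr (q 0 i) : R) k.+1%:R^-1)).
  apply: fin_bigcap_measurable => // i _; rewrite -[X in measurable X]setTI.
  by apply: mf => //; apply: open_measurable; exact: ball_open.
apply/seteqP; split=> t /= bt.
  by move=> i _; rewrite /ball /= distrC; exact: bt.
by move=> i; have := bt i I; rewrite /ball /= distrC.
Qed.

Lemma measurable_coord_rV n (i : 'I_n) :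
  measurable_fun setT (fun v : borel_rV R n => v 0 i : R).
Proof.
move=> mT; apply: (measurability _ (RGenOInfty.measurableE R)) => //.
move=> _ [_ [x ->] <-]; rewrite setTI; apply: sub_sigma_algebra.
apply: (@open_comp 'rV[R]_n R (fun v => v 0 i)).
  by move=> v _; exact: coord_continuous.
by rewrite set_itvE; exact: open_gt.
Qed.

Definition cons_rV n (p : measurableTypeR R * borel_rV R n) :
    borel_rV R n.+1 :=
  \row_i (if unlift ord0 i is Some j then (p.2 : 'rV[R]_n) 0 j else p.1).

Let uncons_rV n (v : borel_rV R n.+1) : measurableTypeR R * borel_rV R n :=
  (v 0 ord0, \row_i v 0 (lift ord0 i)).

Let cons_rVK n : cancel (@cons_rV n) (@uncons_rV n).
Proof.
move=> [x v]; rewrite /uncons_rV /cons_rV; congr pair.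
  by rewrite mxE unlift_none.
by apply/rowP => i; rewrite !mxE liftK.
Qed.

Lemma measurable_cons_rV n : measurable_fun setT (@cons_rV n).
Proof.
apply: measurable_fun_rV => i; case: (unliftP ord0 i) => [j|] ->.
  rewrite (_ : (fun _ => _) = (fun v : borel_rV R n => v 0 j) \o snd).
    by apply: measurableT_comp => //; exact: measurable_coord_rV.
  by apply/funext => p /=; rewrite mxE liftK.
rewrite (_ : (fun _ => _) = fst)//.
by apply/funext => p /=; rewrite mxE unlift_none.
Qed.

Let measurable_uncons_rV n : measurable_fun setT (@uncons_rV n).
Proof.
apply/measurable_fun_pairP; split.
  exact: (measurable_coord_rV ord0).
apply: measurable_fun_rV => i.
rewrite (_ : (fun _ => _) = (fun v : borel_rV R n.+1 => v 0 (lift ord0 i))).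
  exact: measurable_coord_rV.
by apply/funext => v; rewrite mxE.
Qed.

Section step.
Variables (n : nat) (mu : {sigma_finite_measure set (borel_rV R n) -> \bar R}).

Definition lebesgue_rV_step : set (borel_rV R n.+1) -> \bar R :=
  pushforward (lebesgue_measure \x mu)%E (@cons_rV n).

Let step0 : lebesgue_rV_step set0 = 0%E.
Proof. by apply: measure0; exact: measurable_cons_rV. Qed.

Let step_ge0 A : (0 <= lebesgue_rV_step A)%E.
Proof. by apply: measure_ge0; exact: measurable_cons_rV. Qed.

Let step_sigma_additive : semi_sigma_additive lebesgue_rV_step.
Proof.
by apply: measure_semi_sigma_additive; exact: measurable_cons_rV.
Qed.

HB.instance Definition _ := isMeasure.Build _ _ _ lebesgue_rV_step
  step0 step_ge0 step_sigma_additive.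

Let sigma_finite_step : sigma_finite setT lebesgue_rV_step.
Proof.
have /sigma_finiteP[F [FT ndF Foo]] := sigma_finiteT (@lebesgue_measure R).
have /sigma_finiteP[G [GT ndG Goo]] := sigma_finiteT mu.
exists (fun k => @uncons_rV n @^-1` (F k `*` G k)).
  rewrite predeqE => v; split=> // _.
  have [i _ Fi] : (\bigcup_k F k) (uncons_rV v).1 by rewrite -FT.
  have [j _ Gj] : (\bigcup_k G k) (uncons_rV v).2 by rewrite -GT.
  exists (maxn i j) => //; split.
    by move: Fi; exact/subsetPset/ndF/leq_maxl.
  by move: Gj; exact/subsetPset/ndG/leq_maxr.
move=> k; have [mF Fk] := Foo k; have [mG Gk] := Goo k; split.
  rewrite -[X in measurable X]setTI.
  by apply: measurable_uncons_rV => //; exact: measurableX.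
rewrite /lebesgue_rV_step /pushforward.
rewrite (_ : _ @^-1` _ = F k `*` G k); last first.
  apply/funext => p.
  by rewrite -[in RHS](cons_rVK p).
by rewrite product_measure1E// lte_mul_pinfty// ge0_fin_numE.
Qed.

HB.instance Definition _ :=
  Measure_isSigmaFinite.Build _ _ _ lebesgue_rV_step sigma_finite_step.

End step.

Fixpoint lebesgue_rV n : {sigma_finite_measure set (borel_rV R n) -> \bar R} :=
  if n is n'.+1 then lebesgue_rV_step (lebesgue_rV n')
  else \d_(0 : borel_rV R 0).

End LebesgueMeasure.

Section BlockSubstitution.
Variables (d : nat) (n : 'I_d -> nat).

Definition block_pos := {dffun forall i : 'I_d, 'I_(n i)}.

(* the letters 0 and 1 are the elements of 'I_2; rho a j is the letter at
   position j of the block rho(a) *)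
Definition block_substitution := 'I_2 -> block_pos -> 'I_2.

Definition incidence_matrix (rho : block_substitution) : 'M[nat]_2 :=
  \matrix_(i, j) #|[pred k : block_pos | rho j k == i]|.

Definition primitive_substitution (rho : block_substitution) :=
  exists k : nat, forall i j, (0 < (incidence_matrix rho ^+ k) i j)%N.

Hypothesis n_ge2 : forall i, (2 <= n i)%N.

Definition pos_mod (p : 'I_d -> nat) : block_pos :=
  [ffun i => Ordinal (ltn_pmod (p i) (ltnW (n_ge2 i)))].

(* the letter of rho^k(a) at position p; it is meaningful for
   p i < n i ^ k, and rho^(k+1)(a) = rho(rho^k(a)) *)
Fixpoint iter_substitution (rho : block_substitution) (k : nat) (a : 'I_2)
    (p : 'I_d -> nat) : 'I_2 :=
  if k is k'.+1 then
    rho (iter_substitution rho k' a (fun i => p i %/ n i)%N) (pos_mod p)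
  else a.

Definition in_hull (rho : block_substitution) (w : 'rV[int]_d -> 'I_2) :=
  forall F : set 'rV[int]_d, finite_set F ->
    exists (k : nat) (a : 'I_2) (t : 'rV[int]_d), forall x, F x ->
      exists p : 'I_d -> nat, [/\ forall i, (p i < n i ^ k)%N,
        forall i, (x + t) 0 i = (p i)%:Z &
        w x = iter_substitution rho k a p].

End BlockSubstitution.

Section ComplexIntegral.
Context {dsp : measure_display} {T : measurableType dsp} {R : realType}.
Variable mu : {measure set T -> \bar R}.

Definition complex_integrable (f : T -> R[i]) :=
  mu.-integrable setT (EFin \o (fun x => complex.Re (f x))) /\
  mu.-integrable setT (EFin \o (fun x => complex.Im (f x))).

Definition complex_integral (f : T -> R[i]) : R[i] :=
  (\int[mu]_x complex.Re (f x)) +i* (\int[mu]_x complex.Im (f x)).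

Definition mutually_singular (nu : {measure set T -> \bar R}) :=
  exists N, [/\ measurable N, nu N = 0%E & mu (~` N) = 0%E].

End ComplexIntegral.

Section Diffraction.
Context {R : realType} {d : nat}.
Implicit Types (f g : 'rV[R]_d -> R[i]) (k x : 'rV[R]_d).

Definition Cc g :=
  continuous (g : 'rV[R]_d -> R[i]^o) /\
  exists2 K : set 'rV[R]_d, compact K & forall x, ~ K x -> g x = 0.

(* a complex Radon measure, as the functional on Cc it induces *)
Definition functional := ('rV[R]_d -> R[i]) -> R[i].

Definition tilde_fun g : 'rV[R]_d -> R[i] := fun x => (g (- x))^*.

Definition tilde_functional (mu : functional) : functional :=
  fun g => (mu (tilde_fun g))^*.

Definition conv_functional (mu nu : functional) : functional :=
  fun g => mu (fun x => nu (fun y => g (x + y))).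

(* the restriction to A of the Dirac comb with weights c *)
Definition dirac_comb (c : 'rV[int]_d -> R[i]) (A : set 'rV[int]_d) :
    functional :=
  fun g => \sum_(x \in A) c x * g (map_mx intr x).

Definition cube (r : R) : set 'rV[int]_d :=
  [set x | forall i, `|(x 0 i)%:~R : R| <= r].

Definition is_autocorrelation (c : 'rV[int]_d -> R[i]) (gamma : functional) :=
  forall g, Cc g ->
    (((2 * r) ^- d)%:C * conv_functional (dirac_comb c (cube r))
       (tilde_functional (dirac_comb c (cube r))) g : R[i]^o) @[r --> +oo] -->
    (gamma g : R[i]^o).

Definition expi k x : R[i] :=
  let t := 2 * pi * \sum_i k 0 i * x 0 i in cos t +i* sin t.

Definition inverse_fourier g k : R[i] :=
  complex_integral (lebesgue_rV d) (fun x => expi k x * g x).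

Definition convolution f g x : R[i] :=
  complex_integral (lebesgue_rV d) (fun y => f y * g (x - y)).

(* The Fourier transform of a possibly unbounded measure gamma, in the sense of
   Argabright and Gil de Lamadrid: gamma^(h^vee) = gamma(h) for h = f * g with
   f, g in Cc. For a positive definite gamma this is the measure given by the
   Bochner-Schwartz theorem. *)
Definition is_fourier_transform (gamma : functional)
    (gammahat : {measure set (borel_rV R d) -> \bar R}) :=
  (forall K : set 'rV[R]_d, compact K -> (gammahat K < +oo)%E) /\
  forall f g, Cc f -> Cc g ->
    let h := convolution f g in
    complex_integrable gammahat (inverse_fourier h) /\
    complex_integral gammahat (inverse_fourier h) = gamma h.

End Diffraction.

(* Main.v *)
Require Import Defs.
From mathcomp Require Import all_boot all_order all_algebra complex.
From mathcomp Require Import all_classical all_reals all_analysis.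
From mathcomp Require Import measurable_realfun.
From mathcomp Require Import ring lra zify.

(* Write the weights as u(a) = alpha + beta s(a) with signs s(a) = 1, -1.
   Desubstituting K times writes s(w(x)) as a periodic function of x plus a
   coefficient e_K(x) times the sign of the ancestor letter. The Fourier sum of
   e_K over a block is, up to conjugation, the product E_K(k) of Q(n^i k) over
   i < K, where n = diag(n_1, ..., n_d) and Q is the sum of eps_j exp(2 pi i j k)
   over the positions j of the block; here eps_j is 1 or -1 if the letters of
   rho(0) and rho(1) at j differ, and 0 otherwise. Let N = n_1 ... n_d.

   Test the diffraction measure against |P|^2 for the trigonometric polynomial
   P = (1 - |E_K|^2 / N^(2K))^m (1 - D), where D is an average of characters over
   periods of the periodic part. The factor 1 - D kills the periodic part up to
   boundary terms, and x (1 - x)^(2m) <= 1 / (2m) bounds the rest. It follows that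
   the diffraction measure is small where |E_K|^2 / N^K is small.

   Since N >= 2, the function |Q|^2 / N has mean less than 1 or is not constant, so
   its square root lies below a trigonometric polynomial v of mean less than 1. The
   factors of the product of v(n^(2i) k) over i < q do not interact, hence its mean
   is the q-th power of the mean of v. Therefore |E_K|^2 / N^K is small outside a
   set of small Lebesgue measure, and Borel-Cantelli yields the null set that
   carries the diffraction measure. *)

Set Implicit Arguments.
Unset Strict Implicit.
Unset Printing Implicit Defensive.

Import Order.TTheory GRing.Theory Num.Theory numFieldNormedType.Exports.

Local Open Scope classical_set_scope.
Local Open Scope ring_scope.
Local Open Scope complex_scope.

(** * Lebesgue measure on R^d *)

(** If [rho] of 0 and [rho] of 1 differ at every position, |E_K|^2 / N^K has mean 1 for all K and
    Markov's inequality is void; its square root does decay in mean. The frequencies of v are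
    bounded by 2 (n_i - 1), which is not below n_i but is below n_i^2: hence dilations by n^2, and K
    = 2q with even and odd factors of E_K kept apart.

    The exponent m has two tasks: N^K / m, which bounds the surviving sign part, must be small, yet
    (1 - x)^m with x = |E_K|^2 / N^(2K) must stay away from 0 on the good set. There |E_K|^2 / N^K
    is at most T^-4, and m = N^K T^2 makes both N^K / m and m x at most T^-2. All parameters are
    fixed before the window grows, so boundary terms vanish in the limit.

    The Fourier transform is given only through convolutions of compactly supported functions. Tents
    too narrow for their convolutions to reach another lattice point turn it into integrals of
    trigonometric polynomials with a weight Phi^2. This weight is known to be positive only near
    frequency 0, so ever narrower tents are used, with exceptional sets that do not depend on the
    tent. *)

Section LebesgueRV.
Context {R : realType}.

Let lambda : {measure set (measurableTypeR R) -> \bar R} := lebesgue_measure.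

(** By induction on the dimension. The image of the product measure under the map [T] of both
    factors agrees with it on rectangles, so uniqueness of the product measure applies. Translations
    and the reflection x -> -x are instances. *)
Lemma lebesgue_rV_coordwise n (tau : 'I_n -> measurableTypeR R -> measurableTypeR R) :
  (forall i, measurable_fun setT (tau i)) ->
  (forall i A, measurable A -> lambda (tau i @^-1` A) = lambda A) ->
  forall A : set (borel_rV R n), measurable A ->
    lebesgue_rV n ((fun v : 'rV[R]_n => \row_i tau i (v 0 i) : 'rV[R]_n) @^-1` A) =
      lebesgue_rV n A.
Proof.
elim: n tau => [|n IH] tau mtau tau_inv A mA.
  by congr (lebesgue_rV 0 _); apply/funext => v /=; congr A; apply/rowP => -[].
have mrow k (t : 'I_k -> measurableTypeR R -> measurableTypeR R) :
    (forall i, measurable_fun setT (t i)) ->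
    measurable_fun setT (fun v : borel_rV R k => \row_i t i (v 0 i) : borel_rV R k).
  move=> mt; apply: measurable_fun_rV => i.
  rewrite (_ : (fun _ => _) = t i \o (fun v : borel_rV R k => v 0 i)); last first.
    by apply/funext => v /=; rewrite mxE.
  exact: (measurableT_comp (mt i) (measurable_coord_rV i)).
pose tau' i := tau (lift ord0 i).
pose T (p : measurableTypeR R * borel_rV R n) : measurableTypeR R * borel_rV R n :=
  (tau ord0 p.1, \row_i tau' i (p.2 0 i)).
have mT : measurable_fun setT T.
  apply/measurable_fun_pairP; split.
    exact: (measurableT_comp (mtau ord0) measurable_fst).
  rewrite (_ : _ \o _ = (fun v : borel_rV R n => \row_i tau' i (v 0 i) : borel_rV R n) \o snd)//.
  apply: measurableT_comp => //.
  by apply: mrow => i; exact: mtau.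
have mC : measurable (@cons_rV R n @^-1` A).
  by rewrite -[X in measurable X]setTI; apply: measurable_cons_rV.
rewrite /= /lebesgue_rV_step /pushforward.
have -> : @cons_rV R n @^-1` ((fun v : 'rV[R]_n.+1 => \row_i tau i (v 0 i) : 'rV[R]_n.+1) @^-1` A) =
    T @^-1` (@cons_rV R n @^-1` A).
  apply/funext => -[x v] /=; congr A; apply/rowP => i.
  by rewrite !mxE; case: unliftP => [j ->|->]; rewrite ?mxE ?unlift_none ?liftK ?mxE.
pose m' : {measure set (measurableTypeR R * borel_rV R n) -> \bar R} :=
  pushforward (lebesgue_measure \x lebesgue_rV n)%E T.
rewrite -[LHS]/(m' mT (@cons_rV R n @^-1` A)).
apply/esym/product_measure_unique => // B C mB mC'.
rewrite /m' /= /pushforward.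
have -> : T @^-1` (B `*` C) = (tau ord0 @^-1` B) `*` ((fun v : borel_rV R n => \row_i tau' i (v 0 i) : borel_rV R n) @^-1` C).
  by apply/seteqP; split.
rewrite product_measure1E.
- by rewrite tau_inv// IH// => i; [exact: mtau|exact: tau_inv].
- by rewrite -[X in measurable X]setTI; apply: mtau.
- rewrite -[X in measurable X]setTI; apply: mrow => // i; exact: mtau.
Qed.

Lemma lebesgue_measureD (b : R) (A : set (measurableTypeR R)) : measurable A ->
  lambda ((fun x => x + b) @^-1` A) = lambda A.
Proof.
move=> mA; have mf : measurable_fun setT ((fun x => x + b) : measurableTypeR R -> measurableTypeR R).
  by apply: measurable_funD.
pose m' : {measure set (measurableTypeR R) -> \bar R} := pushforward lambda ((fun x => x + b) : measurableTypeR R -> measurableTypeR R).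
rewrite -[LHS]/(m' mf A); apply/esym/lebesgue_measure_unique => //= _ [[x y]] _ <-.
rewrite /m' /= /pushforward.
have -> : (fun x0 => x0 + b) @^-1` [set` `]x, y]] = [set` `](x - b), (y - b)]] :> set R.
  by apply/seteqP; split => z; rewrite /= !in_itv /= ltrBlDr lerBrDr.
by rewrite /lambda !lebesgue_measure_itv /= !lte_fin ltrD2r -!EFinB opprB addrA subrK.
Qed.

Lemma continuous_measurable_rV n (f : 'rV[R]_n -> R) :
  continuous f -> measurable_fun setT (f : borel_rV R n -> R).
Proof.
move=> cf mT; apply: (measurability _ (RGenOInfty.measurableE R)) => //.
move=> _ [_ [x ->] <-]; rewrite setTI; apply: sub_sigma_algebra.
apply: (@open_comp 'rV[R]_n R f); first by move=> v _; exact: cf.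
by rewrite set_itvE; exact: open_gt.
Qed.

Section pushforward_invariance.
Context n (T : borel_rV R n -> borel_rV R n).
Hypothesis mT : measurable_fun setT T.
Hypothesis T_inv : forall A, measurable A ->
  lebesgue_rV n (T @^-1` A) = lebesgue_rV n A.

Lemma Rintegral_invariant (f : borel_rV R n -> R) : measurable_fun setT f ->
  (lebesgue_rV n).-integrable setT (EFin \o (f \o T)) ->
  \int[lebesgue_rV n]_x f (T x) = \int[lebesgue_rV n]_x f x.
Proof.
move=> mf if_; rewrite /Rintegral; congr fine.
rewrite -[LHS](integral_pushforward mT (mu := lebesgue_rV n) (f := EFin \o f) (D := setT)) //.
- by apply: eq_measure_integral => // A mA _; exact: T_inv.
- exact/measurable_EFinP.
Qed.

Lemma integrable_invariant (f : borel_rV R n -> R) : measurable_fun setT f ->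
  (lebesgue_rV n).-integrable setT (EFin \o f) ->
  (lebesgue_rV n).-integrable setT (EFin \o (f \o T)).
Proof.
move=> mf if_; apply/integrableP; split.
  by apply/measurable_EFinP; exact: measurableT_comp.
move/integrableP : if_ => [_]; apply: le_lt_trans.
rewrite -[leLHS](ge0_integral_pushforward mT (lebesgue_rV n) (f := fun x => `|(f x)%:E|%E) (D := setT)) //.
  by rewrite le_eqVlt; apply/orP; left; apply/eqP; apply: eq_measure_integral => // A mA _; apply: T_inv.
by apply: measurableT_comp => //; exact/measurable_EFinP.
Qed.

End pushforward_invariance.

Lemma measurable_funD_rV n (z : 'rV[R]_n) :
  measurable_fun setT ((fun x => x + z) : borel_rV R n -> borel_rV R n).
Proof.
apply: measurable_fun_rV => i.
rewrite (_ : (fun _ => _) = (fun x : borel_rV R n => x 0 i + z 0 i)); last first.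
  by apply/funext => x; rewrite mxE.
by apply: measurable_funD => //; exact: measurable_coord_rV.
Qed.

Lemma measurable_funN_rV n :
  measurable_fun setT ((fun x => - x) : borel_rV R n -> borel_rV R n).
Proof.
apply: measurable_fun_rV => i.
rewrite (_ : (fun _ => _) = (fun x : borel_rV R n => - x 0 i)); last first.
  by apply/funext => x; rewrite mxE.
by apply: measurable_funN; exact: measurable_coord_rV.
Qed.

Lemma lebesgue_rVD n (z : 'rV[R]_n) (A : set (borel_rV R n)) : measurable A ->
  lebesgue_rV n ((fun x => x + z) @^-1` A) = lebesgue_rV n A.
Proof.
move=> mA.
rewrite -[RHS](@lebesgue_rV_coordwise n (fun i (x : R) => x + z 0 i)) //.
- by congr (lebesgue_rV n _); apply/funext => v /=; congr (A _); apply/rowP => i; rewrite !mxE.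
- by move=> i; apply: measurable_funD.
- by move=> i B mB; exact: lebesgue_measureD.
Qed.

Lemma lebesgue_rVN n (A : set (borel_rV R n)) : measurable A ->
  lebesgue_rV n ((fun x => - x) @^-1` A) = lebesgue_rV n A.
Proof.
move=> mA.
rewrite -[RHS](@lebesgue_rV_coordwise n (fun i (x : R) => - x)) //.
- by congr (lebesgue_rV n _); apply/funext => v /=; congr (A _); apply/rowP => i; rewrite !mxE.
- by move=> i; exact: oppr_measurable.
- by move=> i B mB; rewrite -[RHS](lebesgue_measureN mB).
Qed.

Definition cbox n (a : R) : set (borel_rV R n) := [set v | forall i, -a <= v 0 i <= a].

Lemma measurable_cbox n a : measurable (@cbox n a).
Proof.
rewrite (_ : @cbox n a = \bigcap_(i in [set: 'I_n]) ((fun v => v 0 i) @^-1` `[-a, a])).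
  apply: fin_bigcap_measurable => // i _; rewrite -[X in measurable X]setTI.
  by apply: measurable_coord_rV.
apply/seteqP; split => v /= h; first by move=> i _; rewrite /= in_itv /=.
by move=> i; have := h i I; rewrite /= in_itv.
Qed.

Lemma cons_rV_cbox n a : @cons_rV R n @^-1` cbox a = `[-a, a] `*` cbox a.
Proof.
apply/seteqP; split => -[x v] /=.
  move=> h; split=> [|i]; first by have := h ord0; rewrite mxE unlift_none /= in_itv.
  by have := h (lift ord0 i); rewrite mxE liftK.
by move=> [+ h] i; rewrite in_itv /= mxE; case: unliftP => [j _|].
Qed.

Lemma lebesgue_rV_cbox n (a : R) : 0 <= a ->
  lebesgue_rV n (cbox a) = ((2 * a) ^+ n)%:E.
Proof.
move=> a0; elim: n => [|n IH].
  by rewrite /= diracE mem_set// => -[].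
rewrite /= /lebesgue_rV_step /pushforward cons_rV_cbox product_measure1E //; last first.
  exact: measurable_cbox.
rewrite IH exprS EFinM; congr (_ * _)%E.
rewrite -[LHS]/(@lebesgue_measure R [set` `[-a, a]]) lebesgue_measure_itv /= lte_fin.
case: ltP => [_|h]; first by rewrite -EFinB opprK; congr (_%:E); ring.
by have -> : a = 0 by [lra|]; rewrite mulr0.
Qed.

End LebesgueRV.

(** * Integrals of characters over boxes *)

Section TrigIntegral.
Context {R : realType}.

Lemma sin_2pi_int (z : int) (m : nat) : sin (2 * pi * z%:~R * m%:R : R) = 0.
Proof.
have H k : sin (2 * pi * k%:R : R) = 0.
  elim: k => [|k IH]; first by rewrite mulr0 sin0.
  rewrite (_ : 2 * pi * k.+1%:R = 2 * pi * k%:R + pi *+ 2); first by rewrite sinD2pi.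
  by rewrite -natr1 -mulr_natr; ring.
case: z => k; first by rewrite -mulrA -natrM H.
by rewrite NegzE mulrNz mulrN mulNr sinN -mulrA -natrM H oppr0.
Qed.

Lemma integral_cos (c m : R) : 0 < m -> c != 0 ->
  \int[lebesgue_measure]_(x in `[-m, m]) cos (c * x) = 2 * sin (c * m) / c.
Proof.
move=> m0 c0.
have cF : continuous (fun x : R => sin (c * x) / c).
  move=> x; apply: cvgM; last exact: cvg_cst.
  apply: (@continuous_comp _ _ _ ( *%R c) sin); last exact: continuous_sin.
  exact: mulrl_continuous.
have dF (x : R) : is_derive x 1 (fun x => sin (c * x) / c) (cos (c * x)).
  apply: is_derive_eq.
  by rewrite scaler0 add0r -[LHS]/(c^-1 * (cos (c * x) * (c * 1))) mulr1 mulrCA mulVf ?mulr1.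
rewrite /Rintegral (@continuous_FTC2 _ _ (fun x => sin (c * x) / c)) /=; first last.
- by move=> x _; rewrite derive1E derive_val.
- split => [x _| |]; first exact: ex_derive.
  + by apply: cvg_at_right_filter; exact: cF.
  + by apply: cvg_at_left_filter; exact: cF.
- apply: continuous_subspaceT => x.
  apply: (@continuous_comp _ _ _ ( *%R c) cos); last exact: continuous_cos.
  exact: mulrl_continuous.
- by rewrite gtrN.
by rewrite mulrN sinN; field.
Qed.

Lemma integral_sin (c m : R) : 0 < m -> c != 0 ->
  \int[lebesgue_measure]_(x in `[-m, m]) sin (c * x) = 0.
Proof.
move=> m0 c0.
have cF : continuous (fun x : R => cos (c * x) / - c).
  move=> x; apply: cvgM; last exact: cvg_cst.
  apply: (@continuous_comp _ _ _ ( *%R c) cos); last exact: continuous_cos.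
  exact: mulrl_continuous.
have dF (x : R) : is_derive x 1 (fun x => cos (c * x) / - c) (sin (c * x)).
  apply: is_derive_eq.
  rewrite scaler0 add0r -[LHS]/((- c)^-1 * (- sin (c * x) * (c * 1))).
  by rewrite mulr1 mulNr -mulrN mulrCA mulVf ?mulr1 ?oppr_eq0.
rewrite /Rintegral (@continuous_FTC2 _ _ (fun x => cos (c * x) / - c)) /=; first last.
- by move=> x _; rewrite derive1E derive_val.
- split => [x _| |]; first exact: ex_derive.
  + by apply: cvg_at_right_filter; exact: cF.
  + by apply: cvg_at_left_filter; exact: cF.
- apply: continuous_subspaceT => x.
  apply: (@continuous_comp _ _ _ ( *%R c) sin); last exact: continuous_sin.
  exact: mulrl_continuous.
- by rewrite gtrN.
by rewrite mulrN cosN subrr.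
Qed.

Lemma integral_cos_2pi (z : int) (m : nat) : (0 < m)%N ->
  \int[lebesgue_measure]_(x in `[-(m%:R), m%:R]) cos (2 * pi * (x * z%:~R)) =
    (2 * m%:R * (z == 0)%:R : R).
Proof.
move=> m0; have [->|z0] := eqVneq z 0.
  under eq_Rintegral do rewrite mulr0 mulr0 cos0.
  rewrite Rintegral_cst // -[X in fine X]/(@lebesgue_measure R [set` `[-(m%:R), m%:R]]) lebesgue_measure_itv /= lte_fin gtrN ?ltr0n// mul1r mulr1.
  by rewrite -EFinB /=; ring.
under eq_Rintegral do rewrite [_ * z%:~R]mulrC mulrA.
rewrite integral_cos ?ltr0n//; last by rewrite !mulf_neq0 ?pnatr_eq0 ?intr_eq0 ?(lt0r_neq0 (pi_gt0 R)).
by rewrite sin_2pi_int !(mulr0, mul0r).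
Qed.

Lemma integral_sin_2pi (z : int) (m : nat) : (0 < m)%N ->
  \int[lebesgue_measure]_(x in `[-(m%:R), m%:R]) sin (2 * pi * (x * z%:~R)) = 0 :> R.
Proof.
move=> m0; have [->|z0] := eqVneq z 0.
  by under eq_Rintegral do rewrite mulr0 mulr0 sin0; rewrite Rintegral_cst // mul0r.
under eq_Rintegral do rewrite [_ * z%:~R]mulrC mulrA.
by rewrite integral_sin ?ltr0n// !mulf_neq0 ?pnatr_eq0 ?intr_eq0 ?(lt0r_neq0 (pi_gt0 R)).
Qed.

Definition tail_rV n (w : 'rV[R]_n.+1) : 'rV[R]_n := \row_i w 0 (lift ord0 i).

Lemma measurable_tail_rV n :
  measurable_fun setT (@tail_rV n : borel_rV R n.+1 -> borel_rV R n).
Proof.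
apply: measurable_fun_rV => i.
rewrite (_ : (fun _ => _) = (fun v : borel_rV R n.+1 => v 0 (lift ord0 i))).
  exact: measurable_coord_rV.
by apply/funext => v; rewrite mxE.
Qed.

(** Fubini transported along [cons_rV], for inductions on the dimension. Integrals over boxes are
    covered by cutting [a] and [b] off to 0. *)
Lemma Rintegral_rV_prod n (a : measurableTypeR R -> R) (b : borel_rV R n -> R) :
  lebesgue_measure.-integrable setT (EFin \o a) ->
  (lebesgue_rV n).-integrable setT (EFin \o b) ->
  let f := fun w : borel_rV R n.+1 => a (w 0 ord0) * b (tail_rV w) in
  (lebesgue_rV n.+1).-integrable setT (EFin \o f) /\
  \int[lebesgue_rV n.+1]_w f w =
    (\int[lebesgue_measure]_x a x) * \int[lebesgue_rV n]_v b v.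
Proof.
move=> ia ib f.
have ma : measurable_fun setT a by apply/measurable_EFinP; exact: measurable_int ia.
have mb : measurable_fun setT b by apply/measurable_EFinP; exact: measurable_int ib.
have mf : measurable_fun setT f.
  apply: measurable_funM.
    exact: (measurableT_comp ma (measurable_coord_rV ord0)).
  exact: (measurableT_comp mb (@measurable_tail_rV n)).
pose g (p : measurableTypeR R * borel_rV R n) := a p.1 * b p.2.
have fg : f \o @cons_rV R n = g.
  apply/funext => -[x v]; rewrite /f /g /= mxE unlift_none; congr (_ * b _).
  by apply/rowP => i; rewrite !mxE liftK.
have mg : measurable_fun setT g.
  apply: measurable_funM; first exact: (measurableT_comp ma measurable_fst).
  exact: (measurableT_comp mb measurable_snd).
have ig : (lebesgue_measure \x lebesgue_rV n)%E.-integrable setT (EFin \o g).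
  apply/integrable12ltyP; first exact/measurable_EFinP.
  pose B : \bar R := (\int[lebesgue_rV n]_v `|(EFin \o b) v|)%E.
  have Boo : (B < +oo)%E by move/integrableP : ib => [].
  have B0 : (0 <= B)%E by exact: integral_ge0.
  have E x : (\int[lebesgue_rV n]_v `|(EFin \o g) (x, v)| = B * `|a x|%:E)%E.
    rewrite muleC -ge0_integralZl//; last first.
      by apply/measurable_EFinP; exact: measurableT_comp.
    by apply: eq_integral => v _ /=; rewrite normrM EFinM.
  under eq_integral do rewrite E.
  rewrite ge0_integralZl//; last first.
    by apply/measurable_EFinP; exact: measurableT_comp.
  rewrite lte_mul_pinfty ?ge0_fin_numE//.
  by move/integrableP : ia => [].
have mfE : measurable_fun setT (EFin \o f) by exact/measurable_EFinP.
have igf : (lebesgue_measure \x lebesgue_rV n)%E.-integrable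
    (@cons_rV R n @^-1` setT) ((EFin \o f) \o @cons_rV R n).
  by rewrite preimage_setT -compA fg.
have If : (\int[lebesgue_rV n.+1]_w (EFin \o f) w =
    \int[lebesgue_measure]_x \int[lebesgue_rV n]_v (EFin \o g) (x, v))%E.
  rewrite integral12_prod_meas1//.
  rewrite -fg; have := integral_pushforward (@measurable_cons_rV R n) mfE igf measurableT.
  by rewrite preimage_setT.
split; first exact: (integrable_pushforward (@measurable_cons_rV R n) mfE igf measurableT).
rewrite /Rintegral If.
have E x : (\int[lebesgue_rV n]_v (EFin \o g) (x, v) = (a x * \int[lebesgue_rV n]_v b v)%:E)%E.
  rewrite EFinM /Rintegral fineK; last exact: integrable_fin_num.
  by rewrite -integralZl//; apply: eq_integral => v _ /=; rewrite EFinM.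
transitivity (\int[lebesgue_measure]_x (a x * \int[lebesgue_rV n]_v b v)).
  by congr fine; apply: eq_integral => x _; exact: E.
by rewrite RintegralZr.
Qed.

Lemma lebesgue_rV_cbox_lty n (a : R) : 0 <= a -> (lebesgue_rV n (@cbox R n a) < +oo)%E.
Proof. by move=> a0; rewrite lebesgue_rV_cbox// ltry. Qed.

Lemma integrable_cbox n (a M : R) (f : borel_rV R n -> R) : 0 <= a ->
  measurable_fun setT f -> (forall x, `|f x| <= M) ->
  (lebesgue_rV n).-integrable (cbox a) (EFin \o f).
Proof.
move=> a0 mf fM; apply: measurable_bounded_integrable.
- exact: measurable_cbox.
- exact: lebesgue_rV_cbox_lty.
- exact: measurable_funTS.
- exists M; split; first exact: num_real.
  by move=> y My x _; exact: (le_trans (fM x) (ltW My)).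
Qed.

Lemma Rintegral_cbox_cst n (a r : R) : 0 <= a ->
  \int[lebesgue_rV n]_(x in cbox a) r = r * (2 * a) ^+ n.
Proof.
move=> a0; transitivity (r * fine (lebesgue_rV n (@cbox R n a))).
  by apply: Rintegral_cst; exact: measurable_cbox.
by rewrite lebesgue_rV_cbox.
Qed.

Definition dotz n (v : 'rV[R]_n) (z : 'rV[int]_n) : R := \sum_i v 0 i * (z 0 i)%:~R.

Lemma measurable_dotz n z : measurable_fun setT (fun v : borel_rV R n => dotz v z).
Proof.
by apply: measurable_sum => i; apply: measurable_funM => //; exact: measurable_coord_rV.
Qed.

Lemma measurable_cos_dotz n z :
  measurable_fun setT (fun v : borel_rV R n => cos (2 * pi * dotz v z)).
Proof.
apply: (measurableT_comp (continuous_measurable_fun (@continuous_cos R))).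
by apply: measurable_funM => //; exact: measurable_dotz.
Qed.

Lemma measurable_sin_dotz n z :
  measurable_fun setT (fun v : borel_rV R n => sin (2 * pi * dotz v z)).
Proof.
apply: (measurableT_comp (continuous_measurable_fun (@continuous_sin R))).
by apply: measurable_funM => //; exact: measurable_dotz.
Qed.

Lemma cos_normr_le1 (x : R) : `|cos x| <= 1.
Proof. by rewrite ler_norml cos_geN1 cos_le1. Qed.

Lemma sin_normr_le1 (x : R) : `|sin x| <= 1.
Proof. by rewrite ler_norml sin_geN1 sin_le1. Qed.

(** Cosine and sine are treated together because the addition formulas mix them in the induction.
    The value is exact because the side 2m is a whole number of periods. *)
Lemma Rintegral_cbox_dotz n (z : 'rV[int]_n) (m : nat) : (0 < m)%N ->
  \int[lebesgue_rV n]_(v in cbox m%:R) cos (2 * pi * dotz v z) =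
    (2 * m%:R) ^+ n * (z == 0)%:R :> R /\
  \int[lebesgue_rV n]_(v in cbox m%:R) sin (2 * pi * dotz v z) = 0 :> R.
Proof.
move=> m0; elim: n z => [|n IH] z.
  have d0 (v : 'rV[R]_0) : dotz v z = 0 by rewrite /dotz big_ord0.
  under eq_Rintegral do rewrite d0 mulr0 cos0.
  under [X in _ /\ X = _]eq_Rintegral do rewrite d0 mulr0 sin0.
  rewrite !Rintegral_cbox_cst// mul0r mul1r (_ : z = 0) ?eqxx ?mulr1//.
  by apply/rowP => -[].
pose z' : 'rV[int]_n := \row_i z 0 (lift ord0 i).
pose I := `[-(m%:R), m%:R]%classic : set R.
pose a1 := (fun x : R => cos (2 * pi * (x * (z 0 ord0)%:~R))) \_ I.
pose a2 := (fun x : R => sin (2 * pi * (x * (z 0 ord0)%:~R))) \_ I.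
pose b1 := (fun v : borel_rV R n => cos (2 * pi * dotz v z')) \_ (cbox m%:R).
pose b2 := (fun v : borel_rV R n => sin (2 * pi * dotz v z')) \_ (cbox m%:R).
have m0' : 0 <= m%:R :> R by [].
have ib1 : (lebesgue_rV n).-integrable setT (EFin \o b1).
  rewrite -restrict_EFin -integrable_mkcond; last exact: measurable_cbox.
  by apply: integrable_cbox => //; [exact: measurable_cos_dotz|move=> ?; exact: cos_normr_le1].
have ib2 : (lebesgue_rV n).-integrable setT (EFin \o b2).
  rewrite -restrict_EFin -integrable_mkcond; last exact: measurable_cbox.
  by apply: integrable_cbox => //; [exact: measurable_sin_dotz|move=> ?; exact: sin_normr_le1].
have ia1 : (@lebesgue_measure R).-integrable setT (EFin \o a1).
  rewrite -restrict_EFin -integrable_mkcond; last exact: measurable_itv.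
  apply: continuous_compact_integrable; first exact: segment_compact.
  apply: continuous_subspaceT => x.
  apply: (@continuous_comp _ _ _ (fun x : R => 2 * pi * (x * (z 0 ord0)%:~R) : R) cos); last exact: continuous_cos.
  by apply: continuousM; [exact: cst_continuous|exact: mulrr_continuous].
have ia2 : (@lebesgue_measure R).-integrable setT (EFin \o a2).
  rewrite -restrict_EFin -integrable_mkcond; last exact: measurable_itv.
  apply: continuous_compact_integrable; first exact: segment_compact.
  apply: continuous_subspaceT => x.
  apply: (@continuous_comp _ _ _ (fun x : R => 2 * pi * (x * (z 0 ord0)%:~R) : R) sin); last exact: continuous_sin.
  by apply: continuousM; [exact: cst_continuous|exact: mulrr_continuous].
have [i11 E11] := Rintegral_rV_prod ia1 ib1.
have [i22 E22] := Rintegral_rV_prod ia2 ib2.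
have [i12 E12] := Rintegral_rV_prod ia1 ib2.
have [i21 E21] := Rintegral_rV_prod ia2 ib1.
have [IH1 IH2] := IH z'.
have A1 := integral_cos_2pi (z 0 ord0) m0.
have A2 := integral_sin_2pi (z 0 ord0) m0.
rewrite Rintegral_mkcond in IH1; rewrite Rintegral_mkcond in IH2.
rewrite Rintegral_mkcond in A1; rewrite Rintegral_mkcond in A2.
rewrite Rintegral_mkcond [X in _ /\ X = _]Rintegral_mkcond.
have dz (w : 'rV[R]_n.+1) : dotz w z = w 0 ord0 * (z 0 ord0)%:~R + dotz (tail_rV w) z'.
  rewrite /dotz big_ord_recl; congr (_ + _); apply: eq_bigr => i _; by rewrite !mxE.
have cb (w : borel_rV R n.+1) : (w \in cbox m%:R) = (w 0 ord0 \in I) && (tail_rV w \in cbox m%:R).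
  apply/idP/andP => [/set_mem h|[/set_mem h0 /set_mem h]].
    split; apply/mem_set; first by rewrite /I /= in_itv /=; exact: h.
    by move=> i; rewrite mxE; exact: h.
  apply/mem_set => i; case: (unliftP ord0 i) => [j ->|->].
    by have := h j; rewrite mxE.
  by move: h0; rewrite /I /= in_itv.
split.
  transitivity (\int[lebesgue_rV n.+1]_w (a1 (w 0 ord0) * b1 (tail_rV w) - a2 (w 0 ord0) * b2 (tail_rV w))).
    apply: eq_Rintegral => w _; rewrite /a1 /a2 /b1 /b2 /patch cb.
    case: ifP => [/andP[-> ->]|]; first by rewrite dz mulrDr cosD.
    by move/negbT; rewrite negb_and => /orP[] /negbTE ->; rewrite ?(mul0r, mulr0, subrr).
  rewrite RintegralB// E11 E22 A1 IH1 A2 mul0r subr0.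
  rewrite mulrACA -exprS; congr (_ * _); rewrite -natrM mulnb; congr (nat_of_bool _)%:R.
  apply/andP/eqP => [[/eqP z0 /eqP z'0]|z0].
    apply/rowP => i; rewrite mxE; case: (unliftP ord0 i) => [j ->|-> //].
    by have /rowP/(_ j) := z'0; rewrite !mxE.
  by split; apply/eqP; [|apply/rowP => i]; rewrite ?mxE z0 mxE.

transitivity (\int[lebesgue_rV n.+1]_w (a2 (w 0 ord0) * b1 (tail_rV w) + a1 (w 0 ord0) * b2 (tail_rV w))).
  apply: eq_Rintegral => w _; rewrite /a1 /a2 /b1 /b2 /patch cb.
  case: ifP => [/andP[-> ->]|]; first by rewrite dz mulrDr sinD.
  by move/negbT; rewrite negb_and => /orP[] /negbTE ->; rewrite ?(mul0r, mulr0, addr0).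
by rewrite RintegralD// E12 E21 IH2 A2 mul0r mulr0 addr0.
Qed.

End TrigIntegral.

(** * Trigonometric polynomials and their means *)

Section ComplexIntegralOn.
Context {dsp : measure_display} {T : measurableType dsp} {R : realType}.
Variables (mu : {measure set T -> \bar R}) (D : set T) (mD : measurable D).
Implicit Types (f g : T -> R[i]) (c : R[i]).

(** The notions of the statement relative to a domain [D]: boxes for [mean], and [setT] for the
    diffraction measure, where they unfold to [complex_integrable] and [complex_integral]. *)
Definition cintegrable f :=
  mu.-integrable D (EFin \o (fun x => complex.Re (f x))) /\
  mu.-integrable D (EFin \o (fun x => complex.Im (f x))).

Definition cint f : R[i] :=
  (\int[mu]_(x in D) complex.Re (f x)) +i* (\int[mu]_(x in D) complex.Im (f x)).

Lemma ReD (x y : R[i]) : complex.Re (x + y) = complex.Re x + complex.Re y.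
Proof. by case: x; case: y. Qed.

Lemma ImD (x y : R[i]) : complex.Im (x + y) = complex.Im x + complex.Im y.
Proof. by case: x; case: y. Qed.

Lemma ReM (x y : R[i]) :
  complex.Re (x * y) = complex.Re x * complex.Re y - complex.Im x * complex.Im y.
Proof. by case: x; case: y. Qed.

Lemma ImM (x y : R[i]) :
  complex.Im (x * y) = complex.Re x * complex.Im y + complex.Im x * complex.Re y.
Proof. by case: x; case: y. Qed.

Lemma cintegrableD f g : cintegrable f -> cintegrable g -> cintegrable (fun x => f x + g x).
Proof.
move=> [f1 f2] [g1 g2]; split.
  rewrite (_ : _ \o _ = (EFin \o (fun x => complex.Re (f x))) \+ (EFin \o (fun x => complex.Re (g x))))%E.
    exact: integrableD.
  by apply/funext => x /=; rewrite ReD EFinD.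
rewrite (_ : _ \o _ = (EFin \o (fun x => complex.Im (f x))) \+ (EFin \o (fun x => complex.Im (g x))))%E.
  exact: integrableD.
by apply/funext => x /=; rewrite ImD EFinD.
Qed.

Lemma cintD f g : cintegrable f -> cintegrable g ->
  cint (fun x => f x + g x) = cint f + cint g.
Proof.
move=> [f1 f2] [g1 g2]; rewrite /cint.
under eq_Rintegral do rewrite ReD.
under [X in _ +i* X = _]eq_Rintegral do rewrite ImD.
by rewrite !RintegralD.
Qed.

Let iZ (k : R) (h : T -> R) : mu.-integrable D (EFin \o h) ->
  mu.-integrable D (EFin \o (fun x => k * h x)).
Proof.
move=> ih; rewrite (_ : _ \o _ = (fun x => k%:E * (EFin \o h) x))%E.
  exact: integrableZl.
by apply/funext => x /=; rewrite EFinM.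
Qed.

Lemma cintegrableZ c f : cintegrable f -> cintegrable (fun x => c * f x).
Proof.
move=> [f1 f2]; split.
  rewrite (_ : _ \o _ = (EFin \o (fun x => complex.Re c * complex.Re (f x))%R) \- (EFin \o (fun x => complex.Im c * complex.Im (f x))%R))%E.
    by apply: integrableB => //; exact: iZ.
  by apply/funext => x /=; rewrite ReM EFinB.
rewrite (_ : _ \o _ = (EFin \o (fun x => complex.Re c * complex.Im (f x))%R) \+ (EFin \o (fun x => complex.Im c * complex.Re (f x))%R))%E.
  by apply: integrableD => //; exact: iZ.
by apply/funext => x /=; rewrite ImM EFinD.
Qed.

Lemma cintZ c f : cintegrable f -> cint (fun x => c * f x) = c * cint f.
Proof.
move=> [f1 f2]; rewrite /cint.
under eq_Rintegral do rewrite ReM.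
under [X in _ +i* X = _]eq_Rintegral do rewrite ImM.
rewrite RintegralB ?RintegralD ?RintegralZl//; try exact: iZ.
by case: c.
Qed.

Lemma cintegrable0 : cintegrable (fun=> 0).
Proof. by split; exact: integrable0. Qed.

Lemma cint0 : cint (fun=> 0) = 0.
Proof. by rewrite /cint /= !Rintegral_cst// !mul0r. Qed.

Lemma cint_sum I (s : seq I) (c : I -> R[i]) (f : I -> T -> R[i]) :
  (forall i, cintegrable (f i)) ->
  cintegrable (fun x => \sum_(i <- s) c i * f i x) /\
  cint (fun x => \sum_(i <- s) c i * f i x) = \sum_(i <- s) c i * cint (f i).
Proof.
move=> If; elim: s => [|i s [IH1 IH2]].
  rewrite big_nil; under eq_fun do rewrite big_nil.
  by split; [exact: cintegrable0|exact: cint0].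
rewrite big_cons; under eq_fun do rewrite big_cons.
have ? := cintegrableZ (c i) (If i).
by split; [exact: cintegrableD|rewrite cintD// cintZ// IH2].
Qed.

(** In the order on [R[i]], 0 <= z includes that z is real, so the imaginary part of the integrand
    vanishes. *)
Lemma cint_ge0 f : (forall x, D x -> 0 <= f x) -> 0 <= cint f.
Proof.
move=> f0; rewrite lecE /=; apply/andP; split.
  rewrite (@eq_Rintegral _ _ _ mu D (fun=> 0)); first by rewrite Rintegral_cst// mul0r.
  by move=> x /set_mem /f0 /ger0_Im.
by apply: Rintegral_ge0 => x /f0; rewrite lecE => /andP[].
Qed.

Lemma eq_cint f g : (forall x, D x -> f x = g x) -> cint f = cint g.
Proof. by move=> fg; congr Complex; apply: eq_Rintegral => x /set_mem/fg ->. Qed.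

End ComplexIntegralOn.

Section RealComplex.
Context {R : realType}.
Implicit Types x y : R.

Lemma rcD x y : (x + y)%:C = x%:C + y%:C. Proof. exact: rmorphD. Qed.
Lemma rcB x y : (x - y)%:C = x%:C - y%:C. Proof. exact: rmorphB. Qed.
Lemma rcM x y : (x * y)%:C = x%:C * y%:C. Proof. exact: rmorphM. Qed.
Lemma rcX x k : (x ^+ k)%:C = x%:C ^+ k. Proof. exact: rmorphXn. Qed.
Lemma rcV x : (x^-1)%:C = (x%:C)^-1. Proof. exact: fmorphV. Qed.
Lemma rc_nat k : (k%:R : R)%:C = k%:R. Proof. exact: rmorph_nat. Qed.

Lemma rc_ge0 (z : R[i]) : 0 <= z -> z = (complex.Re z)%:C.
Proof. by move=> z0; rewrite RRe_real// ger0_real. Qed.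

End RealComplex.

Section TrigPoly.
Context {R : realType} {d : nat}.
Local Notation V := ('rV[R]_d).
Local Notation C := (R[i]).
Implicit Types (f g : V -> C) (z : 'rV[int]_d) (k : V) (c : C).

Definition chi z k : C := expi k (map_mx intr z).

Arguments chi : simpl never.

Lemma chiE z k : chi z k = cos (2 * pi * dotz k z) +i* sin (2 * pi * dotz k z).
Proof.
rewrite /chi /expi (_ : \sum_i _ = dotz k z)//.
by apply: eq_bigr => i _; rewrite mxE.
Qed.

Lemma expiD (k x y : V) : expi k (x + y) = expi k x * expi k y.
Proof.
rewrite /expi; simpc; rewrite (_ : \sum_i k 0 i * (x + y) 0 i = \sum_i k 0 i * x 0 i + \sum_i k 0 i * y 0 i).
  by rewrite mulrDr cosD sinD; congr Complex; rewrite addrC [X in X + _]mulrC.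
by rewrite -big_split; apply: eq_bigr => i _; rewrite mxE mulrDr.
Qed.

Lemma expi0 k : expi k 0 = 1.
Proof.
rewrite /expi big1 ?mulr0 ?cos0 ?sin0//; by move=> i _; rewrite mxE mulr0.
Qed.

Lemma expiN (k x : V) : expi k (- x) = conjc (expi k x).
Proof.
rewrite /expi (_ : \sum_i k 0 i * (- x) 0 i = - \sum_i k 0 i * x 0 i).
  by rewrite mulrN cosN sinN.
by rewrite -sumrN; apply: eq_bigr => i _; rewrite mxE mulrN.
Qed.

Lemma chiD z z' k : chi (z + z') k = chi z k * chi z' k.
Proof. by rewrite /chi map_mxD expiD. Qed.

Lemma chi0 k : chi 0 k = 1.
Proof. by rewrite /chi map_mx0 expi0. Qed.

Lemma chiN z k : chi (- z) k = conjc (chi z k).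
Proof. by rewrite /chi map_mxN expiN. Qed.

Lemma sqnormE c : `|c| ^+ 2 = c * conjc c.
Proof. by rewrite normcE sqr_sqrtc. Qed.

Lemma conjcM (x y : C) : conjc (x * y) = conjc x * conjc y.
Proof. exact: rmorphM. Qed.

Lemma conjcD (x y : C) : conjc (x + y) = conjc x + conjc y.
Proof. exact: rmorphD. Qed.

Lemma conjcB (x y : C) : conjc (x - y) = conjc x - conjc y.
Proof. exact: rmorphB. Qed.

Lemma conjc_sum I (s : seq I) (F : I -> C) :
  conjc (\sum_(i <- s) F i) = \sum_(i <- s) conjc (F i).
Proof. exact: rmorph_sum. Qed.

Lemma chi_norm z k : `|chi z k| = 1.
Proof.
apply/eqP; rewrite -(@eqrXn2 _ 2)//; apply/eqP.
by rewrite sqnormE -chiN -chiD subrr chi0 expr1n.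
Qed.

(** Trigonometric polynomials with integer frequencies. A frequency may occur several times in the
    list, so sums and products need no normal form. *)
Definition tp f := exists s : seq (C * 'rV[int]_d),
  forall k, f k = \sum_(p <- s) p.1 * chi p.2 k.

Lemma tp_ext f g : f =1 g -> tp f -> tp g.
Proof. by move=> fg [s fs]; exists s => k; rewrite -fg fs. Qed.

Lemma tp_chi z : tp (chi z).
Proof. by exists [:: (1, z)] => k; rewrite big_seq1 mul1r. Qed.

Lemma tp_cst c : tp (fun=> c).
Proof. by exists [:: (c, 0)] => k; rewrite big_seq1 chi0 mulr1. Qed.

Lemma tpD f g : tp f -> tp g -> tp (fun k => f k + g k).
Proof. by move=> [s fs] [s' gs]; exists (s ++ s') => k; rewrite big_cat /= fs gs. Qed.

Lemma tpM f g : tp f -> tp g -> tp (fun k => f k * g k).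
Proof.
move=> [s fs] [s' gs].
exists [seq (p.1 * q.1, p.2 + q.2) | p <- s, q <- s'] => k.
rewrite fs gs big_allpairs_dep mulr_suml; apply: eq_bigr => p _.
by rewrite mulr_sumr; apply: eq_bigr => q _; rewrite /= chiD mulrACA.
Qed.

Lemma tpN f : tp f -> tp (fun k => - f k).
Proof. by move=> /(tpM (tp_cst (-1))); apply: tp_ext => k; rewrite mulN1r. Qed.

Lemma tpB f g : tp f -> tp g -> tp (fun k => f k - g k).
Proof. by move=> tf /tpN; exact: tpD. Qed.

Lemma tpX f n : tp f -> tp (fun k => f k ^+ n).
Proof.
move=> tf; elim: n => [|n IH]; first exact: tp_cst.
by apply: tp_ext (tpM tf IH) => k; rewrite exprS.
Qed.

Lemma tp_conj f : tp f -> tp (fun k => conjc (f k)).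
Proof.
move=> [s fs]; exists [seq (conjc p.1, - p.2) | p <- s] => k.
by rewrite fs big_map rmorph_sum; apply: eq_bigr => p _; rewrite /= rmorphM chiN.
Qed.

Lemma tp_sqnorm f : tp f -> tp (fun k => `|f k| ^+ 2).
Proof.
by move=> tf; apply: tp_ext (tpM tf (tp_conj tf)) => k; rewrite sqnormE.
Qed.

Lemma tp_sum I (s : seq I) (F : I -> V -> C) :
  (forall i, tp (F i)) -> tp (fun k => \sum_(i <- s) F i k).
Proof.
move=> tF; elim: s => [|i s IH].
  by apply: tp_ext (tp_cst 0) => k; rewrite big_nil.
by apply: tp_ext (tpD (tF i) IH) => k; rewrite big_cons.
Qed.

(* [dil n] is the paper's expansion diag(n) acting on frequencies, [dilz n] the
   same map acting on positions. *)
Definition dil (L : 'I_d -> nat) k : V := \row_i ((L i)%:R * k 0 i).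
Definition dilz (L : 'I_d -> nat) z : 'rV[int]_d := \row_i ((L i)%:Z * z 0 i).

Lemma chi_dil L z k : chi z (dil L k) = chi (dilz L z) k.
Proof.
rewrite !chiE; suff -> : dotz (dil L k) z = dotz k (dilz L z) by [].
apply: eq_bigr => i _; rewrite !mxE intrM; by rewrite mulrAC mulrC mulrA.
Qed.

Lemma tp_dil L f : tp f -> tp (fun k => f (dil L k)).
Proof.
move=> [s fs]; exists [seq (p.1, dilz L p.2) | p <- s] => k.
by rewrite fs big_map; apply: eq_bigr => p _; rewrite /= chi_dil.
Qed.

(** For every m > 0 this is exactly the constant Fourier coefficient of a trigonometric polynomial
    ([mean_chi]). All m are kept because Lebesgue measure is later estimated inside every box. *)
Definition mean (m : nat) f : C :=
  ((2 * m%:R) ^+ d)^-1 * cint (lebesgue_rV d) (cbox m%:R) (f : borel_rV R d -> C).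

Lemma cintegrable_chi (m : nat) z :
  cintegrable (lebesgue_rV d) (cbox m%:R) (chi z : borel_rV R d -> C).
Proof.
split.
  rewrite (_ : _ \o _ = EFin \o (fun k : borel_rV R d => cos (2 * pi * dotz k z))).
    apply: integrable_cbox => //; first exact: measurable_cos_dotz.
    by move=> k; exact: cos_normr_le1.
  by apply/funext => k; congr (_%:E); rewrite chiE.
rewrite (_ : _ \o _ = EFin \o (fun k : borel_rV R d => sin (2 * pi * dotz k z))).
  apply: integrable_cbox => //; first exact: measurable_sin_dotz.
  by move=> k; exact: sin_normr_le1.
by apply/funext => k; congr (_%:E); rewrite chiE.
Qed.

Lemma cintegrable_tp (m : nat) f : tp f ->
  cintegrable (lebesgue_rV d) (cbox m%:R) (f : borel_rV R d -> C).
Proof.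
move=> [s fs]; rewrite (_ : f = fun k => \sum_(p <- s) p.1 * chi p.2 k); last first.
  exact/funext.
have [|//] := @cint_sum _ _ _ (lebesgue_rV d) _ (@measurable_cbox R d m%:R) _ s (fun p => p.1) (fun p => chi p.2).
by move=> p; exact: cintegrable_chi.
Qed.

Section mean.
Variable (m : nat) (m0 : (0 < m)%N).

Lemma mean_chi z : mean m (chi z) = (z == 0)%:R.
Proof.
have [H1 H2] := @Rintegral_cbox_dotz R d z m m0.
rewrite /mean (_ : cint _ _ _ = ((2 * m%:R) ^+ d * (z == 0)%:R) +i* 0); last first.
  by congr Complex; rewrite -?H1 -?H2; apply: eq_Rintegral => k _; rewrite chiE.
rewrite complexr0 rmorphM rmorphXn rmorphM !rmorph_nat mulKf//.
by rewrite expf_neq0 ?mulf_neq0 ?pnatr_eq0 -?lt0n.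
Qed.

Lemma meanD f g : tp f -> tp g -> mean m (fun k => f k + g k) = mean m f + mean m g.
Proof.
move=> tf tg; rewrite /mean cintD ?mulrDr//; first exact: measurable_cbox.
- exact: cintegrable_tp.
- exact: cintegrable_tp.
Qed.

Lemma meanZ c f : tp f -> mean m (fun k => c * f k) = c * mean m f.
Proof.
move=> tf; rewrite /mean cintZ 1?mulrCA//; first exact: measurable_cbox.
exact: cintegrable_tp.
Qed.

Lemma mean_sum I (s : seq I) (c : I -> C) (F : I -> V -> C) :
  (forall i, tp (F i)) ->
  mean m (fun k => \sum_(i <- s) c i * F i k) = \sum_(i <- s) c i * mean m (F i).
Proof.
move=> tF; have [|_ E] := @cint_sum _ _ _ (lebesgue_rV d) _ (@measurable_cbox R d m%:R) I s c F.
  by move=> i; exact: cintegrable_tp.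
rewrite /mean E mulr_sumr; apply: eq_bigr => i _; by rewrite mulrCA.
Qed.

Lemma eq_mean f g : f =1 g -> mean m f = mean m g.
Proof. by move=> fg; congr mean; exact/funext. Qed.

Lemma mean_ge0 f : (forall k, 0 <= f k) -> 0 <= mean m f.
Proof.
move=> f0; rewrite /mean mulr_ge0 ?invr_ge0 ?exprn_ge0 ?mulr_ge0//.
by apply: cint_ge0; [exact: measurable_cbox|move=> ? _; exact: f0].
Qed.

Lemma mean_cst c : mean m (fun=> c) = c.
Proof.
transitivity (mean m (fun k => c * chi 0 k)).
  by apply: eq_mean => k; rewrite chi0 mulr1.
by rewrite meanZ ?mean_chi ?eqxx ?mulr1//; exact: tp_chi.
Qed.

Lemma mean_conj f : tp f -> mean m (fun k => conjc (f k)) = conjc (mean m f).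
Proof.
move=> [s fs].
transitivity (mean m (fun k => \sum_(p <- s) conjc p.1 * chi (- p.2) k)).
  by apply: eq_mean => k; rewrite fs conjc_sum; apply: eq_bigr => p _; rewrite conjcM chiN.
rewrite (eq_mean fs) !mean_sum; [|by move=> p; exact: tp_chi..].
rewrite conjc_sum; apply: eq_bigr => p _.
by rewrite conjcM !mean_chi oppr_eq0 conjc_nat.
Qed.

Lemma le_mean f g : tp f -> tp g -> (forall k, f k <= g k) -> mean m f <= mean m g.
Proof.
move=> tf tg fg; rewrite -subr_ge0 -mulN1r -meanZ// -meanD//.
  by apply: mean_ge0 => k; rewrite mulN1r subr_ge0.
by apply: tp_ext (tpN tf) => k; rewrite mulN1r.
Qed.

(** Parseval: after expanding the square, orthogonality of characters leaves only the diagonal. *)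
Lemma mean_sqnorm (I : eqType) (s : seq I) (h : I -> 'rV[int]_d) (a : I -> C) :
  uniq s -> {in s &, injective h} ->
  mean m (fun k => `|\sum_(x <- s) a x * chi (h x) k| ^+ 2) =
  \sum_(x <- s) `|a x| ^+ 2.
Proof.
move=> us hI.
transitivity (mean m (fun k => \sum_(x <- s) a x *
    (\sum_(y <- s) conjc (a y) * chi (h x - h y) k))).
  apply: eq_mean => k; rewrite sqnormE conjc_sum mulr_suml; apply: eq_bigr => x _.
  rewrite mulr_sumr mulr_sumr; apply: eq_bigr => y _.
  by rewrite conjcM -chiN chiD; ring.
rewrite mean_sum; last first.
  by move=> x; apply: tp_sum => y; apply: tpM; [exact: tp_cst|exact: tp_chi].
rewrite big_seq [RHS]big_seq; apply: eq_bigr => x xs.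
rewrite mean_sum; last by move=> y; exact: tp_chi.
rewrite (bigD1_seq x)//= mean_chi subrr eqxx mulr1 big_seq_cond big1 ?addr0 -?sqnormE// => y.
move=> /andP[ys yx]; rewrite mean_chi subr_eq0.
case: eqP => [hxy|]; last by rewrite mulr0.
by rewrite (hI _ _ xs ys hxy) eqxx in yx.
Qed.

End mean.
End TrigPoly.

(** * Desubstitution *)

Section Desubstitution.
Context {R : realType} {d : nat} (n : 'I_d -> nat) (n_ge2 : forall i, (2 <= n i)%N).
Variable rho : block_substitution n.
Local Notation C := (R[i]).
Local Notation Z := ('rV[int]_d).
Local Notation F := (@dil R d n).
Local Notation N := (#|{: block_pos n}|).

Definition blockvec (j : block_pos n) : Z := \row_i (j i : nat)%:Z.
(** Euclidean division by [n] in each coordinate. The remainder lies between 0 and n_i - 1, so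
    neither the absolute value in [blockrem] nor the second reduction inside [pos_mod] changes
    it. *)
Definition blockquo (X : Z) : Z := \row_i (X 0%R i %/ n i)%Z.
Definition blockrem (X : Z) : block_pos n := pos_mod n_ge2 (fun i => `|(X 0%R i %% n i)%Z|%N).

Let n_gt0 i : (0 < n i)%N. Proof. exact: ltnW. Qed.

Let nz_neq0 i : (n i)%:Z != 0. Proof. by rewrite -lt0n. Qed.

Lemma blockquo_blockrem X : X = dilz n (blockquo X) + blockvec (blockrem X).
Proof.
apply/rowP => i; rewrite !mxE ffunE /= modn_small; last first.
  by rewrite -ltz_nat gez0_abs ?modz_ge0 ?ltz_pmod// ltz_nat.
by rewrite gez0_abs ?modz_ge0// mulrC -divz_eq.
Qed.

Lemma blockquo_inflate y j : blockquo (dilz n y + blockvec j) = y.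
Proof.
apply/rowP => i; rewrite !mxE mulrC divzMDl// divz_small ?addr0//.
by rewrite lez_nat ltz_nat ltn_ord.
Qed.

Lemma blockrem_inflate y j : blockrem (dilz n y + blockvec j) = j.
Proof.
apply/ffunP => i; apply/val_inj; rewrite !ffunE /= !mxE mulrC modzMDl.
by rewrite modz_small ?absz_nat ?modn_small// lez_nat ltz_nat ltn_ord.
Qed.

Lemma blockquoD X v : blockquo (X + dilz n v) = blockquo X + v.
Proof. by rewrite {1}(blockquo_blockrem X) addrAC -[dilz n _ + _](_ : dilz n (blockquo X + v) = _) ?blockquo_inflate//; apply/rowP => i; rewrite !mxE mulrDr. Qed.

Lemma blockremD X v : blockrem (X + dilz n v) = blockrem X.
Proof. by rewrite {1}(blockquo_blockrem X) addrAC -[dilz n _ + _](_ : dilz n (blockquo X + v) = _) ?blockrem_inflate//; apply/rowP => i; rewrite !mxE mulrDr. Qed.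

(** The K-th iterate consists of the positions whose K-fold quotient lies in [Y]
    ([mem_iter_inflate]), a union of whole level-K blocks; a list, because it indexes Fourier
    sums. *)
Definition inflate (Y : seq Z) : seq Z :=
  [seq dilz n y + blockvec j | y <- Y, j <- enum {: block_pos n}].

Lemma mem_inflate Y X : (X \in inflate Y) = (blockquo X \in Y).
Proof.
apply/allpairsP/idP => [[[y j] /= [yY _ ->]]|XY]; first by rewrite blockquo_inflate.
by exists (blockquo X, blockrem X); rewrite /= mem_enum -blockquo_blockrem.
Qed.

Lemma uniq_inflate Y : uniq Y -> uniq (inflate Y).
Proof.
move=> uY; apply: allpairs_uniq => //; first exact: enum_uniq.
move=> [y j] [y' j'] _ _ /= E; congr pair.
  by rewrite -(blockquo_inflate y j) E blockquo_inflate.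
by rewrite -(blockrem_inflate y j) E blockrem_inflate.
Qed.

Lemma size_inflate Y : size (inflate Y) = (size Y * N)%N.
Proof. by rewrite size_allpairs -cardE. Qed.

Lemma mem_iter_inflate K Y X : (X \in iter K inflate Y) = (iter K blockquo X \in Y).
Proof. by elim: K X => //= K IH X; rewrite mem_inflate IH -iterSr. Qed.

Lemma uniq_iter_inflate K Y : uniq Y -> uniq (iter K inflate Y).
Proof. by move=> uY; elim: K => //= K IH; exact: uniq_inflate. Qed.

Lemma size_iter_inflate K Y : size (iter K inflate Y) = (size Y * N ^ K)%N.
Proof. by elim: K => [|K IH] /=; rewrite ?muln1// size_inflate IH expnSr mulnA. Qed.

(** Any bound on the diameter of a level-K block will do, since K is fixed while the window grows.
    One more level multiplies the distance by n_i and adds a difference of remainders below n_i. *)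
Lemma iter_blockquo_close K : exists L : nat, forall X X' : Z, iter K blockquo X = iter K blockquo X' ->
  forall i, (`|X 0 i - X' 0 i| <= L%:Z)%R.
Proof.
elim: K => [|K [L IH]]; first by exists 0%N => X X' /= -> i; rewrite subrr.
exists ((\sum_i n i) * L.+1)%N => X X'; rewrite !iterSr => /IH H i.
have := H i; rewrite !mxE => {}H.
have Hn : (n i <= \sum_i n i)%N by rewrite (bigD1 i)//= leq_addr.
rewrite (divz_eq (X 0 i) (n i)) (divz_eq (X' 0 i) (n i)).
have := modz_ge0 (X 0 i) (nz_neq0 i); have := modz_ge0 (X' 0 i) (nz_neq0 i).
have := @ltz_pmod (X 0 i) (n i) (n_gt0 i); have := @ltz_pmod (X' 0 i) (n i) (n_gt0 i).
move: H; set a := (_ %/ _)%Z; set b := (_ %/ _)%Z; set r := (_ %% _)%Z; set r' := (_ %% _)%Z.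
move: Hn; set S := (\sum_i n i)%N => Hn Hab.
move: Hn Hab; move: (n i) => m Hn Hab h1 h2 h3 h4.
apply: (@le_trans _ _ (m%:Z * L.+1%:Z)); last by rewrite -PoszM lez_nat leq_mul2r Hn orbT.
nia.
Qed.

Definition lsign (a : 'I_2) : C := (-1) ^+ a.
Definition eps (j : block_pos n) : C := (lsign (rho ord0 j) - lsign (rho ord_max j)) / 2.
Definition kap (j : block_pos n) : C := (lsign (rho ord0 j) + lsign (rho ord_max j)) / 2.

(** A function on two letters is affine in the sign. The linear part [eps] lives where the two
    blocks differ, the constant part [kap] where they agree. The binary alphabet enters here. *)
Lemma lsign_rho a j : lsign (rho a j) = eps j * lsign a + kap j.
Proof.
case: a => -[|[|//]] ha.
  rewrite (_ : Ordinal ha = ord0); last exact/val_inj.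
  by rewrite /eps /kap [X in _ * X + _]/lsign expr0; field.
rewrite (_ : Ordinal ha = ord_max); last exact/val_inj.
by rewrite /eps /kap [X in _ * X + _]/lsign expr1; field.
Qed.

Lemma lsign_norm a : `|lsign a| = 1.
Proof. by rewrite /lsign normrX normrN1 expr1n. Qed.

Lemma eps_norm j : `|eps j| <= 1.
Proof.
rewrite /eps normrM normfV normr_nat ler_pdivrMr// mul1r.
by rewrite (le_trans (ler_normB _ _))// !lsign_norm.
Qed.

Lemma kap_norm j : `|kap j| <= 1.
Proof.
rewrite /kap normrM normfV normr_nat ler_pdivrMr// mul1r.
by rewrite (le_trans (ler_normD _ _))// !lsign_norm.
Qed.

Lemma conj_eps j : conjc (eps j) = eps j.
Proof.
rewrite (_ : eps j = (((-1) ^+ rho ord0 j - (-1) ^+ rho ord_max j) / 2 : R)%:C) ?conjc_real//.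
by rewrite /eps /lsign rmorphM rmorphB !rmorphXn !rmorphN1 fmorphV rmorph_nat.
Qed.

(* Desubstituting [K] times turns the letter at [X], encoded as a sign, into
   [signpart K X + periodicpart K X]: the part [periodicpart] is periodic, and [signpart] is the product of a
   periodic coefficient with the sign of the ancestor letter. *)
Fixpoint signpart (g0 : Z -> C) (K : nat) (X : Z) : C :=
  if K is K'.+1 then eps (blockrem X) * signpart g0 K' (blockquo X) else g0 X.

Fixpoint periodicpart (K : nat) (X : Z) : C :=
  if K is K'.+1 then eps (blockrem X) * periodicpart K' (blockquo X) + kap (blockrem X) else 0.

Lemma signpart_norm g0 K X : (forall y, `|g0 y| <= 1) -> `|signpart g0 K X| <= 1.
Proof.
move=> g1; elim: K X => [|K IH] X //=.
by rewrite normrM mulr_ile1// eps_norm.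
Qed.

Lemma periodicpart_norm K X : `|periodicpart K X| <= K%:R.
Proof.
elim: K X => [|K IH] X /=; first by rewrite normr0.
rewrite (le_trans (ler_normD _ _))// -natr1 lerD ?kap_norm// normrM.
by rewrite (le_trans _ (IH (blockquo X)))// ler_piMl ?eps_norm.
Qed.

Lemma periodicpart_periodic K X v : periodicpart K (X + iter K (dilz n) v) = periodicpart K X.
Proof. by elim: K X => //= K IH X; rewrite blockquoD blockremD IH. Qed.

(** The recursion of [iter_substitution] peels off the last application of [rho] first, so K steps
    leave the letter of the m-th iterate at the K-fold quotient. [absz] returns from integer
    positions to natural ones; the quotients concerned are nonnegative. *)
Lemma lsign_iter_substitution (m K : nat) (a : 'I_2) (p : 'I_d -> nat) (X : Z) :
  (forall i, X 0 i = (p i)%:Z) ->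
  lsign (iter_substitution n_ge2 rho (K + m) a p) =
  signpart (fun y => lsign (iter_substitution n_ge2 rho m a (fun i => `|y 0%R i|%N))) K X + periodicpart K X.
Proof.
elim: K p X => [|K IH] p X Xp.
  by rewrite /= addr0; congr (lsign (iter_substitution _ _ _ _ _)); apply/funext => i; rewrite Xp.
rewrite /= lsign_rho (IH _ (blockquo X)); last by move=> i; rewrite mxE Xp divz_nat.
have <- : blockrem X = pos_mod n_ge2 p.
  by apply/ffunP => i; apply/val_inj; rewrite !ffunE /= Xp modz_nat absz_nat modn_mod.
by ring.
Qed.

(** The Q of the overview up to conjugation, as [eps] is real; [cocycle K] is E_K in the same
    sense. *)
Definition signpoly (k : 'rV[R]_d) : C := \sum_(j : block_pos n) eps j * chi (- blockvec j) k.

Fixpoint cocycle (K : nat) (k : 'rV[R]_d) : C :=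
  if K is K'.+1 then signpoly k * cocycle K' (F k) else 1.

Lemma sum_inflate (Y : seq Z) (b : Z -> C) k :
  \sum_(X <- inflate Y) eps (blockrem X) * b (blockquo X) * chi (- X) k =
  signpoly k * \sum_(y <- Y) b y * chi (- y) (F k).
Proof.
rewrite big_allpairs_dep mulr_sumr; apply: eq_bigr => y _.
rewrite big_enum /signpoly mulr_suml; apply: eq_bigr => j _.
rewrite blockrem_inflate blockquo_inflate chi_dil opprD chiD (_ : dilz n (- y) = - dilz n y); first by ring.
by apply/rowP => i; rewrite !mxE mulrN.
Qed.

(** On a whole level-K block the character splits into a factor for the position inside the block
    and one for the block itself; the former sum up to [cocycle K]. Windows are completed to whole
    blocks in order to use this. *)
Lemma sum_iter_inflate K Y g0 k :
  \sum_(X <- iter K inflate Y) signpart g0 K X * chi (- X) k =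
  cocycle K k * \sum_(y <- Y) g0 y * chi (- y) (iter K F k).
Proof.
elim: K k => [|K IH] k; first by rewrite /= mul1r.
by rewrite [iter K.+1 inflate Y]/= (sum_inflate _ (signpart g0 K)) IH iterSr mulrA.
Qed.

Lemma tp_signpoly : tp signpoly.
Proof. by apply: tp_sum => j; apply: tpM; [exact: tp_cst|exact: tp_chi]. Qed.

Lemma tp_cocycle K : tp (cocycle K).
Proof. elim: K => [|K IH] /=; [exact: tp_cst|exact: (tpM tp_signpoly (tp_dil n IH))]. Qed.

Lemma signpoly_norm k : `|signpoly k| <= N%:R.
Proof.
rewrite (le_trans (ler_norm_sum _ _ _))// -sum1_card natr_sum; apply: ler_sum => j _.
by rewrite normrM chi_norm mulr1 eps_norm.
Qed.

Lemma cocycle_norm K k : `|cocycle K k| <= N%:R ^+ K.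
Proof.
elim: K k => [|K IH] k /=; first by rewrite normr1 expr0.
by rewrite normrM exprS ler_pM ?signpoly_norm.
Qed.

End Desubstitution.

(** * Small values of the Fourier product *)

Section BoundedFrequencies.
Context {R : realType} {d : nat}.
Local Notation V := ('rV[R]_d).
Local Notation C := (R[i]).
Implicit Types (f g : V -> C) (b : 'I_d -> nat).

(** Unlike [tp], this records the size of the frequencies, which is what excludes interaction with a
    dilated polynomial in [mean_dil_mul]. *)
Definition tpb b f := exists s : seq (C * 'rV[int]_d),
  (forall p, p \in s -> forall i, `|p.2 0 i|%R <= (b i)%:Z) /\
  forall k, f k = \sum_(p <- s) p.1 * chi p.2 k.

Lemma tpb_tp b f : tpb b f -> tp f.
Proof. by move=> [s [_ fs]]; exists s. Qed.

Lemma tpb_ext b f g : f =1 g -> tpb b f -> tpb b g.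
Proof. by move=> fg [s [sb fs]]; exists s; split=> // k; rewrite -fg fs. Qed.

Lemma tpb_cst b c : tpb b (fun=> c).
Proof.
exists [:: (c, 0)]; split=> [p|k]; last by rewrite big_seq1 chi0 mulr1.
by rewrite inE => /eqP -> i; rewrite mxE normr0.
Qed.

Lemma tpbW b b' f : (forall i, (b i <= b' i)%N) -> tpb b f -> tpb b' f.
Proof.
move=> bb' [s [sb fs]]; exists s; split=> // p /sb H i.
by rewrite (le_trans (H i))// lez_nat.
Qed.

Lemma tpbD b f g : tpb b f -> tpb b g -> tpb b (fun k => f k + g k).
Proof.
move=> [s [sb fs]] [s' [sb' gs]]; exists (s ++ s'); split => [p|k].
  by rewrite mem_cat => /orP[/sb|/sb'].
by rewrite big_cat /= fs gs.
Qed.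

Lemma tpbM b b' f g : tpb b f -> tpb b' g ->
  tpb (fun i => b i + b' i)%N (fun k => f k * g k).
Proof.
move=> [s [sb fs]] [s' [sb' gs]].
exists [seq (p.1 * q.1, p.2 + q.2) | p <- s, q <- s']; split => [_ /allpairsP[[p q] /= [ps qs ->]] i|k].
  by rewrite mxE (le_trans (ler_normD _ _))// PoszD lerD ?sb ?sb'.
rewrite fs gs big_allpairs_dep mulr_suml; apply: eq_bigr => p _.
by rewrite mulr_sumr; apply: eq_bigr => q _; rewrite /= chiD mulrACA.
Qed.

Lemma tpbZ b c f : tpb b f -> tpb b (fun k => c * f k).
Proof. by move=> /(tpbM (tpb_cst (fun=> 0%N) c)); apply: tpbW => i. Qed.

(* No frequency of [f] other than 0 is cancelled by one of [g \o dil L], so that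
   only the two constant terms survive. *)
Lemma mean_dil_mul (m : nat) b (L : 'I_d -> nat) f g : (0 < m)%N ->
  (forall i, (b i < L i)%N) -> tpb b f -> tp g ->
  mean m (fun k => f k * g (dil L k)) = mean m f * mean m g.
Proof.
move=> m0 bL [s [sb fs]] [s' gs].
transitivity (mean m (fun k => \sum_(p <- s) p.1 * (\sum_(q <- s') q.1 * chi (p.2 + dilz L q.2) k))).
  apply: eq_mean => k; rewrite fs gs mulr_suml; apply: eq_bigr => p _.
  rewrite -mulrA; congr (_ * _); rewrite mulr_sumr; apply: eq_bigr => q _.
  by rewrite chi_dil chiD mulrCA.
rewrite (eq_mean _ fs) (eq_mean _ gs) !mean_sum//; last first.
- by move=> p; apply: tp_sum => q; apply: tpM; [exact: tp_cst|exact: tp_chi].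
- by move=> p; exact: tp_chi.
- by move=> p; exact: tp_chi.
rewrite mulr_suml [LHS]big_seq [RHS]big_seq; apply: eq_bigr => p ps.
rewrite -mulrA; congr (_ * _); rewrite mean_sum//; last by move=> q; exact: tp_chi.
rewrite mulr_sumr; apply: eq_bigr => q _.
rewrite !mean_chi// mulrCA -natrM mulnb; congr (_ * (nat_of_bool _)%:R).
apply/eqP/andP => [pq|[/eqP p0 /eqP q0]]; last first.
  by rewrite p0 q0 add0r; apply/rowP => i; rewrite !mxE mulr0.
(* In each coordinate L_i |q_i| = |p_i| <= b_i < L_i, so q_i = 0. *)
have q0 : q.2 = 0.
  apply/rowP => i; rewrite mxE.
  have /rowP/(_ i) := pq; rewrite !mxE => /eqP.
  rewrite addr_eq0 => /eqP pq'.
  have := sb _ ps i; rewrite pq' normrN normrM.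
  have := bL i; move: (L i) (b i) (q.2 _ i) => l b' x ? ; apply: contraTeq => x0.
  by rewrite -ltNge; nia.
split; apply/eqP => //; rewrite -pq q0.
by apply/rowP => i; rewrite !mxE mulr0 addr0.
Qed.

Lemma mean_dil (m : nat) (L : 'I_d -> nat) g : (0 < m)%N ->
  (forall i, (0 < L i)%N) -> tp g -> mean m (fun k => g (dil L k)) = mean m g.
Proof.
move=> m0 L0 tg; transitivity (mean m (fun k => 1 * g (dil L k))).
  by apply: eq_mean => k; rewrite mul1r.
by rewrite (mean_dil_mul m0 L0 (tpb_cst _ _))// mean_cst// mul1r.
Qed.

Lemma tpb_sqnorm_sum (I : eqType) (s : seq I) (a : I -> C) (h : I -> 'rV[int]_d) b :
  (forall x y, x \in s -> y \in s -> forall i, `|h x 0 i - h y 0 i|%R <= (b i)%:Z) ->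
  tpb b (fun k => `|\sum_(x <- s) a x * chi (h x) k| ^+ 2).
Proof.
move=> hb; exists [seq (a x * conjc (a y), h x - h y) | x <- s, y <- s]; split.
  by move=> _ /allpairsP[[x y] /= [xs ys ->]] i; rewrite !mxE hb.
move=> k; rewrite sqnormE conjc_sum mulr_suml big_allpairs_dep; apply: eq_bigr => x _.
rewrite mulr_sumr; apply: eq_bigr => y _.
by rewrite conjcM -chiN /= chiD; ring.
Qed.

End BoundedFrequencies.

(** * A majorant of mean less than 1 for the square root of |Q|^2 / N *)

Section SubmultiplicativeBound.
Context {R : realType} {d : nat} (n : 'I_d -> nat) (n_ge2 : forall i, (2 <= n i)%N).
Hypothesis d_gt0 : (0 < d)%N.
Variable rho : block_substitution n.
Local Notation C := (R[i]).
Local Notation F := (@dil R d n).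
Local Notation N := (#|{: block_pos n}|).
Local Notation signpoly := (@signpoly R d n rho).
Local Notation eps := (@eps R d n rho).

Let n_gt0 i : (0 < n i)%N. Proof. exact: ltnW. Qed.

Definition pos_min : block_pos n := [ffun i => Ordinal (n_gt0 i)].

Let ltn_pred i : ((n i).-1 < n i)%N. Proof. by rewrite prednK. Qed.

Definition pos_max : block_pos n := [ffun i => Ordinal (ltn_pred i)].

Lemma card_block_pos_ge2 : (2 <= N)%N.
Proof.
rewrite ltnNge; apply/negP => /fintype_le1P H.
have /ffunP/(_ (Ordinal d_gt0)) := H pos_min pos_max.
rewrite !ffunE => /(congr1 val) /=.
by have := n_ge2 (Ordinal d_gt0); case: (n _) => [|[]].
Qed.

Lemma blockvec_inj : injective (@blockvec d n).
Proof.
move=> j j' /rowP E; apply/ffunP => i; apply/val_inj.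
by have := E i; rewrite !mxE => -[].
Qed.

(** Normalised so that its mean is the proportion of positions at which the two blocks differ, hence
    at most 1. *)
Definition signdensity (k : 'rV[R]_d) : C := `|signpoly k| ^+ 2 / N%:R.

(* A trigonometric polynomial between [sqrt signdensity] and
   [(1 + signdensity) / 2]: the mean of the latter is at most 1, and the
   quadratic correction makes it strictly smaller. *)
Definition majorant (k : 'rV[R]_d) : C := (1 + signdensity k) / 2 - (1 - signdensity k) ^+ 2 / (8 * N%:R).

Lemma majorant_ge k : 0 <= majorant k /\ signdensity k <= majorant k ^+ 2.
Proof.
have N2 : 2 <= N%:R :> R by rewrite ler_nat card_block_pos_ge2.
have N0 : 0 < N%:R :> R by rewrite (lt_le_trans _ N2).
pose r := complex.Re `|signpoly k|.
have rE : `|signpoly k| = r%:C by rewrite RRe_real// normr_real.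
have r0 : 0 <= r by rewrite -ler0c -rE.
have rN : r <= N%:R by rewrite -lecR -rE rc_nat; exact: signpoly_norm.
pose s := r / Num.sqrt N%:R.
have s0 : 0 <= s by rewrite divr_ge0 ?sqrtr_ge0.
have sE : s ^+ 2 = r ^+ 2 / N%:R by rewrite expr_div_n sqr_sqrtr ?ltW.
have sN : s ^+ 2 <= N%:R.
  by rewrite sE ler_pdivrMr// -expr2 lerXn2r// nnegrE.
have gE : signdensity k = (s ^+ 2)%:C.
  by rewrite sE /signdensity rE rcM rcV rc_nat rcX.
have vE : majorant k = ((1 + s ^+ 2) / 2 - (1 - s ^+ 2) ^+ 2 / (8 * N%:R))%:C.
  by rewrite /majorant gE rcB (rcM _ 2^-1) (rcM _ (8 * N%:R)^-1) !rcV (rcM 8) (rcX (1 - s ^+ 2)) rcB rcD !rc_nat.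
have H : s <= (1 + s ^+ 2) / 2 - (1 - s ^+ 2) ^+ 2 / (8 * N%:R).
  rewrite -subr_ge0.
  (* With s the square root of [signdensity], (1 + s^2)/2 - s = (1 - s)^2 / 2 and 1 - s^2 = (1 -
     s)(1 + s). The constant 8N is large enough: (1 + s)^2 <= 2 (1 + s^2) <= 2 + 2N <= 4N. *)
  rewrite (_ : _ - _ = (1 - s) ^+ 2 * (4 * N%:R - (1 + s) ^+ 2) / (8 * N%:R)); last first.
    by field; rewrite gt_eqF.
  apply: divr_ge0; last by rewrite mulr_ge0// ltW.
  apply: mulr_ge0; first exact: sqr_ge0.
  rewrite subr_ge0.
  have := sqr_ge0 (1 - s); nra.
rewrite vE gE ler0c -rcX lecR; split; first exact: le_trans H.
by rewrite lerXn2r// nnegrE (le_trans _ H).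
Qed.

Lemma tpb_signdensity : tpb (fun i => (n i).-1) signdensity.
Proof.
rewrite /signdensity; apply: tpb_ext (tpbZ (N%:R^-1) (tpb_sqnorm_sum (s := index_enum _) eps (h := fun j => - blockvec j) (b := fun i => (n i).-1) _)).
  by move=> k; rewrite mulrC.
move=> x y _ _ i; rewrite !mxE.
have := ltn_ord (x i); have := ltn_ord (y i); have := n_gt0 i.
by move: (x i : nat) (y i : nat) => a b; move: (n i) => c; lia.
Qed.

Lemma tpb_majorant : tpb (fun i => (n i).-1 + (n i).-1)%N majorant.
Proof.
have t1 := tpb_signdensity.
have t2 : tpb (fun i => (n i).-1) (fun k => 1 - signdensity k).
  apply: tpb_ext (tpbD (tpb_cst _ 1) (tpbZ (-1) t1)) => k; by rewrite mulN1r.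
have t3 := tpbM t2 t2.
have t4 : tpb (fun i => (n i).-1 + (n i).-1)%N (fun k => 1 + signdensity k).
  apply: tpbD; first exact: tpb_cst.
  by apply: tpbW t1 => i; exact: leq_addr.
apply: tpb_ext (tpbD (tpbZ 2^-1 t4) (tpbZ (- (8 * N%:R)^-1) t3)) => k.
by rewrite /majorant mulrC; congr (_ + _); rewrite mulNr mulrC expr2.
Qed.

Lemma mean_signdensity (m : nat) : (0 < m)%N -> mean m signdensity = (\sum_j `|eps j| ^+ 2) / N%:R.
Proof.
move=> m0; transitivity (mean m (fun k => N%:R^-1 * `|signpoly k| ^+ 2)).
  by apply: eq_mean => k; rewrite mulrC.
rewrite meanZ//; last exact/tp_sqnorm/tp_signpoly.
rewrite mulrC mean_sqnorm//; first exact: index_enum_uniq.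
by move=> x y _ _ /oppr_inj/blockvec_inj.
Qed.

Lemma mean_signdensity_le1 (m : nat) : (0 < m)%N -> mean m signdensity <= 1.
Proof.
move=> m0; rewrite mean_signdensity// ler_pdivrMr ?ltr0n ?(ltnW card_block_pos_ge2)// mul1r.
rewrite -sum1_card natr_sum; apply: ler_sum => j _.
by rewrite exprn_ile1// eps_norm.
Qed.

(** The difference of opposite corners is attained by a single pair of positions, so nothing can
    cancel in this Fourier coefficient. It shows that [signdensity] is not constant when no [eps]
    vanishes. *)
Lemma mean_signdensity_corner (m : nat) : (0 < m)%N ->
  mean m (fun k => signdensity k * chi (blockvec pos_max) k) = eps pos_min * eps pos_max / N%:R.
Proof.
move=> m0.
transitivity (mean m (fun k => \sum_j (eps j / N%:R) * (\sum_j' conjc (eps j') * chi (blockvec j' - blockvec j + blockvec pos_max) k))).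
  apply: eq_mean => k; rewrite /signdensity sqnormE conjc_sum !mulr_suml; apply: eq_bigr => j _.
  rewrite [RHS]mulr_sumr [X in X / _]mulr_sumr !mulr_suml; apply: eq_bigr => j' _.
  by rewrite conjcM -chiN opprK !chiD; ring.
rewrite mean_sum//; last first.
  by move=> j; apply: tp_sum => j'; apply: tpM; [exact: tp_cst|exact: tp_chi].
have E j j' : (blockvec j' - blockvec j + blockvec pos_max == 0) = (j == pos_max) && (j' == pos_min).
  apply/eqP/andP => [/rowP H|[/eqP -> /eqP ->]]; last first.
    rewrite subrK; apply/rowP => i; by rewrite !mxE ffunE.
  split; apply/eqP/ffunP => i; apply/val_inj; have := H i; rewrite !mxE !ffunE /=;
  have := ltn_ord (j i); have := n_gt0 i;
  by move: (j i : nat) (j' i : nat) => a b; move: (n i) => c; lia.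
rewrite (bigD1 pos_max)//= [X in _ + X]big1 ?addr0 => [|j jm]; last first.
  rewrite mean_sum//; last by move=> j'; exact: tp_chi.
  by rewrite big1 ?mulr0// => j' _; rewrite mean_chi// E (negbTE jm) mulr0.
rewrite mean_sum//; last by move=> j'; exact: tp_chi.
rewrite (bigD1 pos_min)//= [X in _ + X]big1 ?addr0 => [|j jm]; last first.
  by rewrite mean_chi// E (negbTE jm) andbF mulr0.
by rewrite mean_chi// E !eqxx mulr1 conj_eps; ring.
Qed.

(** If the mean of [signdensity] is below 1, the linear part of [majorant] suffices. Otherwise the
    gain comes from the quadratic correction, whose mean [X2] is at least the square of the nonzero
    corner coefficient. *)
Lemma mean_majorant_lt1 (m : nat) : (0 < m)%N -> mean m majorant < 1.
Proof.
move=> m0.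
have N0 : 0 < N%:R :> C by rewrite ltr0n (ltnW card_block_pos_ge2).
have tg : tp signdensity := tpb_tp tpb_signdensity.
have tX : tp (fun k => 1 - signdensity k) := tpB (tp_cst 1) tg.
have gR k : conjc (signdensity k) = signdensity k.
  by rewrite (@rc_ge0 _ (signdensity k)) ?conjc_real// divr_ge0// exprn_ge0.
have gR' k : signdensity k \is Num.real by rewrite ger0_real// divr_ge0// exprn_ge0.
set X2 := mean m (fun k => (1 - signdensity k) ^+ 2).
have X20 : 0 <= X2.
  by apply: mean_ge0 => k; rewrite real_exprn_even_ge0// rpredB// rpred1.
have -> : mean m majorant = (1 + mean m signdensity) / 2 - X2 / (8 * N%:R).
  transitivity (mean m (fun k => 2^-1 * (1 + signdensity k) + (- (8 * N%:R)^-1) * (1 - signdensity k) ^+ 2)).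
    by apply: eq_mean => k; rewrite /majorant; ring.
  have t1 : tp (fun k => 1 + signdensity k) := tpD (tp_cst 1) tg.
  have t2 := tpX 2 tX.
  rewrite meanD; [|exact: tpM (tp_cst _) t1|exact: tpM (tp_cst _) t2].
  rewrite !meanZ// meanD//; last exact: tp_cst.
  by rewrite mean_cst// -/X2; ring.
have q_le1 := mean_signdensity_le1 m0.
have [q1|q1] := eqVneq (mean m signdensity) 1; last first.
  have {q1}q_lt1 : mean m signdensity < 1 by rewrite lt_neqAle q1.
  rewrite (@le_lt_trans _ _ ((1 + mean m signdensity) / 2))//.
    by rewrite gerBl divr_ge0// mulr_ge0// ltW.
  by rewrite ltr_pdivrMr// mul1r [ltRHS](_ : _ = 1 + 1)// ltrD2l.
(* Each |eps j|^2 is at most 1, so an average equal to 1 forces equality at every position. *)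
have eps1 j : eps j != 0.
  move: q1; rewrite mean_signdensity// => /(congr1 ( *%R^~ N%:R)) /=.
  rewrite (divfK (lt0r_neq0 N0)) mul1r => /esym/eqP.
  rewrite -sum1_card natr_sum -subr_eq0 -sumrB psumr_eq0 => [/allP/(_ j)|j' _].
    rewrite mem_index_enum subr_eq0 => /(_ isT) /=; apply: contraTneq => ->.
    by rewrite normr0 expr0n /= oner_eq0.
  by rewrite subr_ge0 exprn_ile1// eps_norm.
pose t := mean m (fun k => signdensity k * chi (blockvec pos_max) k).
have tE : t = eps pos_min * eps pos_max / N%:R by exact: mean_signdensity_corner.
have tR : conjc t = t.
  by rewrite tE conjcM (conjcM (eps _)) !conj_eps conjc_inv conjc_nat.
have t2 : 0 < t ^+ 2.
  rewrite expr2 -{2}tR -sqnormE exprn_gt0// normr_gt0 tE.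
  apply: mulf_neq0; first by apply: mulf_neq0; exact: eps1.
  by rewrite invr_eq0 lt0r_neq0.
(* Bessel's inequality for one coefficient: 1 - [signdensity] plus t times the corner character has
   mean square X2 - t^2. *)
have : t ^+ 2 <= X2.
  have z0 : (blockvec pos_max == 0) = false.
    apply/negbTE/eqP => /rowP/(_ (Ordinal d_gt0)); rewrite !mxE ffunE /=.
    by have := n_ge2 (Ordinal d_gt0); case: (n _) => [|[]].
  have tgc z : tp (fun k => signdensity k * chi z k) := tpM tg (tp_chi z).
  have tm : mean m (fun k => signdensity k * chi (- blockvec pos_max) k) = t.
    rewrite -tR -mean_conj//; apply: eq_mean => k; by rewrite conjcM gR chiN.
  rewrite -subr_ge0.
  have -> : X2 - t ^+ 2 = mean m (fun k => `|(1 - signdensity k) + t * chi (- blockvec pos_max) k| ^+ 2).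
    transitivity (mean m (fun k => (1 - signdensity k) ^+ 2 + (t * chi (blockvec pos_max) k + (t * chi (- blockvec pos_max) k + ((- t) * (signdensity k * chi (blockvec pos_max) k) + ((- t) * (signdensity k * chi (- blockvec pos_max) k) + t ^+ 2)))))).
      have T1 := tpX 2 tX.
      have T2 (z : 'rV[int]_d) : tp (fun k => t * chi z k) := tpM (tp_cst t) (tp_chi z).
      have T3 z : tp (fun k => (- t) * (signdensity k * chi z k)) := tpM (tp_cst (- t)) (tgc z).
      have T4 := tpD (T3 (- blockvec pos_max)) (tp_cst (t ^+ 2)).
      have T5 := tpD (T3 (blockvec pos_max)) T4.
      have T6 := tpD (T2 (- blockvec pos_max)) T5.
      rewrite (meanD m T1 (tpD (T2 _) T6)) (meanD m (T2 _) T6) (meanD m (T2 _) T5).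
      rewrite (meanD m (T3 _) T4) (meanD m (T3 _) (tp_cst _)) mean_cst//.
      rewrite (meanZ m t (tp_chi _)) (meanZ m t (tp_chi _)).
      rewrite (meanZ m _ (tgc _)) (meanZ m _ (tgc _)) tm -/t -/X2.
      rewrite !mean_chi// oppr_eq0 z0 !mulr0 !add0r.
      have A (a b : C) : b - a ^+ 2 = b + (- a * a + (- a * a + a ^+ 2)) by ring.
      exact: A.
    apply: eq_mean => k.
    rewrite sqnormE conjcD conjcB conjc1 gR conjcM tR -chiN opprK.
    have ab : chi (- blockvec pos_max) k * chi (blockvec pos_max) k = 1 by rewrite -chiD addNr chi0.
    rewrite (_ : t ^+ 2 = t ^+ 2 * (chi (- blockvec pos_max) k * chi (blockvec pos_max) k)).
      by ring.
    by rewrite ab mulr1.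
  by apply: mean_ge0 => k; exact: exprn_ge0.
move=> tX2; rewrite q1.
have -> : (1 + 1) / 2 = 1 :> C by rewrite divff// (_ : 1 + 1 = 2%:R)// pnatr_eq0.
rewrite gtrBl; apply: divr_gt0; first exact: lt_le_trans t2 tX2.
by rewrite mulr_gt0.
Qed.

Lemma mean_majorant_ge0 (m : nat) : 0 <= mean m majorant.
Proof. by apply: mean_ge0 => k; exact: (majorant_ge k).1. Qed.

Fixpoint majorantprod (q : nat) (k : 'rV[R]_d) : C :=
  if q is q'.+1 then majorant k * majorantprod q' (F (F k)) else 1.

Lemma tp_majorantprod q : tp (majorantprod q).
Proof.
elim: q => [|q IH] /=; first exact: tp_cst.
exact: (tpM (tpb_tp tpb_majorant) (tp_dil n (tp_dil n IH))).
Qed.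

Lemma majorantprod_ge0 q k : 0 <= majorantprod q k.
Proof. by elim: q k => [|q IH] k //=; rewrite mulr_ge0// (majorant_ge k).1. Qed.

Lemma mean_majorantprod (m q : nat) : (0 < m)%N -> mean m (majorantprod q) = mean m majorant ^+ q.
Proof.
move=> m0; elim: q => [|q IH] /=; first by rewrite mean_cst.
rewrite exprS -IH -(@mean_dil_mul _ _ m _ (fun i => n i * n i)%N _ _ m0 _ tpb_majorant (tp_majorantprod q)).
  apply: eq_mean => k; congr (_ * majorantprod q _); apply/rowP => i.
  by rewrite !mxE mulrA natrM.
(* The condition of [mean_dil_mul]: 2 (n_i - 1) < n_i^2. *)
by move=> i; have := n_ge2 i; move: (n i) => a; nia.
Qed.

(** The 2q factors are split by parity: those at dilations n^(2i) go into [majorantprod q k], those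
    at n^(2i+1) into [majorantprod q (F k)]. The induction therefore takes two factors at a time. *)
Lemma cocycle_le_majorantprod q k :
  `|cocycle rho (q + q) k| ^+ 2 <= N%:R ^+ (q + q) * (majorantprod q k ^+ 2 * majorantprod q (F k) ^+ 2).
Proof.
have N0 : 0 < N%:R :> C by rewrite ltr0n (ltnW card_block_pos_ge2).
elim: q k => [|q IH] k; first by rewrite /= normr1 !expr1n !mulr1.
rewrite addnS addSn /= !normrM !exprMn.
have Qle k' : `|signpoly k'| ^+ 2 <= N%:R * majorant k' ^+ 2.
  by rewrite mulrC -ler_pdivrMr// (majorant_ge k').2.
rewrite [leRHS](_ : _ = (N%:R * majorant k ^+ 2) * ((N%:R * majorant (F k) ^+ 2) *
   (N%:R ^+ (q + q) * (majorantprod q (F (F k)) ^+ 2 * majorantprod q (F (F (F k))) ^+ 2)))); last first.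
  by rewrite !exprS; ring.
have e0 (x : C) : 0 <= `|x| ^+ 2 by rewrite exprn_ge0.
apply: ler_pM; [exact: e0|by rewrite mulr_ge0 ?e0|exact: Qle|].
by apply: ler_pM; [exact: e0|exact: e0|exact: Qle|exact: IH].
Qed.

End SubmultiplicativeBound.

(** * Bounding the autocorrelation on test polynomials *)

Section Tools.
Context {R : realType} {d : nat}.
Local Notation V := ('rV[R]_d).
Local Notation C := (R[i]).
Local Notation Z := ('rV[int]_d).

Lemma sqnormD_le (x y : C) : `|x + y| ^+ 2 <= 2 * (`|x| ^+ 2 + `|y| ^+ 2).
Proof.
apply: (@le_trans _ _ ((`|x| + `|y|) ^+ 2)).
  by rewrite lerXn2r ?nnegrE ?addr_ge0// ler_normD.
rewrite -subr_ge0 (_ : _ - _ = (`|x| - `|y|) ^+ 2); last by ring.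
by rewrite real_exprn_even_ge0// rpredB// normr_real.
Qed.

(** The factor 2^l is wasteful but harmless, as l is fixed while the window grows. *)
Lemma sqnorm_sum_le l (F : nat -> C) :
  `|\sum_(0 <= j < l) F j| ^+ 2 <= 2 ^+ l * \sum_(0 <= j < l) `|F j| ^+ 2.
Proof.
elim: l => [|l IH]; first by rewrite !big_geq// normr0 expr0n mulr0.
rewrite !big_nat_recr//= (le_trans (sqnormD_le _ _))// (exprS 2 l) -mulrA ler_pM2l//.
rewrite mulrDr lerD// ler_peMl ?exprn_ge0//.
by rewrite -natrX ler1n expn_gt0.
Qed.

Definition cubeseq (r : nat) : seq Z :=
  [seq \row_i ((f i : nat)%:Z - r%:Z) | f : {ffun 'I_d -> 'I_(2 * r).+1} <- enum {: {ffun 'I_d -> 'I_(2 * r).+1}}].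

Lemma size_cubeseq r : size (cubeseq r) = ((2 * r).+1 ^ d)%N.
Proof. by rewrite size_map -cardE card_ffun !card_ord. Qed.

Lemma mem_cubeseq r (x : Z) : reflect (forall i, `|x 0 i|%R <= r%:Z) (x \in cubeseq r).
Proof.
apply: (iffP mapP) => [[f _ ->] i|H].
  rewrite mxE; have := ltn_ord (f i); move: (f i : nat) => a; lia.
have Hlt i : (absz (x 0%R i + r%:Z)%R < (2 * r).+1)%N by have := H i; lia.
exists [ffun i => Ordinal (Hlt i)]; first by rewrite mem_enum.
by apply/rowP => i; rewrite !mxE ffunE /=; have := H i; lia.
Qed.

Lemma uniq_cubeseq r : uniq (cubeseq r).
Proof.
rewrite map_inj_uniq ?enum_uniq// => f g /rowP E.
apply/ffunP => i; apply/val_inj; have := E i; rewrite !mxE => /addIr.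
by case.
Qed.

(** The difference is the sum over the points of [B] outside [A], to which Parseval applies.
    Boundary terms are thus bounded by counting points. *)
Lemma mean_diff (A B : seq Z) (a : Z -> C) (M : R) m : (0 < m)%N ->
  uniq A -> uniq B -> {subset A <= B} -> (forall x, `|a x| <= M%:C) ->
  mean m (fun k : V => `|\sum_(x <- B) a x * chi (- x) k - \sum_(x <- A) a x * chi (- x) k| ^+ 2) <=
    ((M ^+ 2) * ((size B)%:R - (size A)%:R))%:C.
Proof.
move=> m0 uA uB AB aM.
pose D := [seq x <- B | x \notin A].
have pB : perm_eq B (A ++ D).
  apply: uniq_perm => //.
    rewrite cat_uniq uA filter_uniq// andbT; apply/hasPn => x.
    by rewrite mem_filter => /andP[].
  by move=> x; rewrite mem_cat mem_filter; case: (boolP (x \in A)) => //= /AB ->.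
have sD : (size B = size A + size D)%N by rewrite (perm_size pB) size_cat.
rewrite (_ : mean _ _ = mean m (fun k : V => `|\sum_(x <- D) a x * chi (- x) k| ^+ 2)); last first.
  by apply: eq_mean => k; rewrite (perm_big _ pB) big_cat /= addrAC subrr add0r.
rewrite mean_sqnorm ?filter_uniq//; last by move=> x y _ _; exact: oppr_inj.
rewrite sD natrD addrAC subrr add0r mulr_natr rmorphMn /= rcX.
rewrite -[leRHS]mulr_natr -sum1_size natr_sum mulr_sumr; apply: ler_sum => x _.
by rewrite mulr1 lerXn2r ?nnegrE// (le_trans _ (aM x)).
Qed.

Lemma mean_weight_le m (f g : V -> C) (M : R) : tp f -> tp g ->
  (forall k, f k <= M%:C) -> (forall k, 0 <= g k) ->
  mean m (fun k => f k * g k) <= M%:C * mean m g.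
Proof.
move=> tf tg fM g0; rewrite -meanZ//; apply: le_mean; [exact: tpM|exact: (tpM (tp_cst _) tg)|].
by move=> k; rewrite ler_wpM2r.
Qed.

(** Bernoulli: (1 - x)^(2m) (1 + 2m x) <= (1 - x)^(2m) (1 + x)^(2m) = (1 - x^2)^(2m) <= 1. *)
Lemma pow_mul_le (x : R) m : (0 < m)%N -> 0 <= x <= 1 ->
  (1 - x) ^+ (m + m) * x <= (2 * m%:R)^-1.
Proof.
move=> m0 /andP[x0 x1].
have m0' : 0 < m%:R :> R by rewrite ltr0n.
have B k : 1 + k%:R * x <= (1 + x) ^+ k.
  elim: k => [|k IH]; first by rewrite mul0r addr0 expr0.
  rewrite exprS (le_trans _ (ler_wpM2l _ IH)) ?addr_ge0//.
  have h : 0 <= k%:R * x * x by rewrite !mulr_ge0.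
  by rewrite -natr1; nra.
have H : (1 - x) ^+ (m + m) * (1 + (m + m)%:R * x) <= 1.
  apply: (@le_trans _ _ ((1 - x) ^+ (m + m) * (1 + x) ^+ (m + m))).
    by rewrite ler_wpM2l// exprn_ge0// subr_ge0.
  rewrite -exprMn exprn_ile1//; nra.
rewrite -[leRHS]mul1r ler_pdivlMr ?mulr_gt0//.
apply: le_trans H; rewrite natrD -mulrA ler_wpM2l ?exprn_ge0 ?subr_ge0//.
by nra.
Qed.

Lemma cube_growth (L : nat) (e : R) : 0 < e ->
  exists r0 : nat, forall r : nat, (r0 <= r)%N -> (0 < r)%N /\
    (2 * (r + L)%:R + 1) ^+ d <= (1 + e) * (2 * r%:R) ^+ d :> R.
Proof.
move=> e0.
(* This is (2 (R + L) + 1) / (2R) at R = r + 1, the shift built into [cvg_harmonic]; hence the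
   witness [r0.+1]. *)
have h1 : (1 + (L%:R + 2^-1 : R) * r.+1%:R^-1) @[r --> \oo] --> (1 + (L%:R + 2^-1) * 0 : R).
  apply: cvgD; first exact: cvg_cst.
  by apply: cvgM; [exact: cvg_cst|exact: cvg_harmonic].
have := cvg_comp _ _ h1 (@exprn_continuous R d _).
rewrite mulr0 addr0 expr1n => /cvgrPdist_lt/(_ _ e0)[r0 _ H].
exists r0.+1 => -[//|r] rr0; split=> //.
have {H} := H r rr0; rewrite /= distrC => /ltr_normlW; rewrite ltrBlDr [ltRHS]addrC => /ltW H.
have r0' : 0 < 2 * r.+1%:R :> R by rewrite mulr_gt0.
rewrite -ler_pdivrMr ?exprn_gt0// -expr_div_n (le_trans _ H)// le_eqVlt; apply/orP; left.
apply/eqP; congr (_ ^+ _); rewrite natrD; field.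
by rewrite gt_eqF// ltr_wpDr.
Qed.

(** The Fourier sum of a finite window; its squared absolute value over (2r)^d is the diffraction
    intensity of that window. *)
Definition windowsum (c : Z -> C) (r : nat) (k : V) : C :=
  \sum_(x <- cubeseq r) c x * chi (- x) k.

Lemma tp_windowsum c r : tp (windowsum c r).
Proof. by apply: tp_sum => x; apply: tpM; [exact: tp_cst|exact: tp_chi]. Qed.

End Tools.

(** * The two factors of the test polynomial *)

Section SpectralBound.
Context {R : realType} {d : nat} (n : 'I_d -> nat) (n_ge2 : forall i, (2 <= n i)%N).
Hypothesis d_gt0 : (0 < d)%N.
Variable rho : block_substitution n.
Local Notation C := (R[i]).
Local Notation Z := ('rV[int]_d).
Local Notation F := (@dil R d n).
Local Notation N := (#|{: block_pos n}|).
Local Notation periodicpart := (@periodicpart R d n n_ge2 rho).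
Local Notation signpart := (@signpart R d n n_ge2 rho).
Local Notation blockquo := (@blockquo d n).
Local Notation cocycle := (@cocycle R d n rho).

Let n_gt0 i : (0 < n i)%N. Proof. exact: ltnW. Qed.

Let N_gt0 : (0 < N)%N. Proof. exact: ltnW (card_block_pos_ge2 n_ge2 d_gt0). Qed.

Lemma iter_dilz_inj K : injective (iter K (@dilz d n)).
Proof.
elim: K => [|K IH] x y //= /rowP E; apply: IH; apply/rowP => i.
have := E i; rewrite !mxE => /mulfI; apply.
by rewrite -lt0n.
Qed.

Lemma chi_iter_dil K z (k : 'rV[R]_d) : chi z (iter K F k) = chi (iter K (@dilz d n) z) k.
Proof. by elim: K z => //= K IH z; rewrite chi_dil IH -iterSr. Qed.

Definition period K (j : nat) : Z := iter K (@dilz d n) (const_mx j%:Z).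

(** The D of the overview. Its l frequencies are distinct, so |D|^2 has mean 1/l; D is therefore
    near 1 only on a small set, and 1 - D does not spoil lower bounds elsewhere. *)
Definition avg K l (k : 'rV[R]_d) : C := \sum_(0 <= j < l) l%:R^-1 * chi (period K j) k.

Lemma tp_avg K l : tp (avg K l).
Proof. by apply: tp_sum => j; apply: tpM; [exact: tp_cst|exact: tp_chi]. Qed.

Lemma mean_avg K l m : (0 < m)%N -> (0 < l)%N ->
  mean m (fun k => `|avg K l k| ^+ 2) = l%:R^-1.
Proof.
move=> m0 l0; rewrite mean_sqnorm//; first last.
- move=> j j' _ _ /iter_dilz_inj/rowP/(_ (Ordinal d_gt0)); rewrite !mxE; by case.
- exact: iota_uniq.
rewrite sumr_const_nat subn0 normfV normr_nat -[LHS]mulr_natl expr2 mulrA mulfV ?mul1r//.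
by rewrite pnatr_eq0 -lt0n.
Qed.

Lemma sum_inv_nat l : (0 < l)%N -> \sum_(0 <= j < l) l%:R^-1 = 1 :> C.
Proof.
by move=> l0; rewrite sumr_const_nat subn0 -[LHS]mulr_natr mulVf// pnatr_eq0 -lt0n.
Qed.

Lemma avg_norm K l k : (0 < l)%N -> `|avg K l k| <= 1.
Proof.
move=> l0; rewrite (le_trans (ler_norm_sum _ _ _))//.
under eq_bigr do rewrite normrM chi_norm mulr1 normfV normr_nat.
by rewrite sum_inv_nat.
Qed.

(** Since [p] has period [v], multiplying by [chi v] moves the sum from S to S - v. Both sums are
    compared with the sum over [U], which contains S and S - v, and each comparison costs |U| - |S|
    points. *)
Lemma mean_periodic (S U : seq Z) (v : Z) (p : Z -> C) (M : R) :
  uniq S -> uniq U -> {subset S <= U} -> {subset [seq X - v | X <- S] <= U} ->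
  (forall X, p (X + v) = p X) -> (forall X, `|p X| <= M%:C) ->
  mean 1 (fun k => `|(1 - chi v k) * \sum_(X <- S) p X * chi (- X) k| ^+ 2) <=
    (4 * M ^+ 2 * ((size U)%:R - (size S)%:R))%:C.
Proof.
move=> uS uU SU SvU pv pM.
pose f (A B : seq Z) (k : 'rV[R]_d) := \sum_(X <- B) p X * chi (- X) k - \sum_(X <- A) p X * chi (- X) k.
pose S' := [seq X - v | X <- S].
have uS' : uniq S' by rewrite map_inj_uniq// => x y /addIr.
have tf A B : tp (f A B).
  by apply: tpB; apply: tp_sum => X; apply: tpM; [exact: tp_cst|exact: tp_chi|exact: tp_cst|exact: tp_chi].
have tf2 A B : tp (fun k => `|f A B k| ^+ 2) by exact: tp_sqnorm.
apply: (@le_trans _ _ (mean 1 (fun k => 2 * (`|f S' U k| ^+ 2 + `|f S U k| ^+ 2)))).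
  apply: le_mean => //.
  - apply/tp_sqnorm/tpM; first by apply: tpB; [exact: tp_cst|exact: tp_chi].
    by apply: tp_sum => X; apply: tpM; [exact: tp_cst|exact: tp_chi].
  - by apply: tpM; [exact: tp_cst|exact: tpD].
  move=> k; rewrite -[`|f S U k|]normrN.
  apply: le_trans (sqnormD_le _ _); rewrite le_eqVlt; apply/orP; left; apply/eqP.
  congr (`|_| ^+ 2); rewrite /f.
  have A (a b c : C) : (a - b) - (a - c) = c - b by ring.
  rewrite A mulrBl mul1r; congr (_ - _).
  rewrite big_map mulr_sumr; apply: eq_bigr => X _.
  by rewrite -(pv (X - v)) subrK opprB chiD; ring.
rewrite meanZ ?meanD//; last exact: tpD.
have H1 := @mean_diff R d S' U p M 1 isT uS' uU SvU pM.
have H2 := @mean_diff R d S U p M 1 isT uS uU SU pM.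
rewrite size_map in H1.
apply: (le_trans (ler_wpM2l _ (lerD H1 H2))) => //.
by rewrite -rcD -(rc_nat 2) -rcM lecR le_eqVlt; apply/orP; left; apply/eqP; ring.
Qed.

(** 1 - [avg] is the average of the l factors treated by [mean_periodic]. The weights 1/l are
    bounded by 1; the constant is not optimised. *)
Lemma mean_avg_periodic K l (S U : seq Z) (p : Z -> C) (M : R) : (0 < l)%N ->
  uniq S -> uniq U -> {subset S <= U} ->
  (forall j, (j < l)%N -> {subset [seq X - period K j | X <- S] <= U}) ->
  (forall X v, p (X + iter K (@dilz d n) v) = p X) -> (forall X, `|p X| <= M%:C) ->
  mean 1 (fun k => `|(1 - avg K l k) * \sum_(X <- S) p X * chi (- X) k| ^+ 2) <=
    (2 ^+ l * l%:R * (4 * M ^+ 2 * ((size U)%:R - (size S)%:R)))%:C.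
Proof.
move=> l0 uS uU SU SvU pv pM.
pose h j (k : 'rV[R]_d) := (1 - chi (period K j) k) * \sum_(X <- S) p X * chi (- X) k.
have tS : tp (fun k => \sum_(X <- S) p X * chi (- X) k).
  by apply: tp_sum => X; apply: tpM; [exact: tp_cst|exact: tp_chi].
have th j : tp (h j) by apply: tpM => //; apply: tpB; [exact: tp_cst|exact: tp_chi].
have th2 j : tp (fun k => `|h j k| ^+ 2) by exact: tp_sqnorm.
have l1 : l%:R^-1 <= 1 :> C by rewrite invf_le1 ?ltr0n// ler1n.
apply: (@le_trans _ _ (mean 1 (fun k => 2 ^+ l * \sum_(0 <= j < l) 1 * `|h j k| ^+ 2))).
  apply: le_mean => //.
  - by apply/tp_sqnorm/tpM => //; apply: tpB; [exact: tp_cst|exact: tp_avg].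
  - apply: tpM; first exact: tp_cst.
    by apply: tp_sum => j; apply: tpM; [exact: tp_cst|].
  move=> k; rewrite (_ : _ * _ = \sum_(0 <= j < l) l%:R^-1 * h j k).
    apply: (le_trans (sqnorm_sum_le _ _)); rewrite ler_wpM2l ?exprn_ge0//.
    apply: ler_sum => j _; rewrite normrM exprMn ler_wpM2r ?exprn_ge0//.
    by rewrite exprn_ile1// ger0_norm.
  under [RHS]eq_bigr do rewrite /h mulrA.
  rewrite -mulr_suml; congr (_ * _).
  under [RHS]eq_bigr do rewrite mulrBr mulr1.
  by rewrite sumrB sum_inv_nat.
rewrite meanZ; last by apply: tp_sum => j; apply: tpM; [exact: tp_cst|].
rewrite mean_sum// -mulrA rcM rcX rc_nat ler_wpM2l ?exprn_ge0//.
rewrite rcM rc_nat -[X in X%:R * _]subn0 mulr_natl -sumr_const_nat.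
rewrite big_nat [leRHS]big_nat; apply: ler_sum => j /andP[_ jl]; rewrite mul1r.
by apply: mean_periodic => //; [exact: SvU|move=> X; exact: pv].
Qed.

(** Division by N^(2K) puts the base into [0, 1], since |E_K| <= N^K everywhere. With m of order N^K
    the power reacts to the size of |E_K|^2 / N^K. *)
Definition damp K m (k : 'rV[R]_d) : C := (1 - `|cocycle K k| ^+ 2 / N%:R ^+ (K + K)) ^+ m.

Lemma tp_damp K m : tp (damp K m).
Proof.
apply/tpX/tpB; first exact: tp_cst.
by apply: tpM; [exact/tp_sqnorm/tp_cocycle|exact: tp_cst].
Qed.

Lemma dampE K m k : exists x : R, [/\ 0 <= x, x <= 1,
  `|cocycle K k| ^+ 2 = (N%:R ^+ (K + K) * x)%:C & damp K m k = ((1 - x) ^+ m)%:C].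
Proof.
have NK : 0 < N%:R ^+ (K + K) :> C by rewrite exprn_gt0// ltr0n.
have NKR : N%:R ^+ (K + K) = (N%:R ^+ (K + K) : R)%:C by rewrite rcX rc_nat.
have x0 : 0 <= `|cocycle K k| ^+ 2 / N%:R ^+ (K + K).
  by rewrite divr_ge0 ?exprn_ge0.
have x1 : `|cocycle K k| ^+ 2 / N%:R ^+ (K + K) <= 1.
  rewrite ler_pdivrMr// mul1r addnn -muln2 exprM lerXn2r ?nnegrE ?exprn_ge0//.
  exact: cocycle_norm.
have xE := rc_ge0 x0; exists (complex.Re (`|cocycle K k| ^+ 2 / N%:R ^+ (K + K))).
split.
- by rewrite -ler0c -xE.
- by rewrite -lecR -xE.
- by rewrite rcM -xE -NKR mulrC divfK// gt_eqF.
- by rewrite /damp {1}xE rcX rcB.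
Qed.

Lemma damp_norm K m k : `|damp K m k| <= 1.
Proof.
have [x [x0 x1 _ ->]] := dampE K m k.
rewrite ger0_norm ?ler0c ?exprn_ge0 ?subr_ge0// -[leRHS](rc_nat 1) lecR.
by rewrite exprn_ile1 ?subr_ge0// lerBlDr lerDl.
Qed.

Lemma damp_cocycle K m k : (0 < m)%N ->
  `|damp K m k| ^+ 2 * `|cocycle K k| ^+ 2 <= (N%:R ^+ (K + K) / (2 * m%:R))%:C.
Proof.
move=> m0; have [x [x0 x1 -> ->]] := dampE K m k.
rewrite ger0_norm ?ler0c ?exprn_ge0 ?subr_ge0// -rcX -rcM lecR.
rewrite mulrCA ler_wpM2l ?exprn_ge0// -exprM muln2 -addnn.
by apply: pow_mul_le; rewrite ?x0.
Qed.

End SpectralBound.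

(** * The test polynomial against a window of w *)

Section SpectralEstimate.
Context {R : realType} {d : nat} (n : 'I_d -> nat) (n_ge2 : forall i, (2 <= n i)%N).
Hypothesis d_gt0 : (0 < d)%N.
Variable rho : block_substitution n.
Variables (w : 'rV[int]_d -> 'I_2) (w_hull : in_hull n_ge2 rho w) (u : 'I_2 -> R[i]).
Local Notation C := (R[i]).
Local Notation Z := ('rV[int]_d).
Local Notation F := (@dil R d n).
Local Notation N := (#|{: block_pos n}|).
Local Notation periodicpart := (@periodicpart R d n n_ge2 rho).
Local Notation signpart := (@signpart R d n n_ge2 rho).
Local Notation blockquo := (@blockquo d n).
Local Notation cocycle := (@cocycle R d n rho).
Local Notation avg := (@avg R d n).
Local Notation wsum := (@windowsum R d (fun x => u (w x))).
Local Notation damp := (@damp R d n rho).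

Let n_gt0 i : (0 < n i)%N. Proof. exact: ltnW. Qed.

Let N_gt0 : (0 < N)%N. Proof. exact: ltnW (card_block_pos_ge2 n_ge2 d_gt0). Qed.

(** The window occurs in some k-th iterate of [rho]. Its opposite corners are 2r >= n_i^K apart, so
    k >= K and K levels can be removed; [g0] is the sign pattern of the iterate of order k - K. It
    varies with r, but remains bounded by 1. *)
Lemma hull_desubstitution K r : (forall i, (n i ^ K <= 2 * r)%N) ->
  exists (t : Z) (g0 : Z -> C), (forall y, `|g0 y| <= 1) /\
    forall x, x \in cubeseq r -> lsign (w x) = signpart g0 K (x + t) + periodicpart K (x + t).
Proof.
move=> nr.
have [k [a [t H]]] := w_hull (finite_seq (cubeseq r : seq Z)).
have Kk : (K <= k)%N.
  rewrite leqNgt; apply/negP => kK.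
  have [|p1 [p1n p1E _]] := H (const_mx r%:Z).
    by apply/mem_cubeseq => i; rewrite mxE; lia.
  have [|p2 [p2n p2E _]] := H (const_mx (- r%:Z)).
    by apply/mem_cubeseq => i; rewrite mxE; lia.
  pose i := Ordinal d_gt0.
  have := p1E i; have := p2E i; rewrite !mxE => E2 E1.
  have nk : (n i ^ k <= n i ^ K)%N by rewrite leq_exp2l// ltnW.
  have := p1n i; have := nr i; lia.
exists t, (fun y => lsign (iter_substitution n_ge2 rho (k - K) a (fun i => `|y 0%R i|%N))).
split=> [y|x xr]; first by rewrite lsign_norm.
have [p [_ pE ->]] := H x xr.
have := @lsign_iter_substitution R d n n_ge2 rho (k - K) K a p (x + t) pE.
by rewrite subnKC.
Qed.

Definition testpoly K m l (k : 'rV[R]_d) : C := damp K m k * (1 - avg K l k).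

Lemma tp_testpoly K m l : tp (testpoly K m l).
Proof. by apply: tpM; [exact: tp_damp|apply: tpB; [exact: tp_cst|exact: tp_avg]]. Qed.

Lemma one_avg_norm K l k : (0 < l)%N -> `|1 - avg K l k| ^+ 2 <= 4.
Proof.
move=> l0; rewrite (_ : 4 = 2 ^+ 2); last by rewrite -natrX.
rewrite lerXn2r ?nnegrE// (le_trans (ler_normB _ _))//.
by rewrite normr1 (_ : 2 = 1 + 1)// lerD2l avg_norm.
Qed.

Definition alpha : C := (u ord0 + u ord_max) / 2.
Definition beta : C := (u ord0 - u ord_max) / 2.

Lemma weightE a : u a = alpha + beta * lsign a.
Proof.
case: a => -[|[|//]] ha.
  rewrite (_ : Ordinal ha = ord0); last exact/val_inj.
  by rewrite /alpha /beta /lsign expr0; field.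
rewrite (_ : Ordinal ha = ord_max); last exact/val_inj.
by rewrite /alpha /beta /lsign expr1; field.
Qed.

Definition beta2 : R := complex.Re (`|beta| ^+ 2).

Lemma beta2E : `|beta| ^+ 2 = beta2%:C.
Proof. by apply: rc_ge0; rewrite exprn_ge0. Qed.

Lemma beta2_ge0 : 0 <= beta2.
Proof. by rewrite -ler0c -beta2E exprn_ge0. Qed.

Let M K : R := complex.Re (`|alpha| + `|beta| * K%:R).

Lemma mean_testpoly_windowsum_cube K m l L r : (0 < m)%N -> (0 < l)%N ->
  (forall X X' : Z, iter K blockquo X = iter K blockquo X' -> forall i, `|X 0 i - X' 0 i|%R <= L%:Z) ->
  (forall j, (j < l)%N -> forall i, `|period n K j 0 i|%R <= L%:Z) ->
  (forall i, (n i ^ K <= 2 * r)%N) ->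
  mean 1 (fun k => `|testpoly K m l k| ^+ 2 * `|wsum r k| ^+ 2) <=
   ((2 * (2 ^+ l * l%:R * (4 * M K ^+ 2)) + 16 * beta2) *
      ((2 * (r + L)).+1%:R ^+ d - (2 * r).+1%:R ^+ d) +
    8 * beta2 * (N%:R ^+ K / m%:R) * (2 * (r + L)).+1%:R ^+ d)%:C.
Proof.
move=> m0 l0 HL HV nr.
have [t [g0 [g01 wE]]] := hull_desubstitution nr.
pose S := [seq x + t | x <- cubeseq r].
pose U := [seq x + t | x <- cubeseq (r + L)].
pose Y := undup [seq iter K blockquo X | X <- S].
(* The smallest union of level-K blocks that contains the window. *)
pose St := iter K (@inflate d n) Y.
have uS : uniq S by rewrite map_inj_uniq ?uniq_cubeseq// => x y /addIr.
have uU : uniq U by rewrite map_inj_uniq ?uniq_cubeseq// => x y /addIr.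
have uSt : uniq St by apply: uniq_iter_inflate => //; exact: undup_uniq.
have memU X : (forall i, `|(X - t) 0 i|%R <= (r + L)%:Z) -> X \in U.
  by move=> H; apply/mapP; exists (X - t); rewrite ?subrK//; exact/mem_cubeseq.
have memS X : X \in S -> forall i, `|(X - t) 0 i|%R <= r%:Z.
  by move=> /mapP[x /mem_cubeseq H ->] i; rewrite addrK.
have SU : {subset S <= U}.
  by move=> X /memS H; apply: memU => i; rewrite (le_trans (H i))// lez_nat leq_addr.
have SSt : {subset S <= St}.
  by move=> X XS; rewrite (mem_iter_inflate n_ge2) /Y mem_undup; apply: map_f.
have StU : {subset St <= U}.
  move=> X; rewrite (mem_iter_inflate n_ge2) /Y mem_undup => /mapP[X' X'S] /HL XX'.
  apply: memU => i; have := memS _ X'S i; have := XX' i; rewrite !mxE => h1 h2.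
  by rewrite (le_trans (ler_distD (X' 0 i) _ _))// addnC PoszD lerD.
have sS : size S = ((2 * r).+1 ^ d)%N by rewrite size_map size_cubeseq.
have sU : size U = ((2 * (r + L)).+1 ^ d)%N by rewrite size_map size_cubeseq.
pose p X := alpha + beta * periodicpart K X.
pose e := signpart g0 K.
pose sm (a : Z -> C) (A : seq Z) (k : 'rV[R]_d) := \sum_(X <- A) a X * chi (- X) k.
have tsm a A : tp (sm a A) by apply: tp_sum => X; apply: tpM; [exact: tp_cst|exact: tp_chi].
(* The factor [chi (- t)] passes from x to x + t and has modulus 1. *)
have specE k : `|wsum r k| = `|sm p S k + beta * (sm e St k - (sm e St k - sm e S k))|.
  rewrite opprB addrCA subrr addr0.
  rewrite -[LHS]mul1r -(chi_norm (- t) k) -normrM /windowsum mulr_sumr.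
  rewrite mulr_sumr -big_split [in RHS]big_map; congr `|_|.
  rewrite big_seq [RHS]big_seq; apply: eq_bigr => x xr.
  by rewrite weightE wE// /p /e opprD chiD /=; ring.
have M0 : 0 <= `|alpha| + `|beta| * K%:R :> C by rewrite addr_ge0 ?mulr_ge0.
have pM X : `|p X| <= (M K)%:C.
  rewrite -(rc_ge0 M0) (le_trans (ler_normD _ _))// lerD2l normrM ler_wpM2l//.
  exact: periodicpart_norm.
pose W (k : 'rV[R]_d) := `|testpoly K m l k| ^+ 2.
have tW : tp W by apply/tp_sqnorm/tp_testpoly.
have t1 : tp (fun k => `|(1 - avg K l k) * sm p S k| ^+ 2).
  by apply/tp_sqnorm/tpM => //; apply: tpB; [exact: tp_cst|exact: tp_avg].
have t2 : tp (fun k => `|sm e St k| ^+ 2) by exact: tp_sqnorm.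
have t3 : tp (fun k => `|sm e St k - sm e S k| ^+ 2) by apply/tp_sqnorm/tpB.
have W4 k : W k <= 4%:C.
  rewrite /W /testpoly normrM exprMn rc_nat (le_trans _ (one_avg_norm K k l0))//.
  by rewrite ler_piMl ?exprn_ge0// exprn_ile1// damp_norm.
(* The inequality |a + b|^2 <= 2 (|a|^2 + |b|^2) is used twice. Only in the periodic term is [damp]
   discarded, through |damp| <= 1. *)
have step k : W k * `|wsum r k| ^+ 2 <= 2 * `|(1 - avg K l k) * sm p S k| ^+ 2 +
    4 * beta2%:C * (W k * `|sm e St k| ^+ 2) +
    4 * beta2%:C * (W k * `|sm e St k - sm e S k| ^+ 2).
  rewrite specE.
  apply: (@le_trans _ _ (W k * (2 * (`|sm p S k| ^+ 2 + beta2%:C *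
     (2 * (`|sm e St k| ^+ 2 + `|sm e St k - sm e S k| ^+ 2)))))).
    rewrite ler_wpM2l ?exprn_ge0// (le_trans (sqnormD_le _ _))// ler_wpM2l// lerD2l.
    rewrite normrM exprMn beta2E ler_wpM2l ?ler0c ?beta2_ge0//.
    by rewrite -(normrN (sm e St k - sm e S k)) sqnormD_le.
  rewrite (_ : W k * _ = 2 * (W k * `|sm p S k| ^+ 2) +
    4 * beta2%:C * (W k * `|sm e St k| ^+ 2) +
    4 * beta2%:C * (W k * `|sm e St k - sm e S k| ^+ 2)); last by ring.
  rewrite lerD2r lerD2r ler_wpM2l// /W /testpoly !normrM !exprMn -mulrA.
  by rewrite ler_piMl ?mulr_ge0 ?exprn_ge0// exprn_ile1// damp_norm.
pose A0 (k : 'rV[R]_d) := \sum_(y <- Y) g0 y * chi (- y) (iter K F k).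
have tA0 : tp (fun k => `|A0 k| ^+ 2).
  apply/tp_sqnorm/tp_sum => y; apply: tpM; first exact: tp_cst.
  by apply: tp_ext (tp_chi _) => k; rewrite chi_iter_dil.
have mA0 : mean 1 (fun k => `|A0 k| ^+ 2) <= (size Y)%:R.
  rewrite (eq_mean 1 (g := fun k => `|\sum_(y <- Y) g0 y * chi (iter K (@dilz d n) (- y)) k| ^+ 2)).
    rewrite mean_sqnorm ?undup_uniq//; last by move=> x y _ _ /(iter_dilz_inj n_ge2)/oppr_inj.
    by rewrite -sum1_size natr_sum; apply: ler_sum => y _; rewrite exprn_ile1.
  by move=> k; congr (`|_| ^+ 2); apply: eq_bigr => y _; rewrite chi_iter_dil.
(* Here 4 bounds |1 - [avg]|^2 and N^(2K) / (2m) bounds |[damp]|^2 |[cocycle]|^2; what remains is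
   the Fourier sum over the ancestors [Y] at a dilated frequency. *)
have e2 : mean 1 (fun k => W k * `|sm e St k| ^+ 2) <=
    (4 * (N%:R ^+ (K + K) / (2 * m%:R)))%:C * (size Y)%:R.
  apply: le_trans (ler_wpM2l _ mA0); last first.
    by rewrite ler0c mulr_ge0// divr_ge0// ?exprn_ge0// mulr_ge0.
  rewrite -meanZ//; apply: le_mean; [exact: tpM|exact: (tpM (tp_cst _) tA0)|] => k.
  rewrite /sm /St (sum_iter_inflate n_ge2) normrM exprMn [leLHS]mulrA ler_wpM2r ?exprn_ge0//.
  rewrite /W /testpoly normrM exprMn rcM rc_nat mulrAC mulrC ler_pM ?mulr_ge0 ?exprn_ge0//.
    exact: one_avg_norm.
  exact: damp_cocycle.
have e3 : mean 1 (fun k => W k * `|sm e St k - sm e S k| ^+ 2) <=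
    4%:C * ((size U)%:R - (size S)%:R)%:C.
  apply: (le_trans (mean_weight_le 1 tW t3 W4 _)); first by move=> k; rewrite exprn_ge0.
  rewrite ler_wpM2l ?rc_nat//.
  have e1 x : `|e x| <= 1%:C by exact: signpart_norm.
  apply: (le_trans (@mean_diff R d S St e 1 1 isT uS uSt SSt e1)).
  by rewrite lecR expr1n mul1r lerD2r ler_nat uniq_leq_size.
have e1 : mean 1 (fun k => `|(1 - avg K l k) * sm p S k| ^+ 2) <=
    (2 ^+ l * l%:R * (4 * M K ^+ 2 * ((size U)%:R - (size S)%:R)))%:C.
  apply: (@mean_avg_periodic R d n K l S U p (M K)) => //.
    move=> j jl _ /mapP[X /memS XS ->]; apply: memU => i.
    rewrite addrAC mxE [X in _ + X]mxE (le_trans (ler_normB _ _))// PoszD; apply: lerD; [exact: XS|exact: HV].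
  by move=> X v; rewrite /p periodicpart_periodic.
have tW2 := tpM tW t2; have tW3 := tpM tW t3.
apply: (@le_trans _ _ (mean 1 (fun k => 2 * `|(1 - avg K l k) * sm p S k| ^+ 2 +
    4 * beta2%:C * (W k * `|sm e St k| ^+ 2) +
    4 * beta2%:C * (W k * `|sm e St k - sm e S k| ^+ 2)))).
  apply: le_mean => //; first by apply: tpM tW _; apply/tp_sqnorm/tp_windowsum.
  by apply: tpD; [apply: tpD|]; apply: tpM => //; exact: tp_cst.
have Z1 := tpM (tp_cst 2) t1; have Z2 := tpM (tp_cst (4 * beta2%:C)) tW2.
have Z3 := tpM (tp_cst (4 * beta2%:C)) tW3.
rewrite (meanD 1 (tpD Z1 Z2) Z3) (meanD 1 Z1 Z2) (meanZ 1 _ t1) (meanZ 1 _ tW2) (meanZ 1 _ tW3).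
have b0 : 0 <= 4 * beta2%:C by rewrite mulr_ge0// ler0c beta2_ge0.
apply: (le_trans (lerD (lerD (ler_wpM2l (ler0n C 2) e1) (ler_wpM2l b0 e2)) (ler_wpM2l b0 e3))).
(* Every ancestor accounts for N^K points of [U], which turns N^(2K) |Y| into N^K |U|. *)
have sY : (size Y)%:R * N%:R ^+ K <= (size U)%:R :> R.
  by rewrite -natrX -natrM ler_nat -(size_iter_inflate n) uniq_leq_size.
rewrite -(rc_nat 2) -(rc_nat 4) -(rc_nat (size Y)) -!rcM -!rcD lecR.
rewrite (_ : (2 * (r + L)).+1%:R ^+ d = (size U)%:R); last by rewrite sU natrX.
rewrite (_ : (2 * r).+1%:R ^+ d = (size S)%:R); last by rewrite sS natrX.
set su := (size U)%:R : R in sY *; set ss := (size S)%:R : R.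
have N0 : 0 < N%:R ^+ K :> R by rewrite exprn_gt0// ltr0n.
have H : 4 * beta2 * (4 * (N%:R ^+ (K + K) / (2 * m%:R)) * (size Y)%:R) <=
    8 * beta2 * (N%:R ^+ K / m%:R) * su.
  rewrite (_ : 4 * _ * _ = 8 * beta2 * (N%:R ^+ K / m%:R) * ((size Y)%:R * N%:R ^+ K)); last first.
    by rewrite exprD; field; rewrite pnatr_eq0 -lt0n.
  by rewrite ler_wpM2l// !mulr_ge0 ?beta2_ge0// ?exprn_ge0// invr_ge0.
lra.
Qed.

(** For fixed K, m, l the boundary part is of lower order than (2r)^d and is absorbed into e. The
    enlarged window has at most 2 (2r)^d points, which turns the factor 8 into 16. *)
Lemma mean_testpoly_windowsum K m l (e : R) : (0 < m)%N -> (0 < l)%N -> 0 < e ->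
  exists r0 : nat, forall r, (r0 <= r)%N -> (0 < r)%N /\
    mean 1 (fun k => `|testpoly K m l k| ^+ 2 * `|wsum r k| ^+ 2) <=
    ((e + 16 * beta2 * (N%:R ^+ K / m%:R)) * (2 * r%:R) ^+ d)%:C.
Proof.
move=> m0 l0 e0.
have [L1 HL1] := iter_blockquo_close n_ge2 K.
pose L2 := (\sum_(j < l) \sum_i `|period n K j 0%R i|)%N.
pose L := (L1 + L2)%N.
pose A := 2 * (2 ^+ l * l%:R * (4 * M K ^+ 2)) + 16 * beta2.
have A0 : 0 <= A.
  have h1 : 0 <= 2 ^+ l :> R by exact: exprn_ge0.
  have h2 := sqr_ge0 (M K); have h3 := beta2_ge0.
  by apply: addr_ge0; [apply: mulr_ge0 => //; apply: mulr_ge0; apply: mulr_ge0|apply: mulr_ge0].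
(* The 1 keeps the enlarged window below 2 (2r)^d points; A + 1 avoids a division by 0. *)
pose e' := Num.min 1 (e / (A + 1)).
have A1 : 0 < A + 1 by rewrite ltr_wpDl.
have e'0 : 0 < e' by rewrite lt_min ltr01 divr_gt0.
have e'1 : e' <= 1 by rewrite ge_min lexx.
have e'2 : A * e' <= e.
  apply: (@le_trans _ _ ((A + 1) * e')); first by rewrite ler_wpM2r ?lerDl// ltW.
  by rewrite mulrC -ler_pdivlMr// ge_min lexx orbT.
have [r1 Hr1] := @cube_growth R d L e' e'0.
(* The second summand makes the window wide enough for K desubstitutions. *)
exists (r1 + \sum_i n i ^ K)%N => r rr.
have [r_gt0 Hr] := Hr1 r (leq_trans (leq_addr _ _) rr).
split=> //.
apply: (le_trans (@mean_testpoly_windowsum_cube K m l L r m0 l0 _ _ _)).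
- move=> X X' /HL1 H i; by rewrite (le_trans (H i))// lez_nat leq_addr.
- move=> j jl i; rewrite -abszE lez_nat.
  apply: (@leq_trans L2); last exact: leq_addl.
  rewrite /L2 (bigD1 (Ordinal jl))//= (bigD1 i)//= -addnA leq_addr//.
- move=> i; apply: (@leq_trans (\sum_i n i ^ K)); first by rewrite (bigD1 i)//= leq_addr.
  by rewrite (leq_trans (leq_addl r1 _))// (leq_trans rr)// leq_pmull.
rewrite lecR -/A.
have E1 : (2 * (r + L)).+1%:R = 2 * (r + L)%:R + 1 :> R by rewrite -natr1 natrM.
have E2 : (2 * r).+1%:R = 2 * r%:R + 1 :> R by rewrite -natr1 natrM.
rewrite E1 E2; set X := (2 * (r + L)%:R + 1) ^+ d in Hr *.
have : (2 * r%:R) ^+ d <= (2 * r%:R + 1) ^+ d :> R.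
  by rewrite lerXn2r ?nnegrE ?addr_ge0 ?mulr_ge0// lerDl.
set Y := (_ + 1) ^+ d; set D := (2 * r%:R) ^+ d in Hr * => DY.
have D0 : 0 <= D by rewrite exprn_ge0// mulr_ge0.
set B := beta2 * (N%:R ^+ K / m%:R).
have B0 : 0 <= B by rewrite mulr_ge0 ?beta2_ge0// divr_ge0// exprn_ge0.
have h1 : A * (X - Y) <= e * D.
  apply: (@le_trans _ _ (A * (e' * D))); first by rewrite ler_wpM2l//; lra.
  by rewrite mulrA ler_wpM2r.
have h2 : X <= 2 * D by have := ler_wpM2r D0 e'1; lra.
have h3 : B * X <= B * (2 * D) by rewrite ler_wpM2l.
rewrite (_ : 8 * beta2 * _ * X = 8 * (B * X)); last by rewrite /B; ring.
rewrite (_ : (e + _) * D = e * D + 8 * (B * (2 * D))); last by rewrite /B; ring.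
lra.
Qed.

End SpectralEstimate.

(** * Fourier transform of a bump *)

Section Bump.
Context {R : realType} {d : nat}.
Local Notation V := ('rV[R]_d).
Local Notation BV := (borel_rV R d).
Local Notation leb := (@lebesgue_rV R d).
Local Notation C := (R[i]).

Lemma coord_le_norm (x : V) i : `|x 0 i| <= `|x|.
Proof.
rewrite [leRHS]/Num.norm /= mx_normrE; apply/bigmax_geP; right => /=.
by exists (0, i).
Qed.

Lemma norm_le_coord (x : V) (a : R) : 0 <= a -> (forall i, `|x 0 i| <= a) -> `|x| <= a.
Proof.
move=> a0 H; rewrite [leLHS]/Num.norm /= mx_normrE; apply/bigmax_leP; split=> // -[i j] _ /=.
by rewrite ord1.
Qed.

Lemma measurableM_bounded (f g : BV -> R) (M : R) :
  measurable_fun setT g -> (forall x, `|g x| <= M) ->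
  leb.-integrable setT (EFin \o f) -> leb.-integrable setT (EFin \o (fun x => g x * f x)).
Proof.
move=> mg gM fi.
rewrite (_ : _ \o _ = ((EFin \o g) \* (EFin \o f))%E); last first.
  by apply/funext => x /=; rewrite EFinM.
apply: integrableMr => //; exists M; split; first exact: num_real.
by move=> y My x _; exact: (le_trans (gM x) (ltW My)).
Qed.

Variables (e : R) (e0 : 0 < e).

(** The norm is the maximum norm: a tent over a cube, even, 1-Lipschitz and compactly supported. *)
Definition bump (x : V) : R := Num.max 0 (e - `|x|).

Lemma bump_ge0 x : 0 <= bump x.
Proof. by rewrite le_max lexx. Qed.

Lemma bump_le x : bump x <= e.
Proof. by rewrite ge_max ltW//= gerBl. Qed.

Lemma bump_eq0 x : e <= `|x| -> bump x = 0.
Proof. by move=> h; apply/max_idPl; rewrite subr_le0. Qed.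

Lemma bump_ge x : e - `|x| <= bump x.
Proof. by rewrite le_max lexx orbT. Qed.

Lemma bumpN x : bump (- x) = bump x.
Proof. by rewrite /bump normrN. Qed.

Lemma bump_lip x y : `|bump x - bump y| <= `|x - y|.
Proof.
wlog h : x y / bump y <= bump x.
  move=> H; have [yx|/ltW xy] := leP (bump y) (bump x); first exact: H.
  by rewrite distrC [leRHS]distrC; exact: H.
rewrite ger0_norm ?subr_ge0// lerBlDr {1}/bump ge_max; apply/andP; split.
  by rewrite addr_ge0// bump_ge0.
have := bump_ge y; have := lerB_dist y x; rewrite distrC; lra.
Qed.

Lemma bump_continuous : continuous bump.
Proof.
move=> x; apply/(@cvgrPdist_lt _ _ _ _ (nbhs_filter x)) => a a0.
apply/nbhs_ballP; exists a => //= y.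
by rewrite mx_norm_ball /ball_ /=; apply: le_lt_trans; exact: bump_lip.
Qed.

Lemma measurable_bump : measurable_fun setT (bump : BV -> R).
Proof. by apply: continuous_measurable_rV; exact: bump_continuous. Qed.

Lemma measurable_bumpB (y : V) : measurable_fun setT ((fun x => bump (x - y)) : BV -> R).
Proof. exact: (measurableT_comp measurable_bump (measurable_funD_rV (- y))). Qed.

Lemma integrable_bump : leb.-integrable setT (EFin \o bump).
Proof.
have -> : bump = (bump : BV -> R) \_ (cbox e).
  apply/funext => x; rewrite patchE; case: ifPn => //; rewrite notin_setE /cbox /= => H.
  apply: bump_eq0; rewrite leNgt; apply/negP => xe; apply: H => i.
  by rewrite -ler_norml (le_trans (coord_le_norm x i))// ltW.
rewrite -restrict_EFin -integrable_mkcond; last exact: measurable_cbox.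
apply: (@integrable_cbox _ _ _ e); [exact: ltW|exact: measurable_bump|].
by move=> x; rewrite ger0_norm ?bump_ge0 ?bump_le.
Qed.

Definition mass : R := \int[leb]_x bump x.

Lemma integrable_bumpB (y : V) : leb.-integrable setT (EFin \o (fun x => bump (x - y))).
Proof.
apply: (integrable_invariant (measurable_funD_rV (- y)) _ measurable_bump integrable_bump).
by move=> A mA; exact: lebesgue_rVD.
Qed.

Lemma Rintegral_bumpB (y : V) : \int[leb]_x bump (x - y) = mass.
Proof.
apply: (Rintegral_invariant (measurable_funD_rV (- y)) _ measurable_bump (integrable_bumpB y)).
by move=> A mA; exact: lebesgue_rVD.
Qed.

Definition theta (k x : V) : R := 2 * pi * \sum_i k 0 i * x 0 i.

Lemma thetaD k x y : theta k (x + y) = theta k x + theta k y.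
Proof.
rewrite /theta -mulrDr -big_split; congr (_ * _).
by apply: eq_bigr => i _; rewrite mxE mulrDr.
Qed.

Lemma thetaN k x : theta k (- x) = - theta k x.
Proof.
rewrite /theta -mulrN -sumrN; congr (_ * _).
by apply: eq_bigr => i _; rewrite mxE mulrN.
Qed.

Lemma measurable_theta k : measurable_fun setT (theta k : BV -> R).
Proof.
apply: measurable_funM => //; apply: measurable_sum => i.
by apply: measurable_funM => //; exact: measurable_coord_rV.
Qed.

Lemma measurable_cos_theta k : measurable_fun setT ((fun x => cos (theta k x)) : BV -> R).
Proof.
exact: (measurableT_comp (continuous_measurable_fun (@continuous_cos R)) (measurable_theta k)).
Qed.

Lemma measurable_sin_theta k : measurable_fun setT ((fun x => sin (theta k x)) : BV -> R).
Proof.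
exact: (measurableT_comp (continuous_measurable_fun (@continuous_sin R)) (measurable_theta k)).
Qed.

(** The Fourier transform of the tent; the sine part vanishes because the tent is even
    ([Rintegral_sin_bump]). *)
Definition Phi (k : V) : R := \int[leb]_x (cos (theta k x) * bump x).

Let icos k := measurableM_bounded (measurable_cos_theta k) (fun x => cos_normr_le1 _) integrable_bump.
Let isin k := measurableM_bounded (measurable_sin_theta k) (fun x => sin_normr_le1 _) integrable_bump.

Let measurable_sin_bump k : measurable_fun setT ((fun x => sin (theta k x) * bump x) : BV -> R).
Proof. by apply: measurable_funM; [exact: measurable_sin_theta|exact: measurable_bump]. Qed.

Lemma Rintegral_sin_bump k : \int[leb]_x (sin (theta k x) * bump x) = 0.
Proof.
have Ninv A (mA : measurable A) := @lebesgue_rVN R d A mA.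
have H := Rintegral_invariant (@measurable_funN_rV R d) Ninv (measurable_sin_bump k)
  (integrable_invariant (@measurable_funN_rV R d) Ninv (measurable_sin_bump k) (isin k)).
set I := (X in X = _); suff : I = - I by lra.
rewrite {1}/I -H -[RHS]mulN1r -(RintegralZl _ measurableT (isin k)).
by apply: eq_Rintegral => x _; rewrite thetaN sinN bumpN mulN1r mulNr.
Qed.

Let icosB k y := measurableM_bounded (measurable_cos_theta k) (fun x => cos_normr_le1 _) (integrable_bumpB y).
Let isinB k y := measurableM_bounded (measurable_sin_theta k) (fun x => sin_normr_le1 _) (integrable_bumpB y).

Let measurable_cos_bumpB k y :
  measurable_fun setT ((fun x => cos (theta k x) * bump (x - y)) : BV -> R).
Proof. by apply: measurable_funM; [exact: measurable_cos_theta|exact: measurable_bumpB]. Qed.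

Let measurable_sin_bumpB k y :
  measurable_fun setT ((fun x => sin (theta k x) * bump (x - y)) : BV -> R).
Proof. by apply: measurable_funM; [exact: measurable_sin_theta|exact: measurable_bumpB]. Qed.

Let iZ (c : R) (f : BV -> R) : leb.-integrable setT (EFin \o f) ->
  leb.-integrable setT (EFin \o (fun x => c * f x)).
Proof.
move=> fi; apply: (@measurableM_bounded f (fun=> c) `|c|) => //.
Qed.

Lemma Rintegral_cos_bumpB k y :
  \int[leb]_x (cos (theta k x) * bump (x - y)) = cos (theta k y) * Phi k.
Proof.
have Dinv A (mA : measurable A) := @lebesgue_rVD R d y A mA.
rewrite -(Rintegral_invariant (measurable_funD_rV y) Dinv (measurable_cos_bumpB k y)
  (integrable_invariant (measurable_funD_rV y) Dinv (measurable_cos_bumpB k y) (icosB k y))).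
transitivity (\int[leb]_x (cos (theta k y) * (cos (theta k x) * bump x) - sin (theta k y) * (sin (theta k x) * bump x))).
  by apply: eq_Rintegral => x _; rewrite addrK thetaD cosD; ring.
rewrite RintegralB//; [|exact/iZ/icos|exact/iZ/isin].
by rewrite !RintegralZl// Rintegral_sin_bump mulr0 subr0.
Qed.

Lemma Rintegral_sin_bumpB k y :
  \int[leb]_x (sin (theta k x) * bump (x - y)) = sin (theta k y) * Phi k.
Proof.
have Dinv A (mA : measurable A) := @lebesgue_rVD R d y A mA.
rewrite -(Rintegral_invariant (measurable_funD_rV y) Dinv (measurable_sin_bumpB k y)
  (integrable_invariant (measurable_funD_rV y) Dinv (measurable_sin_bumpB k y) (isinB k y))).
transitivity (\int[leb]_x (sin (theta k y) * (cos (theta k x) * bump x) + cos (theta k y) * (sin (theta k x) * bump x))).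
  by apply: eq_Rintegral => x _; rewrite addrK thetaD sinD; ring.
rewrite RintegralD//; [|exact/iZ/icos|exact/iZ/isin].
by rewrite !RintegralZl// Rintegral_sin_bump mulr0 addr0.
Qed.

(** The convolution of the tents centred at z and at 0, the form of test function that
    [is_fourier_transform] asks for. Its transform is the character of z times [Phi]^2. *)
Definition bump2 (z x : V) : R := \int[leb]_y (bump (y - z) * bump (x - y)).

Let EFin_Rint (g : BV -> R) : leb.-integrable setT (EFin \o g) ->
  (\int[leb]_x (g x)%:E = (\int[leb]_x g x)%:E)%E.
Proof. by move=> gi; rewrite /Rintegral fineK// (integrable_fin_num measurableT gi). Qed.

Lemma integrable_bump2_integrand z x :
  leb.-integrable setT (EFin \o (fun y => bump (y - z) * bump (x - y))).
Proof.
rewrite (_ : (fun y => _) = (fun y => bump (y - z) * bump (y - x))); last first.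
  by apply/funext => y; rewrite -[bump (x - y)]bumpN opprB.
apply: (@measurableM_bounded _ _ e (measurable_bumpB z)); last exact: integrable_bumpB.
by move=> y; rewrite ger0_norm ?bump_ge0 ?bump_le.
Qed.

(** Fubini, done once for T a cosine and T a sine. Integrability on the product follows from
    Tonelli, since |T| <= 1 and the inner integral of the tent is [mass]. *)
Lemma Rintegral_bump2 (T : BV -> R) (c : V -> R) z : measurable_fun setT T ->
  (forall x, `|T x| <= 1) -> (forall y, \int[leb]_x (T x * bump (x - y)) = c y) ->
  \int[leb]_x (T x * bump2 z x) = \int[leb]_y (c y * bump (y - z)).
Proof.
move=> mT T1 Tc.
pose f (p : BV * BV) := T p.1 * (bump (p.2 - z) * bump (p.1 - p.2)).
have mdiff : measurable_fun setT ((fun p : BV * BV => p.1 - p.2) : BV * BV -> BV).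
  apply: measurable_fun_rV => i.
  rewrite (_ : (fun _ => _) = (fun p : BV * BV => p.1 0 i - p.2 0 i)); last first.
    by apply/funext => p; rewrite !mxE.
  apply: measurable_funB.
    exact: (measurableT_comp (measurable_coord_rV i) measurable_fst).
  exact: (measurableT_comp (measurable_coord_rV i) measurable_snd).
have mf : measurable_fun setT f.
  apply: measurable_funM; first exact: (measurableT_comp mT measurable_fst).
  apply: measurable_funM; first exact: (measurableT_comp (measurable_bumpB z) measurable_snd).
  exact: (measurableT_comp measurable_bump mdiff).
have iTB y : leb.-integrable setT (EFin \o (fun x => T x * bump (x - y))).
  by apply: measurableM_bounded mT T1 (integrable_bumpB y).
have fy y : (\int[leb]_x (f (x, y))%:E = (c y * bump (y - z))%:E)%E.
  rewrite mulrC -Tc -RintegralZl// -EFin_Rint; last exact/iZ/iTB.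
  by apply: eq_integral => x _; rewrite /f /=; congr (_%:E); ring.
have fx x : (\int[leb]_y (f (x, y))%:E = (T x * bump2 z x)%:E)%E.
  rewrite /bump2 -RintegralZl//; last exact: integrable_bump2_integrand.
  by rewrite -EFin_Rint//; apply: iZ; exact: integrable_bump2_integrand.
have mfE : measurable_fun setT (EFin \o f) by exact/measurable_EFinP.
have ifz : (leb \x leb)%E.-integrable setT (EFin \o f).
  apply/integrable21ltyP => //.
  apply: (@le_lt_trans _ _ (\int[leb]_y ((mass * bump (y - z))%:E))%E); last first.
    by rewrite EFin_Rint ?ltry//; apply: iZ; exact: integrable_bumpB.
  apply: ge0_le_integral => //.
  - by move=> y _; exact: integral_ge0.
  - have H : measurable_fun setT (fun p => `|(EFin \o f) p|%E) by exact: measurableT_comp.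
    exact: (measurable_fun_fubini_tonelli_G (m1 := leb) _ H (fun=> abse_ge0 _)).
  - by apply/measurable_EFinP; apply: measurable_funM => //; exact: measurable_bumpB.
  move=> y _; rewrite mulrC -[mass](Rintegral_bumpB y) -RintegralZl//; last exact: integrable_bumpB.
  rewrite -EFin_Rint; last by apply: iZ; exact: integrable_bumpB.
  apply: ge0_le_integral => //.
  - by apply: measurableT_comp => //; apply: (measurableT_comp mfE); exact: pair2_measurable.
  - by apply/measurable_EFinP; apply: measurable_funM => //; exact: measurable_bumpB.
  - move=> x _; rewrite /= lee_fin normrM [X in _ * X]ger0_norm ?mulr_ge0 ?bump_ge0//.
    by rewrite ler_piMl ?mulr_ge0 ?bump_ge0.
rewrite /Rintegral; congr fine.
under eq_integral do rewrite -fx.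
under [RHS]eq_integral do rewrite -fy.
exact: (Fubini ifz).
Qed.

Lemma Rintegral_cos_bump2 k z :
  \int[leb]_x (cos (theta k x) * bump2 z x) = cos (theta k z) * Phi k ^+ 2.
Proof.
rewrite (Rintegral_bump2 z (measurable_cos_theta k) (fun x => cos_normr_le1 _) (Rintegral_cos_bumpB k)).
under eq_Rintegral do rewrite mulrAC mulrC.
rewrite (RintegralZl _ measurableT (icosB k z)) Rintegral_cos_bumpB; ring.
Qed.

Lemma Rintegral_sin_bump2 k z :
  \int[leb]_x (sin (theta k x) * bump2 z x) = sin (theta k z) * Phi k ^+ 2.
Proof.
rewrite (Rintegral_bump2 z (measurable_sin_theta k) (fun x => sin_normr_le1 _) (Rintegral_sin_bumpB k)).
under eq_Rintegral do rewrite mulrAC mulrC.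
rewrite (RintegralZl _ measurableT (isinB k z)) Rintegral_sin_bumpB; ring.
Qed.

Lemma bump2_lip z x x' : `|bump2 z x - bump2 z x'| <= mass * `|x - x'|.
Proof.
rewrite /bump2 -RintegralB//; [|exact: integrable_bump2_integrand..].
have iD : leb.-integrable setT (EFin \o (fun y => bump (y - z) * bump (x - y) - bump (y - z) * bump (x' - y))).
  rewrite (_ : _ \o _ = ((EFin \o (fun y => bump (y - z) * bump (x - y))%R) \- (EFin \o (fun y => bump (y - z) * bump (x' - y))%R))%E)//.
  by apply: integrableB => //; exact: integrable_bump2_integrand.
apply: (le_trans (le_normr_Rintegral _ iD)) => //.
rewrite -(Rintegral_bumpB z) -RintegralZr//; last exact: integrable_bumpB.
apply: le_Rintegral => //.
- have /integrable_abse := iD; by apply: eq_integrable.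
- rewrite (_ : (fun y => bump (y - z) * `|x - x'|) = (fun y => `|x - x'| * bump (y - z))).
    exact: iZ (integrable_bumpB z).
  by apply/funext => y; rewrite mulrC.
move=> y _; rewrite -mulrBr normrM ger0_norm ?bump_ge0// ler_wpM2l ?bump_ge0//.
by rewrite (le_trans (bump_lip _ _))// opprB addrA subrK.
Qed.

Lemma bump2_eq0 z x : 2 * e <= `|x - z| -> bump2 z x = 0.
Proof.
move=> h; rewrite /bump2; under eq_Rintegral => y _.
  rewrite (_ : _ * _ = 0); first over.
  have [yz|yz] := leP e `|y - z|; first by rewrite bump_eq0// mul0r.
  rewrite [X in _ * X]bump_eq0 ?mulr0//.
  have := ler_distD y x z; lra.
by rewrite Rintegral_cst// mul0r.
Qed.

Definition bump20 : R := \int[leb]_y (bump y ^+ 2).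

Lemma bump2_diag z : bump2 z z = bump20.
Proof.
rewrite /bump2 /bump20.
have Dinv A (mA : measurable A) := @lebesgue_rVD R d (- z) A mA.
have m2 : measurable_fun setT ((fun y => bump y ^+ 2) : BV -> R).
  by apply: measurable_funX; exact: measurable_bump.
have E y : bump (y - z) * bump (z - y) = bump (y - z) ^+ 2.
  by rewrite -[bump (z - y)]bumpN opprB expr2.
rewrite -(Rintegral_invariant (measurable_funD_rV (- z)) Dinv m2).
  by apply: eq_Rintegral => y _.
rewrite (_ : _ \o _ = EFin \o (fun y => bump (y - z) * bump (z - y))).
  exact: integrable_bump2_integrand.
by apply/funext => y /=; rewrite E.
Qed.

Lemma bump20_ge0 : 0 <= bump20.
Proof. by apply: Rintegral_ge0 => y _; exact: sqr_ge0. Qed.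

End Bump.

(** * Positivity of the weight at low frequencies *)

Section PhiPositive.
Context {R : realType} {d : nat}.
Local Notation V := ('rV[R]_d).
Local Notation BV := (borel_rV R d).
Local Notation leb := (@lebesgue_rV R d).
Variables (e : R) (e0 : 0 < e).

Lemma mass_gt0 : 0 < @mass R d e.
Proof.
have e2 : 0 <= e / 2 by rewrite divr_ge0// ltW.
apply: (@lt_le_trans _ _ (\int[leb]_(x in cbox (e / 2)) (e / 2))).
  rewrite Rintegral_cbox_cst// mulr_gt0 ?divr_gt0//.
  by rewrite exprn_gt0// mulr_gt0// divr_gt0.
rewrite Rintegral_mkcond; apply: le_Rintegral => //.
- rewrite -restrict_EFin -integrable_mkcond; last exact: measurable_cbox.
  apply: (@integrable_cbox _ _ _ (e / 2)) => // _; by rewrite ger0_norm.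
- exact: integrable_bump.
move=> x _; rewrite patchE; case: ifPn => [/set_mem H|_]; last exact: bump_ge0.
apply: (le_trans _ (bump_ge e x)).
have : `|x| <= e / 2 by apply: norm_le_coord => // i; rewrite ler_norml; exact: H.
by rewrite [in X in _ -> _ <= X](splitr e); lra.
Qed.

(** The hypothesis keeps the phase within 1/2 on the support of the tent, where the cosine is at
    least cos (1/2) > 0. For each k it holds once e is small. *)
Lemma Phi_gt0 (k : V) : 2 * pi * (\sum_i `|k 0 i|) * e <= 2^-1 -> 0 < Phi e k.
Proof.
move=> H; pose c0 := cos (2^-1 : R).
have p1 : 1 <= pi / 2 :> R by exact: pihalf_ge1.
have c0_gt0 : 0 < c0 by apply: cos_gt0_pihalf; lra.
apply: (@lt_le_trans _ _ (c0 * @mass R d e)); first by rewrite mulr_gt0// mass_gt0.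
rewrite /mass -RintegralZl//; last exact: integrable_bump.
apply: le_Rintegral => //.
- exact: (@measurableM_bounded _ _ _ (fun=> c0) `|c0| (measurable_cst _) (fun=> lexx _) (integrable_bump e0)).
- exact: (measurableM_bounded (measurable_cos_theta k) (fun x => cos_normr_le1 _) (integrable_bump e0)).
move=> x _; have [xe|xe] := leP e `|x|; first by rewrite bump_eq0// !mulr0.
rewrite ler_wpM2r ?bump_ge0//.
have : `|theta k x| <= 2^-1.
  apply: le_trans H; rewrite /theta normrM ger0_norm ?mulr_ge0 ?pi_ge0// -mulrA ler_wpM2l ?mulr_ge0 ?pi_ge0//.
  rewrite (le_trans (ler_norm_sum _ _ _))// mulr_suml; apply: ler_sum => i _.
  by rewrite normrM ler_wpM2l// (le_trans (coord_le_norm x i))// ltW.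
have -> : cos (theta k x) = cos `|theta k x|.
  by have [//|_] := ger0P (theta k x); rewrite cosN.
set y := `|theta k x| => y2; rewrite /c0.
have y0 : 0 <= y by exact: normr_ge0.
have pi1 : 2 <= pi :> R by exact: pi_ge2.
rewrite leNgt ltr_cos -?leNgt// in_itv /=; lra.
Qed.

End PhiPositive.

(** * Autocorrelation coefficients read off with tents *)

Section Diffraction.
Context {R : realType} {d : nat}.
Local Notation V := ('rV[R]_d).
Local Notation BV := (borel_rV R d).
Local Notation leb := (@lebesgue_rV R d).
Local Notation C := (R[i]).
Local Notation Z := ('rV[int]_d).
Variables (e : R) (e0 : 0 < e) (e1 : 2 * e <= 1).

Definition bumpC (z : V) (x : V) : C := (bump e (x - z))%:C.

Lemma real_complex_continuous (f : V -> R) :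
  continuous f -> continuous ((fun x => (f x)%:C) : V -> R[i]^o).
Proof.
move=> cf x; apply/(@cvgrPdist_lt _ _ _ _ (nbhs_filter x)) => a a0.
have aR : a = (complex.Re a)%:C by apply: rc_ge0; exact: ltW.
have a0' : 0 < complex.Re a by rewrite -ltcR -aR.
have /(@cvgrPdist_lt _ _ _ _ (nbhs_filter x))/(_ _ a0') := cf x.
apply: filterS => y /=; rewrite -rcB normc_def /= expr0n /= addr0 sqrtr_sqr.
by rewrite {2}aR ltcR.
Qed.

Lemma compact_ball (z : V) (r : R) : compact [set x : V | `|x - z| <= r].
Proof.
apply: bounded_closed_compact.
  exists (r + `|z|); split; first exact: num_real.
  move=> y hy x /= xz; rewrite (le_trans _ (ltW hy))//.
  by rewrite -[x in `|x|](subrK z) (le_trans (ler_normD _ _))// lerD2r.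
have -> : [set x : V | `|x - z| <= r] = (fun x : V => `|x - z|) @^-1` [set y | y <= r] by [].
apply: closed_comp; last exact: closed_le.
move=> x _; apply/(@cvgrPdist_lt _ _ _ _ (nbhs_filter x)) => a a0.
apply/nbhs_ballP; exists a => //= y; rewrite mx_norm_ball /ball_ /=; apply: le_lt_trans.
by rewrite (le_trans (ler_dist_dist _ _))// opprB addrA subrK.
Qed.

Lemma Cc_bumpC z : Cc (bumpC z).
Proof.
split.
  apply: real_complex_continuous => x.
  apply/(@cvgrPdist_lt _ _ _ _ (nbhs_filter x)) => a a0.
  apply/nbhs_ballP; exists a => //= y; rewrite mx_norm_ball /ball_ /=; apply: le_lt_trans.
  by rewrite (le_trans (bump_lip _ _ _))// opprB addrA subrK.
exists [set x : V | `|x - z| <= e]; first exact: compact_ball.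
by move=> x /negP; rewrite -ltNge => /ltW h; rewrite /bumpC bump_eq0.
Qed.

Lemma convolution_bumpC z x : convolution (bumpC z) (bumpC 0) x = (bump2 e z x)%:C.
Proof.
rewrite /convolution /complex_integral /bumpC /bump2 -complexr0.
congr Complex.
  by apply: eq_Rintegral => y _; rewrite subr0 -rcM.
under eq_Rintegral => y _ do rewrite -rcM /=.
by rewrite Rintegral_cst// mul0r.
Qed.

(** The autocorrelation is given as a limit on [Cc], and it has to be evaluated at this
    convolution. *)
Lemma Cc_conv z : Cc (convolution (bumpC z) (bumpC 0)).
Proof.
have -> : convolution (bumpC z) (bumpC 0) = (fun x => (bump2 e z x)%:C).
  by apply/funext => x; exact: convolution_bumpC.
split.
  apply: real_complex_continuous => x.
  apply/(@cvgrPdist_lt _ _ _ _ (nbhs_filter x)) => a a0.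
  have m0 := @mass_gt0 R d e e0.
  apply/nbhs_ballP; exists (a / @mass R d e) => /= [|y]; first exact: divr_gt0.
  rewrite mx_norm_ball /ball_ /= ltr_pdivlMr// mulrC; apply: le_lt_trans.
  exact: bump2_lip.
exists [set x : V | `|x - z| <= 2 * e]; first exact: compact_ball.
by move=> x /negP; rewrite -ltNge => /ltW h; rewrite bump2_eq0.
Qed.

Lemma inverse_fourier_conv (z : Z) (k : V) :
  inverse_fourier (convolution (bumpC (map_mx intr z)) (bumpC 0)) k =
  chi z k * (Phi e k ^+ 2)%:C.
Proof.
rewrite /inverse_fourier /complex_integral chiE.
have E x : expi k x * convolution (bumpC (map_mx intr z)) (bumpC 0) x =
    (cos (theta k x) * bump2 e (map_mx intr z) x) +i* (sin (theta k x) * bump2 e (map_mx intr z) x).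
  by rewrite convolution_bumpC /expi -/(theta k x); simpc.
have T : theta k (map_mx intr z) = 2 * pi * dotz k z.
  by rewrite /theta; congr (_ * _); apply: eq_bigr => i _; rewrite mxE.
transitivity ((cos (theta k (map_mx intr z)) * Phi e k ^+ 2) +i* (sin (theta k (map_mx intr z)) * Phi e k ^+ 2)).
  rewrite -Rintegral_cos_bump2// -Rintegral_sin_bump2//.
  by congr Complex; apply: eq_Rintegral => x _; rewrite E.
by rewrite T; simpc.
Qed.

(** The support has radius 2e <= 1 in the maximum norm, while distinct lattice points differ by at
    least 1 in some coordinate. *)
Lemma bump2_int (x z : Z) :
  bump2 e (map_mx intr z) (map_mx intr x : V) = (x == z)%:R * @bump20 R d e.
Proof.
have [->|xz] := eqVneq x z; first by rewrite mul1r bump2_diag.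
rewrite mul0r bump2_eq0// (le_trans e1)// -map_mxB.
have [i xzi] : exists i, x 0 i != z 0 i.
  apply/existsP; rewrite -negb_forall; apply: contra xz => /forallP H.
  by apply/eqP/rowP => i; apply/eqP; exact: H.
apply: le_trans (coord_le_norm _ i); rewrite !mxE -intr_norm -[leLHS]/(1%:~R) ler_int.
by rewrite -gtz0_ge1 normr_gt0 subr_eq0.
Qed.

Variable c : Z -> C.

Lemma dirac_comb_cube (r : nat) (g : V -> C) :
  dirac_comb c (@cube R d r%:R) g = \sum_(x <- cubeseq r) c x * g (map_mx intr x).
Proof.
rewrite /dirac_comb (_ : cube _ = [set` (cubeseq r : seq Z)]); last first.
  apply/seteqP; split => x; rewrite /cube /=.
    by move=> H; apply/mem_cubeseq => i; have := H i; rewrite -intr_norm -[X in _ <= X]/((r%:Z)%:~R) ler_int.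
  by move=> /mem_cubeseq H i; rewrite -intr_norm -[leRHS]/((r%:Z)%:~R) ler_int.
rewrite [RHS]fsbig_seq; last exact: uniq_cubeseq.
by [].
Qed.

(** Both sides collect the pairs with x - y = z: on the left because the test function vanishes at
    all lattice points but z, on the right by orthogonality of characters. *)
Lemma conv_dirac_comb (r : nat) (z : Z) :
  conv_functional (dirac_comb c (@cube R d r%:R))
    (tilde_functional (dirac_comb c (@cube R d r%:R)))
    (convolution (bumpC (map_mx intr z)) (bumpC 0)) =
  (@bump20 R d e)%:C * mean 1 (fun k : V => chi z k * `|windowsum c r k| ^+ 2).
Proof.
rewrite /conv_functional dirac_comb_cube.
transitivity (\sum_(x <- cubeseq r) c x * (\sum_(y <- cubeseq r) conjc (c y) * ((@bump20 R d e)%:C * (z - x + y == 0)%:R))).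
  apply: eq_bigr => x _; congr (_ * _).
  rewrite /tilde_functional dirac_comb_cube -[LHS]/(conjc _) conjc_sum; apply: eq_bigr => y _.
  rewrite conjcM; congr (_ * _); rewrite /tilde_fun -[LHS]/(conjc (conjc _)) conjcK.
  rewrite -map_mxN -map_mxD convolution_bumpC bump2_int rcM rc_nat mulrC; congr (_ * (nat_of_bool _)%:R).
  by rewrite -subr_eq0 -oppr_eq0; congr (_ == 0); rewrite opprB opprB addrA addrAC.
transitivity ((@bump20 R d e)%:C * mean 1 (fun k : V => \sum_(x <- cubeseq r) c x * (\sum_(y <- cubeseq r) conjc (c y) * chi (z - x + y) k))).
  rewrite mean_sum; last by move=> x; apply: tp_sum => y; apply: tpM; [exact: tp_cst|exact: tp_chi].
  rewrite mulr_sumr; apply: eq_bigr => x _.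
  rewrite mean_sum; last by move=> y; exact: tp_chi.
  rewrite mulrCA; congr (_ * _); rewrite mulr_sumr; apply: eq_bigr => y _.
  by rewrite mean_chi// mulrCA.
congr (_ * _); apply: eq_mean => k.
rewrite sqnormE /windowsum conjc_sum mulr_suml mulr_sumr; apply: eq_bigr => x _.
rewrite !mulr_sumr; apply: eq_bigr => y _.
by rewrite conjcM -chiN opprK !chiD; ring.
Qed.

End Diffraction.

(** * Testing the diffraction measure *)

Section Limit.
Context {R : realType} {d : nat}.
Local Notation V := ('rV[R]_d).
Local Notation BV := (borel_rV R d).
Local Notation leb := (@lebesgue_rV R d).
Local Notation C := (R[i]).
Local Notation Z := ('rV[int]_d).
Variables (c : Z -> C) (gamma : (V -> C) -> C).
Hypothesis gammaP : is_autocorrelation c gamma.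
Variable gammahat : {measure set BV -> \bar R}.
Hypothesis gammahatP : is_fourier_transform gamma gammahat.
Variables (e : R) (e0 : 0 < e) (e1 : 2 * e <= 1).

Let W (k : V) : C := (Phi e k ^+ 2)%:C.

(** Integration against the diffraction measure with weight [Phi]^2. Its counterpart for a window of
    radius r is [finint], and [finint_cvg] links the two. *)
Definition hatint (f : V -> C) : C := cint gammahat setT ((fun k => f k * W k) : BV -> C).

Definition finint (f : V -> C) (r : nat) : C :=
  ((2 * r%:R) ^- d)%:C * ((@bump20 R d e)%:C * mean 1 (fun k => f k * `|windowsum c r k| ^+ 2)).

Let hatintE z : (fun k => chi z k * W k) =
  inverse_fourier (convolution (bumpC e (map_mx intr z)) (bumpC e 0)).
Proof. by apply/funext => k; rewrite inverse_fourier_conv. Qed.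

Lemma cintegrable_hat_chi z : cintegrable gammahat setT ((fun k => chi z k * W k) : BV -> C).
Proof.
have [_ /(_ _ _ (Cc_bumpC e (map_mx intr z)) (Cc_bumpC e 0))[H _]] := gammahatP.
by rewrite hatintE.
Qed.

Lemma hatint_chi z : hatint (chi z) =
  gamma (convolution (bumpC e (map_mx intr z)) (bumpC e 0)).
Proof.
have [_ /(_ _ _ (Cc_bumpC e (map_mx intr z)) (Cc_bumpC e 0))[_ <-]] := gammahatP.
by rewrite /hatint hatintE.
Qed.

Lemma cintegrable_hat f : tp f -> cintegrable gammahat setT ((fun k => f k * W k) : BV -> C).
Proof.
move=> [s fs].
have [|H _] := @cint_sum _ _ _ gammahat _ measurableT _ s (fun p => p.1) (fun p k => chi p.2 k * W k).
  by move=> p; exact: cintegrable_hat_chi.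
rewrite (_ : (fun k => _) = (fun k : BV => \sum_(i <- s) i.1 * (chi i.2 k * W k)))//.
by apply/funext => k; rewrite fs mulr_suml; apply: eq_bigr => p _; rewrite mulrA.
Qed.

Lemma hatint_sum (s : seq (C * Z)) :
  hatint (fun k => \sum_(p <- s) p.1 * chi p.2 k) = \sum_(p <- s) p.1 * hatint (chi p.2).
Proof.
have [|_ <-] := @cint_sum _ _ _ gammahat _ measurableT _ s (fun p => p.1) (fun p k => chi p.2 k * W k).
  by move=> p; exact: cintegrable_hat_chi.
apply: eq_cint => k _; rewrite mulr_suml; apply: eq_bigr => p _; by rewrite mulrA.
Qed.

Lemma finint_sum (s : seq (C * Z)) r :
  finint (fun k => \sum_(p <- s) p.1 * chi p.2 k) r = \sum_(p <- s) p.1 * finint (chi p.2) r.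
Proof.
have T z : tp (fun k => chi z k * `|windowsum c r k| ^+ 2).
  by apply: tpM; [exact: tp_chi|exact/tp_sqnorm/tp_windowsum].
rewrite /finint.
transitivity (((2 * r%:R) ^- d)%:C * ((@bump20 R d e)%:C * mean 1 (fun k => \sum_(p <- s) p.1 * (chi p.2 k * `|windowsum c r k| ^+ 2)))).
  congr (_ * (_ * _)); apply: eq_mean => k; rewrite mulr_suml.
  by apply: eq_bigr => p _; rewrite mulrA.
rewrite mean_sum; last by move=> p; exact: T.
rewrite !mulr_sumr; apply: eq_bigr => p _; ring.
Qed.

Lemma finint_chi_cvg z (a : R) : 0 < a -> exists r0 : nat, forall r, (r0 <= r)%N ->
  `|hatint (chi z) - finint (chi z) r| <= a%:C.
Proof.
move=> a0; have H := gammaP (Cc_conv e0 (map_mx intr z)).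
have aC : 0 < a%:C :> C by rewrite ltcR.
move/cvgrPdist_lt : H => /(_ _ aC)[M [_ HM]].
exists (Num.truncn `|M|).+1 => r rM.
have Mr : M < r%:R.
  rewrite (le_lt_trans (ler_norm _))// (lt_le_trans (truncnS_gt _))// ler_nat//.
have := HM _ Mr; rewrite /= conv_dirac_comb// hatint_chi => /ltW.
by rewrite /finint.
Qed.

Lemma finint_cvg f (a : R) : tp f -> 0 < a -> exists r0 : nat, forall r, (r0 <= r)%N ->
  `|hatint f - finint f r| <= a%:C.
Proof.
move=> [s fs] a0.
rewrite (_ : f = (fun k => \sum_(p <- s) p.1 * chi p.2 k)); last exact/funext.
under eq_exists do under eq_forall do rewrite hatint_sum finint_sum -sumrB.
elim: s a a0 {fs} => [|p s IH] a a0.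
  by exists 0%N => r _; rewrite big_nil normr0 ler0c ltW.
pose b := complex.Re `|p.1|.
have bE : `|p.1| = b%:C by exact: rc_ge0.
have b0 : 0 <= b by rewrite -ler0c -bE.
have a2 : 0 < a / 2 by rewrite divr_gt0.
have [r1 H1] := IH _ a2.
have a3 : 0 < a / 2 / (b + 1) by rewrite divr_gt0// ltr_wpDl.
have [r2 H2] := finint_chi_cvg p.2 a3.
exists (maxn r1 r2) => r; rewrite geq_max => /andP[/H1 h1 /H2 h2].
rewrite big_cons (le_trans (ler_normD _ _))// (splitr a) rcD addrC lerD//.
rewrite -mulrBr normrM bE (le_trans (ler_wpM2l _ h2)) ?ler0c// -rcM lecR.
rewrite mulrCA ger_pMr//.
have b1 : 0 < b + 1 by rewrite ltr_wpDl.
by rewrite ler_pdivrMr// mul1r lerDl.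
Qed.

Lemma hatint_ge0 f : (forall k, 0 <= f k) -> 0 <= hatint f.
Proof.
move=> f0; apply: cint_ge0 => // k _; rewrite mulr_ge0// ler0c; exact: sqr_ge0.
Qed.

(** Upper bounds on windows pass to the limit. The factor [bump20] is the value of the test function
    at its centre. *)
Lemma hatint_le f (B : R) : tp f -> (forall k, 0 <= f k) ->
  (forall a, 0 < a -> exists r0 : nat, forall r, (r0 <= r)%N -> (0 < r)%N /\
    mean 1 (fun k => f k * `|windowsum c r k| ^+ 2) <= ((a + B) * (2 * r%:R) ^+ d)%:C) ->
  hatint f <= (@bump20 R d e * B)%:C.
Proof.
move=> tf f0 H.
rewrite (rc_ge0 (hatint_ge0 f0)) lecR; apply/ler_addgt0Pr => a a0.
have b0 := @bump20_ge0 R d e.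
have a2 : 0 < a / 2 by rewrite divr_gt0.
have a3 : 0 < a / 2 / (@bump20 R d e + 1) by rewrite divr_gt0// ltr_wpDl.
have [r1 H1] := finint_cvg tf a2.
have [r2 H2] := H _ a3.
pose r := maxn r1 r2.
have h1 := H1 r (leq_maxl _ _); have [r0 h2] := H2 r (leq_maxr _ _).
have r0' : 0 < (2 * r%:R) ^+ d :> R by rewrite exprn_gt0// mulr_gt0// ltr0n.
have h3 : finint f r <= (@bump20 R d e * (a / 2 / (@bump20 R d e + 1) + B))%:C.
  rewrite /finint (le_trans (ler_wpM2l _ (ler_wpM2l _ h2)))//.
  - by rewrite ler0c invr_ge0 ltW.
  - by rewrite ler0c.
  rewrite -!rcM lecR le_eqVlt; apply/orP; left; apply/eqP.
  by rewrite mulrCA; congr (_ * _); rewrite mulrC mulfK// gt_eqF.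
have h4 : hatint f <= finint f r + (a / 2)%:C.
  rewrite -lerBlDl (le_trans _ h1)// real_ler_norm//.
  rewrite rpredB//; first by rewrite ger0_real// hatint_ge0.
  rewrite ger0_real// mulr_ge0 ?ler0c ?invr_ge0 ?(ltW r0')// mulr_ge0 ?ler0c//.
  by apply: mean_ge0 => k; rewrite mulr_ge0// exprn_ge0.
have := le_trans h4 (lerD h3 (lexx _)).
rewrite {1}(rc_ge0 (hatint_ge0 f0)) -rcD lecR => h5; apply: (le_trans h5).
have h6 : @bump20 R d e * (a / 2 / (@bump20 R d e + 1)) <= a / 2.
  rewrite mulrCA ger_pMr//.
  have b1 : 0 < @bump20 R d e + 1 by rewrite ltr_wpDl.
  by rewrite ler_pdivrMr// mul1r lerDl.
by rewrite mulrDr {3}(splitr a); lra.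
Qed.

Lemma Phi_measurable : measurable_fun setT ((fun k => Phi e k ^+ 2) : BV -> R).
Proof.
have [/measurable_int H _] := cintegrable_hat_chi 0.
apply/measurable_EFinP; rewrite (_ : (fun k => _) = (fun k : BV => complex.Re (chi 0 k * W k)))//.
by apply/funext => k; rewrite chi0 mul1r.
Qed.

(** Markov's inequality. The lower bound on [A] includes [Phi]^2, since [hatint] sees the measure
    only through this weight. *)
Lemma markov_hat f (A : set BV) (B a : R) : tp f -> (forall k, 0 <= f k) ->
  measurable A -> 0 < a -> (forall k, A k -> a <= complex.Re (f k) * Phi e k ^+ 2) ->
  hatint f <= B%:C -> (gammahat A <= (B / a)%:E)%E.
Proof.
move=> tf f0 mA a0 fA fB.
have [i1 _] := cintegrable_hat tf.
have E k : complex.Re (f k * W k) = complex.Re (f k) * Phi e k ^+ 2.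
  by rewrite ReM /= mulr0 subr0.
have H : (a%:E * gammahat A <= B%:E)%E.
  rewrite -integral_cst//.
  apply: (@le_trans _ _ (\int[gammahat]_(k in A) (complex.Re (f k * W k))%:E)%E).
    apply: ge0_le_integral => //.
    - by move=> k _; rewrite lee_fin ltW.
    - by apply: measurable_funTS; exact: measurable_int i1.
    - by move=> k /fA; rewrite lee_fin E.
  apply: (@le_trans _ _ (\int[gammahat]_k (complex.Re (f k * W k))%:E)%E).
    apply: ge0_subset_integral => //; first exact: measurable_int i1.
    move=> k _; rewrite lee_fin E mulr_ge0 ?sqr_ge0//.
    by rewrite -ler0c -rc_ge0.
  rewrite -[X in (_ <= X)%E](fineK (x := B%:E))//.
  rewrite -[leLHS]fineK; last exact: (integrable_fin_num measurableT i1).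
  by rewrite lee_fin; have := fB; rewrite lecE => /andP[_].
by rewrite mulrC EFinM lee_pdivlMl.
Qed.

End Limit.

(** * Markov's inequality for means over boxes *)

Section LebesgueMarkov.
Context {R : realType} {d : nat}.
Local Notation V := ('rV[R]_d).
Local Notation BV := (borel_rV R d).
Local Notation leb := (@lebesgue_rV R d).
Local Notation C := (R[i]).

Lemma mean_indep m m' (f : V -> C) : (0 < m)%N -> (0 < m')%N -> tp f -> mean m f = mean m' f.
Proof.
move=> m0 m0' [s fs]; rewrite (eq_mean _ fs) [RHS](eq_mean _ fs).
rewrite !mean_sum; [|by move=> p; exact: tp_chi..].
by apply: eq_bigr => p _; rewrite !mean_chi.
Qed.

Lemma tp_Re_measurable (f : V -> C) : tp f ->
  measurable_fun setT ((fun k => complex.Re (f k)) : BV -> R).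
Proof.
move=> [s fs].
rewrite (_ : (fun k => _) = (fun k : BV => \sum_(p <- s)
   (complex.Re p.1 * cos (2 * pi * dotz k p.2) - complex.Im p.1 * sin (2 * pi * dotz k p.2)))).
  apply: measurable_sum => p; apply: measurable_funB; apply: measurable_funM => //.
    exact: measurable_cos_dotz.
  exact: measurable_sin_dotz.
apply/funext => k; rewrite fs; elim: s {fs} => [|p s IH]; first by rewrite !big_nil.
by rewrite !big_cons ReD IH ReM chiE.
Qed.

Lemma measurable_tp_ge (f : V -> C) (a : R) : tp f -> measurable ([set k | a <= complex.Re (f k)] : set BV).
Proof.
move=> tf; rewrite (_ : [set k | _] = (fun k : BV => complex.Re (f k)) @^-1` `[a, +oo[).
  by rewrite -[X in measurable X]setTI; apply: (tp_Re_measurable tf).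
by apply/seteqP; split => k; rewrite /= in_itv /= andbT.
Qed.

Lemma markov_mean (m : nat) (f : V -> C) (a B : R) : (0 < m)%N -> tp f ->
  (forall k, 0 <= f k) -> 0 < a -> mean m f = B%:C ->
  (leb ([set k | (a <= complex.Re (f k))%R] `&` cbox m%:R) <= ((2 * m%:R) ^+ d * B / a)%:E)%E.
Proof.
move=> m0 tf f0 a0 mf.
pose A : set BV := [set k | a <= complex.Re (f k)]; rewrite -/A.
have mA : measurable (A : set BV) by exact: measurable_tp_ge.
have mAc : measurable (A `&` cbox m%:R : set BV) by apply: measurableI => //; exact: measurable_cbox.
have [i1 _] := cintegrable_tp m tf.
have m0' : 0 < (2 * m%:R) ^+ d :> R by rewrite exprn_gt0// mulr_gt0// ltr0n.
have Ref k : 0 <= complex.Re (f k) by rewrite -ler0c -rc_ge0.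
have H : (a%:E * leb (A `&` cbox m%:R) <= ((2 * m%:R) ^+ d * B)%:E)%E.
  rewrite -integral_cst//.
  apply: (@le_trans _ _ (\int[leb]_(k in A `&` cbox m%:R) (complex.Re (f k))%:E)%E).
    apply: ge0_le_integral => //.
    - by move=> k _; rewrite lee_fin ltW.
    - by apply/measurable_EFinP/measurable_funTS; exact: tp_Re_measurable.
    - by move=> k [Ak _]; rewrite lee_fin.
  apply: (@le_trans _ _ (\int[leb]_(k in cbox m%:R) (complex.Re (f k))%:E)%E).
    apply: ge0_subset_integral => //.
    - exact: measurable_cbox.
    - by apply/measurable_EFinP/measurable_funTS; exact: tp_Re_measurable.
    - by move=> k _; rewrite lee_fin.
  rewrite -[leLHS]fineK; last first.
    by apply: (integrable_fin_num _ i1); exact: measurable_cbox.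
  rewrite lee_fin le_eqVlt; apply/orP; left; apply/eqP.
  have : complex.Re ((2 * m%:R) ^+ d * mean m f) = (2 * m%:R) ^+ d * B.
    by rewrite mf -(rc_nat 2) -(rc_nat m) -rcM -rcX -rcM.
  rewrite /mean mulVKf//; last first.
    by rewrite expf_neq0// mulf_neq0 ?pnatr_eq0 -?lt0n.
by rewrite mulrC EFinM lee_pdivlMl.
Qed.

End LebesgueMarkov.

(** * Where the test polynomial is bounded below *)

Section GoodSets.
Context {R : realType} {d : nat} (n : 'I_d -> nat) (n_ge2 : forall i, (2 <= n i)%N).
Hypothesis d_gt0 : (0 < d)%N.
Variable rho : block_substitution n.
Local Notation V := ('rV[R]_d).
Local Notation BV := (borel_rV R d).
Local Notation leb := (@lebesgue_rV R d).
Local Notation C := (R[i]).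
Local Notation N := (#|{: block_pos n}|).
Local Notation F := (@dil R d n).
Local Notation majorantprod := (@majorantprod R d n rho).
Local Notation avg := (@avg R d n).
Local Notation testpoly := (@testpoly R d n rho).

Let N_gt0 : (0 < N)%N. Proof. exact: ltnW (card_block_pos_ge2 n_ge2 d_gt0). Qed.

(* The set on which [testpoly] may be small; its proportion in every box
   [-m, m]^d is small. *)
Definition exceptional (T q l : nat) : set BV :=
  [set k | T%:R^-1 <= complex.Re (majorantprod q k)] `|`
  [set k | T%:R^-1 <= complex.Re (majorantprod q (F k))] `|`
  [set k | 4^-1 <= complex.Re (`|avg (q + q) l k| ^+ 2)].

Let tVq q := @tp_majorantprod R d n n_ge2 d_gt0 rho q.
Let tavg K l : tp (fun k => `|avg K l k| ^+ 2) := tp_sqnorm (tp_avg n K l).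

Lemma measurable_exceptional T q l : measurable (exceptional T q l).
Proof.
apply: measurableU; last exact: measurable_tp_ge.
apply: measurableU; first exact: measurable_tp_ge.
exact: (measurable_tp_ge _ (tp_dil n (tVq q))).
Qed.

Let r := complex.Re (mean 1 (@majorant R d n rho)).

(** Markov's inequality three times. Dilation by n does not change the mean of [majorantprod q], so
    the first two sets share the bound r^q T; the third polynomial has mean 1/l and threshold
    1/4. *)
Lemma leb_exceptional T q l m : (0 < T)%N -> (0 < l)%N -> (0 < m)%N ->
  (leb (exceptional T q l `&` cbox m%:R) <=
    ((2 * m%:R) ^+ d * (2 * (r ^+ q * T%:R) + 4 / l%:R))%:E)%E.
Proof.
move=> T0 l0 m0.
have T0' : 0 < T%:R^-1 :> R by rewrite invr_gt0 ltr0n.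
have mV : mean m (majorantprod q) = (r ^+ q)%:C.
  have H0 := @mean_majorant_ge0 R d n n_ge2 d_gt0 rho 1.
  rewrite mean_majorantprod// (@mean_indep _ _ m 1)//; last exact: (tpb_tp (tpb_majorant n_ge2 d_gt0 rho)).
  by rewrite rcX -rc_ge0.
have V0 := @majorantprod_ge0 R d n n_ge2 d_gt0 rho q.
have h1 := markov_mean m0 (tVq q) V0 T0' mV.
have mV' : mean m (fun k => majorantprod q (F k)) = (r ^+ q)%:C.
  by rewrite (mean_dil m0 _ (tVq q))// => i; exact: ltnW.
have h2 := markov_mean m0 (tp_dil n (tVq q)) (fun k => V0 (F k)) T0' mV'.
have mA : mean m (fun k => `|avg (q + q) l k| ^+ 2) = (l%:R^-1)%:C.
  by rewrite mean_avg// rcV rc_nat.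
have q0 : 0 < 4^-1 :> R by [].
have h3 := markov_mean m0 (tavg (q + q) l) (fun k => exprn_ge0 _ (normr_ge0 _)) q0 mA.
rewrite /exceptional !setIUl.
have mc := @measurable_cbox R d m%:R.
have m1 : measurable ([set k | T%:R^-1 <= complex.Re (majorantprod q k)] `&` cbox m%:R : set BV).
  by apply: measurableI => //; exact: measurable_tp_ge.
have m2 : measurable ([set k | T%:R^-1 <= complex.Re (majorantprod q (F k))] `&` cbox m%:R : set BV).
  by apply: measurableI => //; exact: (measurable_tp_ge _ (tp_dil n (tVq q))).
have m3 : measurable ([set k | 4^-1 <= complex.Re (`|avg (q + q) l k| ^+ 2)] `&` cbox m%:R : set BV).
  by apply: measurableI => //; exact: measurable_tp_ge.
apply: (le_trans (measureU2 _ _ _)) => //; first exact: measurableU.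
apply: (le_trans (leeD (measureU2 _ _ _) h3)) => //.
apply: (le_trans (leeD (leeD h1 h2) (lexx _))).
rewrite -!EFinD lee_fin !invrK le_eqVlt; apply/orP; left; apply/eqP; ring.
Qed.

(** Off the exceptional set |E_K|^2 <= N^K T^-4 with K = 2q, so m x <= T^-2 <= 1/4 and Bernoulli
    gives (1 - x)^m >= 1/2. Moreover |[avg]| < 1/2, so both factors are at least 1/2 in absolute
    value, whence 1/16. *)
Lemma testpoly_ge T q l k : (2 <= T)%N -> ~ exceptional T q l k ->
  16^-1 <= complex.Re (`|testpoly (q + q) (N ^ (q + q) * T ^ 2) l k| ^+ 2).
Proof.
move=> T2 /not_orP[/not_orP[/negP h1 /negP h2] /negP h3].
rewrite -ltNge in h1; rewrite -ltNge in h2; rewrite -ltNge in h3.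
have V0 := @majorantprod_ge0 R d n n_ge2 d_gt0 rho q.
have T0 : 0 < T%:R :> R by rewrite ltr0n ltnW.
have NK : 0 < N%:R ^+ (q + q) :> R by rewrite exprn_gt0// ltr0n.
set m := (N ^ (q + q) * T ^ 2)%N.
have [x [x0 x1 xE dE]] := dampE n_ge2 d_gt0 rho (q + q) m k.
have mx : m%:R * x <= 4^-1.
  have := cocycle_le_majorantprod n_ge2 d_gt0 rho q k.
  rewrite xE (rc_ge0 (V0 k)) (rc_ge0 (V0 (F k))).
  set a := complex.Re _ in h1 *; set b := complex.Re _ in h2 *.
  have a0 : 0 <= a by rewrite -ler0c -rc_ge0.
  have b0 : 0 <= b by rewrite -ler0c -rc_ge0.
  rewrite -(rc_nat N) -!rcX -!rcM lecR exprD -mulrA ler_pM2l// => H.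
  have ab : a ^+ 2 * b ^+ 2 <= T%:R^-1 ^+ 2 * T%:R^-1 ^+ 2.
    by apply: ler_pM; rewrite ?sqr_ge0// lerXn2r ?nnegrE ?invr_ge0// ltW.
  have t2 : T%:R^-1 <= 2^-1 :> R by rewrite lef_pV2 ?posrE// ler_nat.
  rewrite /m natrM !natrX mulrAC mulrC.
  apply: (@le_trans _ _ (T%:R ^+ 2 * (T%:R^-1 ^+ 2 * T%:R^-1 ^+ 2))).
    by rewrite ler_wpM2l ?exprn_ge0// (le_trans H).
  rewrite mulrA -exprMn mulfV ?gt_eqF// expr1n mul1r.
  rewrite (_ : 4^-1 = 2^-1 ^+ 2); last by rewrite exprVn -natrX.
  by rewrite lerXn2r ?nnegrE ?invr_ge0.
clearbody m.
have bern j : 1 - j%:R * x <= (1 - x) ^+ j.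
  elim: j => [|j IH]; first by rewrite mul0r subr0 expr0.
  have y0 : 0 <= 1 - x by rewrite subr_ge0.
  rewrite exprS (le_trans _ (ler_wpM2l y0 IH))//.
  have : 0 <= j%:R * x * x by rewrite !mulr_ge0.
  by rewrite -natr1; nra.
have d2 : 2^-1 <= (1 - x) ^+ m by have := bern m; lra.
pose y := complex.Re `|avg (q + q) l k|; pose z := complex.Re `|1 - avg (q + q) l k|.
have yE : `|avg (q + q) l k| = y%:C by exact: rc_ge0.
have zE : `|1 - avg (q + q) l k| = z%:C by exact: rc_ge0.
have y0 : 0 <= y by rewrite -ler0c -yE.
have z2 : 2^-1 <= z.
  have := lerB_dist 1 (avg (q + q) l k); rewrite normr1 yE zE -[1 in X in X -> _](rc_nat 1) -rcB lecR.
  have : y < 2^-1.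
    rewrite -(@ltr_pXn2r _ 2)// ?nnegrE ?invr_ge0// exprVn -natrX.
    by move: h3; rewrite yE -rcX.
  lra.
rewrite /testpoly normrM exprMn dE zE ger0_norm; last by rewrite ler0c; lra.
rewrite -!rcX -rcM [leRHS]/=.
rewrite (_ : 16^-1 = 2^-1 ^+ 2 * 2^-1 ^+ 2); last by rewrite !expr2; field.
by apply: ler_pM; rewrite ?exprn_ge0 ?invr_ge0// lerXn2r ?nnegrE ?invr_ge0//; lra.
Qed.

End GoodSets.

(** * Exceptional sets *)

Section SmallBadSets.
Context {R : realType} {d : nat} (n : 'I_d -> nat) (n_ge2 : forall i, (2 <= n i)%N).
Hypothesis d_gt0 : (0 < d)%N.
Variable rho : block_substitution n.
Variables (w : 'rV[int]_d -> 'I_2) (w_hull : in_hull n_ge2 rho w) (u : 'I_2 -> R[i]).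
Variable gamma : ('rV[R]_d -> R[i]) -> R[i].
Hypothesis gammaP : is_autocorrelation (fun x => u (w x)) gamma.
Variable gammahat : {measure set (borel_rV R d) -> \bar R}.
Hypothesis gammahatP : is_fourier_transform gamma gammahat.
Local Notation V := ('rV[R]_d).
Local Notation BV := (borel_rV R d).
Local Notation leb := (@lebesgue_rV R d).
Local Notation C := (R[i]).
Local Notation N := (#|{: block_pos n}|).

Let N_gt0 : (0 < N)%N. Proof. exact: ltnW (card_block_pos_ge2 n_ge2 d_gt0). Qed.

(** Sets on which the weight in [markov_hat] is bounded below; countably many of them cover the
    space ([level_cover]). *)
Definition level (e : R) (i : nat) : set BV := [set k | i.+1%:R^-1 <= Phi e k ^+ 2].

Lemma measurable_level e i : 0 < e -> measurable (level e i).
Proof.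
move=> e0; rewrite (_ : level e i = (fun k : BV => Phi e k ^+ 2) @^-1` `[i.+1%:R^-1, +oo[).
  by rewrite -[X in measurable X]setTI; apply: (Phi_measurable gammahatP e0).
by apply/seteqP; split => k; rewrite /level /= in_itv /= andbT.
Qed.

(** The first 16 comes from [mean_testpoly_windowsum], the second from the bound 1/16 in
    [testpoly_ge], and i + 1 from [level]. *)
Definition level_const (e : R) (i : nat) : R :=
  @bump20 R d e * (16 * beta2 u) * (16 * i.+1%:R).

Lemma hat_compl_exceptional (e : R) (i T q l : nat) : 0 < e -> 2 * e <= 1 ->
  (2 <= T)%N -> (0 < l)%N ->
  (gammahat (~` exceptional rho T q l `&` level e i) <= (level_const e i / T%:R ^+ 2)%:E)%E.
Proof.
move=> e0 e1 T2 l0; set K := (q + q)%N.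
have T0 : (0 < T)%N by exact: ltnW.
pose m := (N ^ K * T ^ 2)%N.
have m0 : (0 < m)%N by rewrite muln_gt0 !expn_gt0 N_gt0 T0.
pose f (k : V) : C := `|testpoly rho K m l k| ^+ 2.
have tf : tp f by exact/tp_sqnorm/tp_testpoly.
have f0 k : 0 <= f k by exact: exprn_ge0.
have H := hatint_le gammaP gammahatP e0 e1 tf f0
  (fun a a0 => mean_testpoly_windowsum d_gt0 w_hull u K m0 l0 a0).
have a0 : 0 < 16^-1 * i.+1%:R^-1 :> R by rewrite mulr_gt0 ?invr_gt0 ?ltr0n.
have mA : measurable (~` exceptional rho T q l `&` level e i).
  apply: measurableI; last exact: measurable_level.
  by apply: measurableC; exact: (measurable_exceptional n_ge2 d_gt0).
apply: (le_trans (markov_hat gammahatP e0 tf f0 mA a0 _ H)).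
  move=> k [nb lk]; apply: ler_pM => //.
  exact: (testpoly_ge n_ge2 d_gt0).
rewrite lee_fin le_eqVlt; apply/orP; left; apply/eqP.
rewrite /level_const /m natrM !natrX; field.
by rewrite nat1r expf_neq0 !pnatr_eq0 -?lt0n ?T0.
Qed.

(** One set has to serve all boxes and all tents, so it is chosen from [eta] alone. *)
Lemma exists_exceptional (eta : R) : 0 < eta -> exists A : set BV, [/\ measurable A,
  forall m, (0 < m)%N -> (leb (A `&` cbox m%:R) <= ((2 * m%:R) ^+ d * eta)%:E)%E &
  forall e i, 0 < e -> 2 * e <= 1 ->
    (gammahat (~` A `&` level e i) <= (level_const e i * eta)%:E)%E].
Proof.
move=> eta0.
pose r := complex.Re (mean 1 (@majorant R d n rho)).
have /andP[r0 r1] : 0 <= r < 1.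
  have H1 := @mean_majorant_lt1 R d n n_ge2 d_gt0 rho 1 isT.
  have H0 := @mean_majorant_ge0 R d n n_ge2 d_gt0 rho 1.
  by rewrite -ler0c -ltcR -(rc_ge0 H0) H0 H1.
pose T := (Num.truncn eta^-1).+2.
have T2 : (2 <= T)%N by [].
have Teta : T%:R^-1 <= eta.
  by rewrite invf_ple ?posrE// ?ltr0n// (le_trans (ltW (truncnS_gt _)))// ler_nat.
pose l := (Num.truncn (8 / eta)).+1.
have leta : 4 / l%:R <= eta / 2.
  rewrite ler_pdivrMr ?ltr0n// mulrC mulrA ler_pdivlMr// -ler_pdivrMr// -natrM.
  by rewrite (le_trans (ltW (truncnS_gt _))).
have [q Hq] : exists q, 2 * (r ^+ q * T%:R) <= eta / 2.
  have r1' : `|r| < 1 by rewrite ger0_norm.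
  have a0 : 0 < eta / 2 / (2 * T%:R) by rewrite !divr_gt0// mulr_gt0// ltr0n.
  have /cvgrPdist_lt/(_ _ a0)[q _ H] := cvg_expr r1'.
  exists q; have := H q (leqnn q); rewrite /= sub0r normrN ger0_norm ?exprn_ge0//.
  by rewrite ltr_pdivlMr ?mulr_gt0 ?ltr0n// => /ltW; rewrite mulrCA.
exists (exceptional rho T q l); split.
- exact: (measurable_exceptional n_ge2 d_gt0).
- move=> m m0; apply: (le_trans (@leb_exceptional R d n n_ge2 d_gt0 rho T q l m isT isT m0)).
  rewrite lee_fin ler_wpM2l ?exprn_ge0 ?mulr_ge0// -/r; lra.
move=> e i e0 e1; apply: (le_trans (@hat_compl_exceptional e i T q l e0 e1 T2 isT)).
rewrite lee_fin ler_wpM2l//.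
  by rewrite /level_const !mulr_ge0 ?bump20_ge0 ?beta2_ge0.
rewrite -exprVn (le_trans _ Teta)// expr2 ler_piMl ?invr_ge0//.
by rewrite invf_le1 ?ltr0n// ler1n.
Qed.

(** The phase at k is at most S e on a tent of radius e. As p + 1 > S, the radius 1 / (2 (p + 1))
    satisfies the condition S e <= 1/2 of [Phi_gt0]. *)
Lemma level_cover (k : BV) : exists p i, level (2 * p.+1%:R)^-1 i k.
Proof.
pose S : R := 2 * pi * (\sum_i `|(k : V) 0 i|).
have S0 : 0 <= S by rewrite !mulr_ge0 ?pi_ge0// sumr_ge0.
pose p := Num.truncn S.
have p0 : 0 < (2 * p.+1%:R)^-1 :> R by rewrite invr_gt0 mulr_gt0.
have P0 : 0 < Phi (2 * p.+1%:R)^-1 k.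
  apply: Phi_gt0 => //; rewrite -/S invfM mulrCA ger_pMr//.
  by rewrite ler_pdivrMr ?ltr0n// mul1r ltW// truncnS_gt.
exists p, (Num.truncn (Phi (2 * p.+1%:R)^-1 k ^+ 2)^-1).
have P2 : 0 < Phi (2 * p.+1%:R)^-1 k ^+ 2 by exact: exprn_gt0.
by rewrite /level /= invf_ple ?posrE ?ltr0n// ltW// truncnS_gt.
Qed.

Lemma diffraction_singular : mutually_singular gammahat leb.
Proof.
(* The choice eta_j = 2^-(j+1) is summable, as Borel-Cantelli requires. *)
have eta0 j : 0 < 1 / (2 ^ j.+1)%:R :> R by rewrite divr_gt0// ltr0n expn_gt0.
pose A j := projT1 (cid (exists_exceptional (eta0 j))).
have mA j : measurable (A j) by rewrite /A; case: cid => /= B [].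
have lA j m : (0 < m)%N ->
    (leb (A j `&` cbox m%:R) <= ((2 * m%:R) ^+ d / (2 ^ j.+1)%:R)%:E)%E.
  by rewrite /A; case: cid => /= B [_ H _] m0; have := H m m0; rewrite div1r.
have hA j e i : 0 < e -> 2 * e <= 1 ->
    (gammahat (~` A j `&` level e i) <= (level_const e i / (2 ^ j.+1)%:R)%:E)%E.
  by rewrite /A; case: cid => /= B [_ _ H] e0 e1; have := H e i e0 e1; rewrite div1r.
have mN : measurable (lim_sup_set A).
  by apply: bigcap_measurable => // j _; apply: bigcup_measurable.
exists (lim_sup_set A); split=> //.
- apply/(negligibleP leb mN).
  (* The bounds on [A j] are relative to boxes, so Borel-Cantelli is applied to Lebesgue measure
     restricted to each box. *)
  have : lim_sup_set A `<=` \bigcup_m (lim_sup_set A `&` cbox m.+1%:R).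
    move=> v Av; exists (Num.truncn `|v|) => //; split => // i.
    by rewrite -ler_norml (le_trans (coord_le_norm _ _))// ltW// truncnS_gt.
  move/negligibleS; apply; apply: negligible_bigcup => m.
  have mc := @measurable_cbox R d m.+1%:R.
  apply/(negligibleP leb (measurableI _ _ mN mc)).
  apply: (lim_sup_set_cvg0 (mu := mrestr leb mc)) => //.
  have M0 : 0 <= (2 * m.+1%:R) ^+ d :> R by rewrite exprn_ge0// mulr_ge0.
  have := @epsilon_trick R (fun=> 0%E) _ xpredT (fun=> lexx _) M0.
  move=> /le_lt_trans-/(_ +oo%E) H.
  apply: le_lt_trans (H _); last by rewrite eseries0// add0e ltry.
  apply: lee_nneseries => // j _; rewrite add0e; exact: lA.
apply/(negligibleP gammahat (measurableC mN)).
(* A point outside the upper limit avoids all [A j] from some J on and lies in some level set. On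
   each such piece the bound holds for every j >= J, so the piece is null. *)
have : ~` lim_sup_set A `<=` \bigcup_J \bigcup_p \bigcup_i
    ((\bigcap_(j >= J) ~` A j) `&` level (2 * p.+1%:R)^-1 i).
  move=> k; rewrite /lim_sup_set setC_bigcap => -[J _]; rewrite setC_bigcup => Jk.
  have [p [i pik]] := level_cover k.
  by exists J => //; exists p => //; exists i.
move/negligibleS; apply.
apply: negligible_bigcup => J; apply: negligible_bigcup => p; apply: negligible_bigcup => i.
set e := (2 * p.+1%:R)^-1.
have e0 : 0 < e by rewrite invr_gt0 mulr_gt0.
have e1 : 2 * e <= 1.
  by rewrite /e invfM mulrA mulfV// mul1r invf_le1// ler1n.
have mB : measurable ((\bigcap_(j >= J) ~` A j) `&` level e i).
  apply: measurableI; last exact: measurable_level.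
  by apply: bigcap_measurable => [|j _]; [exists J => /=|exact: measurableC].
apply/(negligibleP gammahat mB).
apply/eqP; rewrite eq_le measure_ge0 andbT.
apply/lee_addgt0Pr => a a0; rewrite add0e.
have L0 : 0 <= level_const e i by rewrite /level_const !mulr_ge0 ?bump20_ge0 ?beta2_ge0.
(* Then 2^(j+1) >= j + 1 > [level_const e i] / a, so the bound is at most a. *)
pose j := (J + Num.truncn (level_const e i / a))%N.
have mC : measurable (~` A j `&` level e i).
  by apply: measurableI; [exact: measurableC|exact: measurable_level].
apply: (@le_trans _ _ (gammahat (~` A j `&` level e i))).
  apply: le_measure; rewrite ?inE// => k [Hk lk]; split=> //.
  by apply: Hk => /=; rewrite leq_addr.
apply: (le_trans (hA j e i e0 e1)).
rewrite lee_fin ler_pdivrMr ?ltr0n ?expn_gt0// mulrC -ler_pdivrMr//.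
rewrite (le_trans (ltW (truncnS_gt _)))// ler_nat.
apply: (@leq_trans j.+1); first by rewrite ltnS leq_addl.
by rewrite ltnW// ltn_expl.
Qed.

End SmallBadSets.

Theorem theorem7p1 (R : realType) (d : nat) (d_ge2 : (2 <= d)%N)
    (n : 'I_d -> nat) (n_ge2 : forall i, (2 <= n i)%N)
    (rho : block_substitution n) (rho_prim : primitive_substitution rho)
    (w : 'rV[int]_d -> 'I_2) (w_hull : in_hull n_ge2 rho w)
    (u : 'I_2 -> R[i])
    (gamma : ('rV[R]_d -> R[i]) -> R[i])
    (gammaP : is_autocorrelation (fun x => u (w x)) gamma)
    (gammahat : {measure set (borel_rV R d) -> \bar R})
    (gammahatP : is_fourier_transform gamma gammahat) :
  mutually_singular gammahat (lebesgue_rV d).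
Proof. exact: (diffraction_singular (ltnW d_ge2) w_hull gammaP gammahatP). Qed.
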